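(* Let $q$ be a prime power and $n$ a positive integer. There exists an element of $\mathbb{F}_{q^n}$ that is primitive and $2$-normal over $\mathbb{F}_q$ if and only if either $n \geq 5$ and $\gcd(q^3-q,n) \neq 1$, or $n=4$ and $q \equiv 1 \pmod 4$.
   Context: An element $\alpha \in \mathbb{F}_{q^n}$ is primitive if it generates the cyclic group $\mathbb{F}_{q^n}^*$. For $\alpha\in\mathbb{F}_{q^n}$ let $g_\alpha(x)=\sum_{i=0}^{n-1}\alpha^{q^i}x^{n-1-i}\in\mathbb{F}_{q^n}[x]$; $\alpha$ is called $k$-normal over $\mathbb{F}_q$ if $\gcd(x^n-1,g_\alpha(x))$ in $\mathbb{F}_{q^n}[x]$ has degree $k$ (equivalently, the $\mathbb{F}_q$-span of $\alpha,\alpha^q,\dots,\alpha^{q^{n-1}}$ has dimension $n-k$). *)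

(* Defs.v *)
From HB Require Import structures.
From mathcomp Require Import all_boot all_order all_algebra all_field.
Set Implicit Arguments. Unset Strict Implicit. Unset Printing Implicit Defensive.
Import GRing.Theory.
Local Open Scope ring_scope.

Definition primitive_elt (L : fieldType) (a : L) : Prop :=
  a != 0 /\ forall y : L, y != 0 -> exists k : nat, y = a ^+ k.

Definition g_poly (L : fieldType) (q n : nat) (a : L) : {poly L} :=
  \sum_(i < n) (a ^+ (q ^ i)) *: 'X^(n.-1 - i).

Definition k_normal (L : fieldType) (q n k : nat) (a : L) : Prop :=
  (size (gcdp ('X^n - 1) (g_poly q n a))).-1 = k.

(* Main.v *)
(* Let F[X] act on L by X . a = a^q, q = #|F|. An element is 2-normal iff its annihilator is
   f = (X^n - 1) / D for some D of degree 2; companion matrices and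
   Cauchy's theorem in GL_2(F) show that such a D exists iff gcd(q^3 - q, n) <> 1. Multiplying by elements of F^* reduces primitivity
   to the primes dividing M = (q^n - 1) / (q - 1).
   For n >= 5, character sums over the subspaces ker g, g | X^n - 1, are at most q^(n/2), and sieving
   gives an element with annihilator f that generates L^* / F^* for all but finitely many (q, n); for
   these a suitable element is written down. For n = 4 the subspaces have dimension 2 and the trivial bound
   fails. There D = (X + 1)(X + i) with i^2 = -1, and one looks for y + t with y^q = i y, t in F: by
   Stepanov's method, character sums over this line are at most 2 sqrt q. The class of y generates the
   2-part of L^* / F^*, so only odd primes are sieved; this again leaves finitely many q. For q not
   congruent to 1 modulo 4 the only D dividing X^4 - 1 are X^2 - 1 and X^2 + 1, which force the order of
   a to be small. *)
Require Import Defs.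
From Stdlib Require Import BinNat Nnat.
From HB Require Import structures.
From mathcomp Require Import all_boot all_order all_algebra all_field all_fingroup all_solvable.
From mathcomp Require Import zify ring.
Set Implicit Arguments. Unset Strict Implicit. Unset Printing Implicit Defensive.
Import Order.TTheory GRing.Theory Num.Theory.
Local Open Scope ring_scope.

(** * The sieve *)

(** The irreducible factors r of f obstruct in the same way as the primes of M, and they are met in
    two ways. [mode1_criterion] removes the smaller kernels by a union bound: cheap in error terms,
    but the sum of the q^(-deg r) must stay below 1. [mode2_criterion] uses inclusion-exclusion: the
    density prod (1 - q^(-deg r)) is always positive, at the price of a factor 2 in the error for
    every r. The primes are split as well: each one in K doubles the error, while one in R only adds
    to it but costs its reciprocal in the main term. For a whole range of q the primes of M are
    unknown. [cover] replaces them by lower bounds, entry by entry, as long as the product stays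
    below a bound for M; one comparison of integers then settles an interval of q. Beyond explicit
    bounds all primes go into K, and comparing their product with a power of 256 or 512 limits their
    number. *)

Lemma one_subV_mul (l : nat) (t : algC) : (0 < l)%N -> (1 - l%:R^-1) * t = l%:R^-1 * (t *+ (l - 1)).
Proof.
move=> l0; rewrite -[t *+ _]mulr_natl mulrA natrB // mulrBr mulVf ?mulr1 //.
by rewrite pnatr_eq0 -lt0n.
Qed.

Section Sieve.
Variables (T : finType) (X : {set T}) (e : T -> nat) (M : nat) (z : algC).
Hypothesis M_gt0 : (0 < M)%N.
Hypothesis zM : z ^+ M = 1.
Hypothesis z_prim : forall j, z ^+ j = 1 -> (M %| j)%N.

Definition avoids (ls : seq nat) (x : T) := all (fun l => ~~ (l %| e x)%N) ls.
Definition sift_sum ls j : algC := \sum_(x in X | avoids ls x) z ^+ (j * e x).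
Definition sift_density (ls : seq nat) : algC := \prod_(l <- ls) (1 - l%:R^-1).
Definition sift_count ls : nat := #|[set x in X | avoids ls x]|.

Lemma sift_sum0 ls : sift_sum ls 0 = (sift_count ls)%:R.
Proof.
rewrite /sift_sum /sift_count -sum1_card natr_sum.
by apply: eq_big => [x|x _]; rewrite ?inE ?mul0n.
Qed.

(** Orthogonality of the characters of Z/l: z^((M / l) e(x)) is an l-th root of unity, equal to 1
    exactly when l divides e(x), so its powers sum to l or to 0. *)
Lemma not_dvd_indicator l x : (0 < l)%N -> (l %| M)%N ->
  (~~ (l %| e x)%N)%:R = (1 - l%:R^-1) - l%:R^-1 * \sum_(1 <= i < l) z ^+ (i * (M %/ l) * e x).
Proof.
move=> l0 lM; have l0' : l%:R != 0 :> algC by rewrite pnatr_eq0 -lt0n.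
have Ml : (M %/ l * l = M)%N by rewrite divnK.
set w := z ^+ ((M %/ l) * e x).
have E i : z ^+ (i * (M %/ l) * e x) = w ^+ i by rewrite /w -exprM; congr (_ ^+ _); lia.
under eq_bigr => i _ do rewrite E.
have wl : w ^+ l = 1.
  by rewrite /w -exprM mulnAC Ml exprM zM expr1n.
have S : \sum_(0 <= i < l) w ^+ i = 1 + \sum_(1 <= i < l) w ^+ i.
  by rewrite big_ltn // expr0.
have [le|nle] := boolP (l %| e x)%N.
  have w1 : w = 1.
    have /dvdnP [c ec] := le.
    by rewrite /w ec mulnCA Ml mulnC exprM zM expr1n.
  under eq_bigr => i _ do rewrite w1 expr1n.
  rewrite big_const_nat iter_addr_0 subn1 /= -[_ *+ _]mulr_natl mulr1 -subn1 natrB //.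
  by rewrite mulrBr mulVf // mulr1 subrr.
have w1 : w - 1 != 0.
  rewrite subr_eq0; apply/eqP => /z_prim /dvdnP [c H].
  move/negP: nle; apply; apply/dvdnP; exists c.
  have : (M %/ l * e x = M %/ l * (c * l))%N by rewrite H mulnCA Ml.
  have : (0 < M %/ l)%N by rewrite divn_gt0 // dvdn_leq.
  by move=> h /eqP; rewrite eqn_pmul2l // => /eqP.
have := subrX1 w l; rewrite wl subrr => /esym/eqP; rewrite mulf_eq0 (negbTE w1) /=.
rewrite -(big_mkord xpredT (fun i => w ^+ i)) S addr_eq0 => /eqP E1.
have -> : \sum_(1 <= i < l) w ^+ i = -1 by rewrite E1 opprK.
by rewrite mulrN1 opprK subrK.
Qed.

Lemma sift_sum_cons l ls j : (0 < l)%N -> (l %| M)%N ->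
  sift_sum (l :: ls) j = (1 - l%:R^-1) * sift_sum ls j
    - l%:R^-1 * \sum_(1 <= i < l) sift_sum ls (j + i * (M %/ l)).
Proof.
move=> l0 lM; rewrite /sift_sum exchange_big /= !mulr_sumr -sumrB.
rewrite (bigID (fun x => ~~ (l %| e x)%N)) /= [X in _ = X](bigID (fun x => ~~ (l %| e x)%N)) /=.
have E x : (1 - l%:R^-1) * z ^+ (j * e x) -
     l%:R^-1 * (\sum_(1 <= i < l) z ^+ ((j + i * (M %/ l)) * e x)) =
     z ^+ (j * e x) * (~~ (l %| e x)%N)%:R.
  rewrite (not_dvd_indicator x l0 lM) mulrBr mulrC; congr (_ - _).
  rewrite mulrCA; congr (_ * _); rewrite mulr_sumr; apply: eq_bigr => i _.
  by rewrite mulnDl exprD.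
rewrite [X in _ = _ + X]big1 ?addr0; last first.
  by move=> x /andP [_ h]; rewrite E (negbTE h) mulr0.
rewrite [X in _ + X]big1 ?addr0; last by move=> x; rewrite -!andbA => /and4P [_ ->].
apply: eq_big => [x|x /andP [_ h]]; last by rewrite E h mulr1.
by rewrite -!andbA /=; case: (l %| e x)%N; rewrite /= ?andbF ?andbT.
Qed.

Lemma sift_density_gt0 ls : all (leq 2) ls -> 0 < sift_density ls.
Proof.
move=> /allP h; rewrite /sift_density big_seq; apply: prodr_gt0 => l /h l2.
by rewrite subr_gt0 invf_lt1 ?ltr1n // ltr0n ltnW.
Qed.

Variable B : algC.
Hypothesis B0 : 0 <= B.
Hypothesis hB : forall j, ~~ (M %| j)%N -> `|\sum_(x in X) z ^+ (j * e x)| <= B.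

Definition primes_of ls := [&& all prime ls, uniq ls & all (fun l => l %| M)%N ls].

Lemma primes_of_cons l ls : primes_of (l :: ls) = [&& prime l, (l %| M)%N, l \notin ls & primes_of ls].
Proof.
rewrite /primes_of /=; case: (prime l) => //=; case: (l \notin ls); rewrite ?andbF //=.
by case: (uniq ls); rewrite ?andbF //= andbCA.
Qed.

(** Each use of [sift_sum_cons] shifts the frequency by multiples of M / l. Multiplying by the
    product of the primes removes these shifts modulo M, so the hypothesis survives the recursion
    and every sum reached is nontrivial. The unshifted term and the l - 1 shifted ones contribute
    equally, whence one factor 2 per prime. *)
Lemma sift_sum_bound ls j : primes_of ls -> ~~ (M %| j * \prod_(l <- ls) l)%N ->
  `|sift_sum ls j| <= sift_density ls * 2 ^+ size ls * B.
Proof.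
elim: ls j => [|l ls IH] j.
  move=> _; rewrite big_nil muln1 => /hB; rewrite /sift_sum /sift_density big_nil /= expr0 !mul1r.
  by move=> h; under eq_bigl => x do rewrite andbT.
rewrite primes_of_cons => /and4P [lp lM _ pls]; rewrite big_cons => nd.
have l0 := prime_gt0 lp; have l0' : (0 : algC) < l%:R by rewrite ltr0n.
have Ml : (M %/ l * l = M)%N by rewrite divnK.
rewrite sift_sum_cons //; set t := sift_density ls * 2 ^+ size ls * B.
have bi i : `|sift_sum ls (j + i * (M %/ l))| <= t.
  apply: IH => //; apply: contra nd => h.
  have : (M %| (j + i * (M %/ l)) * (\prod_(k <- ls) k) * l)%N by apply: dvdn_mulr.
  have -> : ((j + i * (M %/ l)) * \prod_(k <- ls) k * l =
     j * (l * \prod_(k <- ls) k) + M * (i * \prod_(k <- ls) k))%N.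
    by move: Ml; move: (M %/ l)%N (\prod_(k <- ls) k)%N => a b <-; lia.
  by rewrite dvdn_addl // dvdn_mulr.
have b0 : `|sift_sum ls j| <= t by have := bi 0%N; rewrite mul0n addn0.
have d0 : 0 <= 1 - (l%:R^-1 : algC) by rewrite subr_ge0 invf_le1 ?ler1n.
apply: le_trans (ler_normB _ _) _; rewrite !normrM (ger0_norm d0) normfV normr_nat.
have -> : sift_density (l :: ls) * 2 ^+ size (l :: ls) * B =
   (1 - l%:R^-1) * t + (1 - l%:R^-1) * t.
  by rewrite /t /sift_density big_cons exprS; ring.
apply: lerD; first by rewrite ler_wpM2l.
have -> : (1 - l%:R^-1) * t = l%:R^-1 * (t *+ (l - 1)).
  exact: one_subV_mul.
rewrite ler_wpM2l ?invr_ge0 ?ler0n //.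
apply: (le_trans (ler_norm_sum _ _ _)).
apply: le_trans (ler_sum _ (fun i _ => bi i)) _.
by rewrite big_const_nat iter_addr_0.
Qed.

(** At frequency 0 the unshifted term is the old count itself. Only the shifts i M / l with 0 < i <
    l remain, and they stay nontrivial because l divides neither i nor the product of [ls]. *)
Lemma sift_count_step l ls : primes_of (l :: ls) ->
  `|(sift_count (l :: ls))%:R - (1 - l%:R^-1) * (sift_count ls)%:R|
    <= (1 - l%:R^-1) * (sift_density ls * 2 ^+ size ls * B).
Proof.
rewrite primes_of_cons => /and4P [lp lM nl pls].
have l0 := prime_gt0 lp; have l0' : (0 : algC) < l%:R by rewrite ltr0n.
have Ml : (M %/ l * l = M)%N by rewrite divnK.
rewrite -!sift_sum0 sift_sum_cons // addrAC subrr add0r normrN.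
set t := sift_density ls * _ * B.
have -> : (1 - l%:R^-1) * t = l%:R^-1 * (t *+ (l - 1)).
  exact: one_subV_mul.
rewrite normrM normfV normr_nat ler_wpM2l ?invr_ge0 ?ler0n //.
apply: (le_trans (ler_norm_sum _ _ _)).
have -> : t *+ (l - 1) = \sum_(1 <= i < l) t by rewrite big_const_nat iter_addr_0.
rewrite big_nat_cond [X in _ <= X]big_nat_cond.
apply: ler_sum => i /andP [/andP [i1 il] _]; apply: sift_sum_bound => //.
rewrite add0n; apply/negP => /dvdnP [c H].
have H1 : (l %| i * \prod_(k <- ls) k)%N.
  apply/dvdnP; exists c; have : (0 < M %/ l)%N by rewrite divn_gt0 // dvdn_leq.
  move=> h; apply/eqP; rewrite -(eqn_pmul2l h); apply/eqP.
  by rewrite mulnA [(_ * i)%N]mulnC H mulnCA Ml.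
move: H1; rewrite Euclid_dvdM // => /orP [/dvdn_leq|]; first by lia.
have : all prime ls by case/and3P: pls.
elim: ls nl {pls t H} => [|k ls IH]; first by rewrite big_nil /= dvdn1 => _ _ /eqP E; move: lp; rewrite E.
rewrite inE negb_or big_cons /= => /andP [nk nl] /andP [kp als].
rewrite Euclid_dvdM // => /orP [|h]; last exact: (IH nl als h).
by rewrite dvdn_prime2 // => /eqP E; move: nk; rewrite E eqxx.
Qed.

Lemma sift_count_core ls : primes_of ls ->
  `|(sift_count ls)%:R - sift_density ls * #|X|%:R| <= sift_density ls * (2 ^+ size ls - 1) * B.
Proof.
elim: ls => [|l ls IH].
  move=> _; rewrite /sift_density big_nil expr0 subrr mulr0 mul0r mul1r.
  rewrite /sift_count (_ : [set _ in _ | _] = X) ?subrr ?normr0 //.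
  by apply/setP => x; rewrite inE andbT.
move=> h; have := sift_count_step h; move: h.
rewrite primes_of_cons => /and4P [lp lM nl pls] h1.
have l0 := prime_gt0 lp.
have d0 : 0 <= 1 - (l%:R^-1 : algC) by rewrite subr_ge0 invf_le1 ?ler1n ?ltr0n.
have -> : sift_density (l :: ls) = (1 - l%:R^-1) * sift_density ls by rewrite /sift_density big_cons.
set N1 := (sift_count _)%:R; set N := (sift_count ls)%:R in h1 IH *.
have -> : N1 - (1 - l%:R^-1) * sift_density ls * #|X|%:R =
  (N1 - (1 - l%:R^-1) * N) + (1 - l%:R^-1) * (N - sift_density ls * #|X|%:R) by ring.
apply: le_trans (ler_normD _ _) _; rewrite normrM (ger0_norm d0).
apply: le_trans (lerD h1 (ler_wpM2l d0 (IH pls))) _.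
by rewrite /= exprS le_eqVlt; apply/orP; left; apply/eqP; ring.
Qed.

Definition rec_sum (R : seq nat) : algC := \sum_(l <- R) l%:R^-1.

Lemma real_dist_ge (N : nat) (a b : algC) : a \is Num.real -> `|N%:R - a| <= b -> a - b <= N%:R.
Proof.
move=> ar h; have br : b \is Num.real by apply: ger0_real; apply: le_trans h.
rewrite lerBlDr -lerBlDl; apply: le_trans h; rewrite distrC; apply: real_ler_norm.
by rewrite rpredB // realn.
Qed.

(** Inside the set sieved by K this is |A| + |C| = |A meet C| + |A join C|. Iterated, it charges
    each prime of R an additive loss where [sift_count_core] would charge a factor 2. *)
Lemma sift_count_union l R K :
  (sift_count (R ++ K) + sift_count (l :: K) <= sift_count (l :: R ++ K) + sift_count K)%N.
Proof.
rewrite /sift_count.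
set A := [set x in X | avoids (R ++ K) x]; set C := [set x in X | avoids (l :: K) x].
set U := [set x in X | avoids (l :: R ++ K) x]; set W := [set x in X | avoids K x].
have -> : U = A :&: C.
  apply/setP => x; rewrite !inE /avoids /= !all_cat.
  by case: (x \in X); case: (l %| _)%N => //=; rewrite ?andbF //= -andbA andbb.
rewrite -cardsUI addnC leq_add2l subset_leq_card //.
apply/subsetP => x; rewrite !inE /avoids /= !all_cat.
by case: (x \in X) => //=; case/orP => /andP [].
Qed.

Lemma primes_of_sub ls1 ls2 : subseq ls1 ls2 -> primes_of ls2 -> primes_of ls1.
Proof.
move=> h /and3P [a b c]; apply/and3P; split; first by apply/allP => x /(mem_subseq h) /(allP a).
  exact: subseq_uniq b.
by apply/allP => x /(mem_subseq h) /(allP c).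
Qed.

Lemma sift_count_all K R : primes_of (R ++ K) ->
  (1 - rec_sum R) * (sift_count K)%:R
     - sift_density K * 2 ^+ size K * B * ((size R)%:R - rec_sum R) <= (sift_count (R ++ K))%:R.
Proof.
elim: R => [|l R IH] pRK.
  by rewrite /rec_sum big_nil subrr mulr0 !subr0 mul1r.
have pK : primes_of (l :: K).
  by apply: primes_of_sub pRK; rewrite /= eqxx suffix_subseq.
have pR : primes_of (R ++ K) by apply: primes_of_sub pRK; exact: subseq_cons.
have := IH pR; have := sift_count_step pK.
have rl : (l%:R : algC)^-1 \is Num.real by rewrite rpredV realn.
move=> /real_dist_ge => /(_ _) h1; have {h1} := h1 _.
rewrite rpredM ?rpredB ?rpred1 ?realn // => /(_ isT) h1 h2.
have h3 : ((sift_count (R ++ K))%:R + (sift_count (l :: K))%:R : algC)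
    <= (sift_count (l :: R ++ K))%:R + (sift_count K)%:R.
  by rewrite -!natrD ler_nat sift_count_union.
rewrite -(lerD2r (sift_count K)%:R); apply: le_trans h3.
apply: le_trans (lerD h2 h1).
by rewrite /rec_sum big_cons /= -addn1 natrD le_eqVlt; apply/orP; left; apply/eqP; ring.
Qed.

(** [sift_count_core] inserted into [sift_count_all], with two terms in [rec_sum R] dropped. The B
    kept beside #|X| is the slack by which a non-strict numerical criterion yields a strict
    inequality. *)
Lemma sift_count_lower K R : primes_of (R ++ K) -> 0 <= 1 - rec_sum R ->
  sift_density K * ((1 - rec_sum R) * (#|X|%:R + B) - 2 ^+ size K * B * (size R).+1%:R)
   <= (sift_count (R ++ K))%:R.
Proof.
move=> pRK r0; apply: le_trans (sift_count_all pRK).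
have pK : primes_of K by apply: primes_of_sub pRK; exact: suffix_subseq.
have d0 : 0 < sift_density K.
  apply: sift_density_gt0; case/and3P: pK => h _ _.
  by apply: sub_all h => l; exact: prime_gt1.
have /real_dist_ge := sift_count_core pK; rewrite rpredM ?realn ?gtr0_real // => /(_ isT).
move=> /(ler_wpM2l r0) h; rewrite -subr_ge0; rewrite -subr_ge0 in h.
have rr : 0 <= rec_sum R by rewrite /rec_sum; apply: sumr_ge0 => l _; rewrite invr_ge0.
have g : 0 <= sift_density K * 2 ^+ size K * B * rec_sum R.
  by do 3!apply: mulr_ge0 => //; [exact: ltW | exact: exprn_ge0].
apply: le_trans (addr_ge0 h (addr_ge0 g g)) _.
rewrite -addn1 natrD le_eqVlt; apply/orP; left; apply/eqP; ring.
Qed.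

Lemma sift_count_upper K : primes_of K ->
  (sift_count K)%:R <= sift_density K * (#|X|%:R + (2 ^+ size K - 1) * B).
Proof.
move=> pK; have h := sift_count_core pK.
rewrite mulrDr mulrA -lerBlDl; apply: le_trans h; apply: real_ler_norm.
by rewrite rpredB ?rpredM ?realn // rpred_prod // => l _; rewrite rpredB ?rpred1 ?rpredV ?realn.
Qed.
End Sieve.

(** * Stepanov's method *)

Lemma poly_family_dependent (K : fieldType) (I : finType) (H : I -> {poly K}) (N : nat) :
  (forall i, size (H i) <= N)%N -> (N < #|I|)%N ->
  exists sg : I -> K, (exists i, sg i != 0) /\ \sum_i sg i *: H i = 0.
Proof.
move=> sH NI.
pose A : 'M[K]_(#|I|, N) := \matrix_(i, j) (H (enum_val i))`_j.
have : kermx A != 0.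
  rewrite kermx_eq0 /row_free; apply: contraL NI => /eqP <-.
  by rewrite -leqNgt rank_leq_col.
case/rowV0Pn => v /sub_kermxP vA /rV0Pn [j vj].
exists (fun i => v 0 (enum_rank i)); split; first by exists (enum_val j); rewrite enum_valK.
apply/polyP => k; rewrite coef0 coef_sum.
have [kN|Nk] := ltnP k N; last first.
  by apply: big1 => i _; rewrite coefZ nth_default ?mulr0 // (leq_trans (sH i)).
have := congr1 (fun B : 'M_(_, _) => B 0 (Ordinal kN)) vA; rewrite !mxE => E; rewrite -[RHS]E.
rewrite (reindex (@enum_val I I)) /=; last by apply: onW_bij; exact: enum_val_bij.
by apply: eq_bigr => i _; rewrite coefZ enum_valK !mxE.
Qed.

(** The i-th summand vanishes at b to the exact order [w i]; after division by the least order with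
    a nonzero coefficient a single term survives at b. *)
Lemma sum_distinct_order_neq0 (K : fieldType) (I : finType) (b : K) (w : I -> nat)
    (u : I -> {poly K}) (t : I -> K) :
  injective w -> (forall i, (u i).[b] != 0) -> (exists i, t i != 0) ->
  \sum_i t i *: (('X - b%:P) ^+ w i * u i) != 0.
Proof.
move=> winj ub [i1 ti1].
case: (@arg_minnP I i1 (fun i => t i != 0) w ti1) => i0 ti0 imin.
set s := \sum_i _; pose r := \sum_(i | t i != 0) t i *: (('X - b%:P) ^+ (w i - w i0) * u i).
have -> : s = ('X - b%:P) ^+ w i0 * r.
  rewrite /s (bigID (fun i => t i != 0)) /= [X in _ + X]big1 ?addr0; last first.
    by move=> i; rewrite negbK => /eqP ->; rewrite scale0r.
  rewrite /r mulr_sumr; apply: eq_bigr => i ti.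
  by rewrite -scalerAr mulrA -exprD subnKC // imin.
rewrite mulf_neq0 ?expf_neq0 ?polyXsubC_eq0 //.
suff : r.[b] != 0 by apply: contraNneq => ->; rewrite horner0.
rewrite /r (bigD1 i0) //= hornerD horner_sum [X in _ + X]big1 ?addr0; last first.
  move=> i /andP [ti ne]; rewrite hornerZ hornerM horner_exp hornerXsubC subrr.
  have : (w i0 < w i)%N.
    by rewrite ltn_neqAle imin // andbT; apply: contraNneq ne => /winj ->.
  by rewrite -subn_gt0 => h; rewrite expr0n eqn0Ngt h mul0r mulr0.
by rewrite hornerZ subnn expr0 mul1r mulf_neq0.
Qed.

Lemma sum_pchar_pow (K : comNzRingType) (p k : nat) (I : Type) (r : seq I) (P : pred I) (F : I -> K) :
  p \in [pchar K] -> (\sum_(i <- r | P i) F i) ^+ (p ^ k) = \sum_(i <- r | P i) F i ^+ (p ^ k).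
Proof.
move=> pK; have pnat : [pchar K].-nat (p ^ k)%N.
  by rewrite pnatX (pnatE _ (pcharf_prime pK)) pK.
apply: (big_morph (fun x => x ^+ (p ^ k))) => [x y|]; first exact: exprDn_pchar.
by rewrite expr0n expn_eq0 -leqn0 leqNgt prime_gt0 ?(pcharf_prime pK).
Qed.

Lemma closed_root_pow (K : closedFieldType) (N : nat) (x : K) : (0 < N)%N -> exists y : K, y ^+ N = x.
Proof.
move=> N0; have : size ('X^N - x%:P : {poly K}) != 1%N by rewrite size_XnsubC // eqSS -lt0n.
by case/closed_rootP => y; rewrite rootE !hornerE subr_eq0 => /eqP; exists y.
Qed.

(* The auxiliary polynomial is sum_{e,k,i} tau (X-b)^(i+kR) g^e with g = h^m; its orders
   i + em + kR at b are pairwise distinct, so it is nonzero, and on the points in question its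
   R-th power is g^(1-d) times a polynomial that a dimension count allows to vanish identically. *)
Lemma stepanov (K : closedFieldType) (p k d m : nat) (h h1 : {poly K}) (b c : K) (S : seq K) :
  p \in [pchar K] -> (1 < d)%N -> (0 < m)%N -> (p ^ k)%N = (d * m).+1 ->
  h = ('X - b%:P) * h1 -> h1.[b] != 0 -> b ^+ (p ^ k * p ^ k) = b -> c != 0 -> uniq S ->
  (forall s, s \in S -> s ^+ (p ^ k * p ^ k) = s /\ (h.[s] ^+ m) ^+ (p ^ k).+1 = c) ->
  (size S <= (m + d * (size h).-1 + (size h).-1 + 1) * p ^ k)%N.
Proof.
move=> pK d1 m0; set R := (p ^ k)%N => RE hE h1b bQ c0 Su Sh.
(* K' bounds the exponent k; it is chosen so that the d K' m unknowns outnumber the N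
   coefficients. *)
set D := (size h).-1; pose K' := (m + d * D + 1)%N; pose g := h ^+ m.
have sg e : (size (g ^+ e) <= (D * m * e).+1)%N.
  by rewrite /g -exprM -mulnA; exact: size_poly_exp_leq.
pose I : finType := ('I_d * 'I_K' * 'I_m)%type.
pose H (x : I) : {poly K} :=
  c ^+ x.1.1 *: (('X - b%:P) ^+ (x.2 * R + x.1.2) * g ^+ (d.-1 - x.1.1)).
have sX (j : nat) : size (('X - b%:P) ^+ j) = j.+1 by rewrite size_exp_XsubC.
pose N := ((m - 1) * R + K' + d.-1 * (D * m))%N.
have sH x : (size (H x) <= N)%N.
  apply: leq_trans (size_scale_leq _ _) _; apply: leq_trans (size_polyMleq _ _) _.
  rewrite sX; have := sg (d.-1 - x.1.1)%N; rewrite /N.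
  case: x => [[[e ed] [kk kK]] [i im]] /=.
  have : (D * m * (d.-1 - e) <= d.-1 * (D * m))%N by rewrite mulnC leq_mul2r leq_subr orbT.
  have : (i * R <= (m - 1) * R)%N by rewrite leq_mul2r; apply/orP; right; lia.
  by clear -kK; lia.
have cardI : #|I| = (d * K' * m)%N by rewrite !card_prod !card_ord.
have NI : (N < #|I|)%N.
  rewrite cardI /N RE /K'; clear -d1 m0; case: d d1 => [|[|d]] // _; case: m m0 => [|m] // _.
  by rewrite /= subn1 /=; nia.
have [sgm [sgn0 sg0]] := poly_family_dependent sH NI.
have R0 : (0 < R)%N by rewrite RE.
(* The linear relation has the coefficients [sgm]. The polynomial f takes their R-th roots, because
   raising f to the power R raises its coefficients too. *)
have /fin_all_exists [tau tauE] : forall x : I, exists y : K, y ^+ R = sgm x.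
  by move=> x; exact: closed_root_pow.
pose w (x : I) := (x.2 + x.1.1 * m + x.1.2 * R)%N.
pose f := \sum_x tau x *: (('X - b%:P) ^+ w x * h1 ^+ (m * x.1.1)).
have fE : f = \sum_x tau x *: (('X - b%:P) ^+ (x.2 + x.1.2 * R) * g ^+ x.1.1).
  apply: eq_bigr => x _; congr (_ *: _).
  rewrite /g hE -exprM exprMn mulrA -exprD /w; congr (_ ^+ _ * _).
  by clear; lia.
have f0 : f != 0.
  apply: sum_distinct_order_neq0 => [x y|x|].
  - case: x y => [[[e ed] [kk kK]] [i im]] [[[e' ed'] [kk' kK']] [i' im']]; rewrite /w /= => E.
    have a1 : (i + e * m < d * m)%N by clear -ed im; nia.
    have a2 : (i' + e' * m < d * m)%N by clear -ed' im'; nia.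
    have k1 : kk = kk'.
      have := congr1 (fun z => z %/ R)%N E.
      by rewrite !(addnC (_ + _)%N) !divnMDl // !divn_small ?addn0 // RE; apply: ltnW.
    have E2 : (e * m + i = e' * m + i')%N by move: E; rewrite k1; clear; lia.
    have e1 : e = e'.
      by have := congr1 (fun z => z %/ m)%N E2; rewrite !divnMDl // !divn_small ?addn0.
    have i1 : i = i' by move: E2; rewrite e1; clear; lia.
    by apply/eqP; rewrite !xpair_eqE -!val_eqE /= k1 e1 i1 !eqxx.
  - by rewrite horner_exp expf_neq0.
  - case: sgn0 => x sx; exists x; apply: contraNneq sx => tx.
    by rewrite -tauE tx expr0n eqn0Ngt R0.
have rootf s : s \in S -> root f s.
  move=> /Sh [sQ gs]; rewrite rootE.
  have gs0 : g.[s] != 0.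
    apply: contraNneq c0 => g0; rewrite -gs; move: g0; rewrite /g horner_exp => ->.
    by rewrite expr0n.
  have sbQ : (s - b) ^+ (R * R) = s - b.
    have pnat : [pchar K].-nat (R * R)%N.
      by rewrite /R -expnD pnatX (pnatE _ (pcharf_prime pK)) pK.
    by rewrite exprDn_pchar // exprNn_pchar // sQ bQ.
  (* (s - b)^(R^2) = s - b turns the exponent k R^2 into k, and g(s)^(R + 1) = c turns g^(e R) into
     c^e g^(-e); the factor g^(d - 1) clears the negative powers. *)
  suff : f.[s] ^+ R * g.[s] ^+ d.-1 == 0.
    by rewrite mulf_eq0 !expf_eq0 (negbTE gs0) andbF orbF => /andP [].
  rewrite fE horner_sum /R sum_pchar_pow // -/R mulr_suml.
  apply/eqP; transitivity ((\sum_x sgm x *: H x).[s]); last by rewrite sg0 horner0.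
  rewrite horner_sum; apply: eq_bigr => x _.
  have xd : (x.1.1 <= d.-1)%N by have := ltn_ord x.1.1; clear; lia.
  have E1 : (s - b) ^+ ((x.2 + x.1.2 * R) * R) = (s - b) ^+ (x.2 * R + x.1.2).
    by rewrite mulnDl -mulnA [(x.1.2 * _)%N]mulnC !exprD [in LHS](exprM _ (R * R)%N) sbQ.
  have E2 : h.[s] ^+ (m * x.1.1 * R) * h.[s] ^+ (m * d.-1) = c ^+ x.1.1 * h.[s] ^+ (m * (d.-1 - x.1.1)).
    rewrite -gs -!exprM -!exprD; congr (_ ^+ _).
    by clear -xd; move: (nat_of_ord x.1.1) xd => e; nia.
  rewrite /H !hornerZ !hornerM !horner_exp hornerXsubC -tauE !exprMn -!exprM E1.
  by rewrite -!mulrA E2; congr (_ * _); rewrite mulrCA.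
have := max_poly_roots f0 (introT allP rootf) Su.
have : (size f <= (m + (K' - 1) * R + d * (D * m)))%N.
  rewrite fE; apply: leq_trans (size_sum _ _ _) _.
  apply/bigmax_leqP => x _; apply: leq_trans (size_scale_leq _ _) _.
  apply: leq_trans (size_polyMleq _ _) _; rewrite sX; have := sg x.1.1.
  case: x => [[[e ed] [kk kK]] [i im]] /=.
  have : (D * m * e <= d * (D * m))%N by rewrite mulnC leq_mul2r ltnW ?orbT.
  have : (kk * R <= (K' - 1) * R)%N by rewrite leq_mul2r; apply/orP; right; lia.
  by clear -im; lia.
move=> h2 h3; apply: leq_trans (ltnW h3) _; apply: leq_trans h2 _.
have a1 : (d * (D * m) <= D * R)%N by rewrite mulnCA leq_mul2l RE; apply/orP; right; lia.
have a2 : (m <= R)%N by rewrite RE; clear -d1; nia.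
rewrite /K' addnK !mulnDl mul1n; clear -a1 a2; lia.
Qed.

Lemma finField_card_pX (F : finFieldType) :
  exists p n, [/\ p \in [pchar F], (0 < n)%N & #|F| = (p ^ n)%N].
Proof.
have [p pr_p pF] := finPcharP F; exists p, (logn p #|F|).
have := card_pgroup (abelem_pgroup (fin_ring_pchar_abelem pF)); rewrite cardsT => E.
split=> //; case: (posnP (logn p #|F|)) => // l0; move: E; rewrite l0 expn0 => E.
by have := finNzRing_gt1 F; rewrite E.
Qed.

Lemma expf_card_add (F : finFieldType) (K : comNzRingType) (j : {rmorphism F -> K}) (x y : K) :
  (x + y) ^+ #|F| = x ^+ #|F| + y ^+ #|F|.
Proof.
have [p [n [pF _ E]]] := finField_card_pX F.
have pK : p \in [pchar K] by exact: rmorph_pchar pF.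
by rewrite E; apply: exprDn_pchar; rewrite pnatX (pnatE _ (pcharf_prime pF)) pK.
Qed.

Lemma natr_card_eq0 (F : finFieldType) : #|F|%:R = 0 :> F.
Proof.
have [p [[|n] [pF n0 E]]] := finField_card_pX F; first by [].
by rewrite E natrX (pcharf0 pF) expr0n.
Qed.

Lemma sum_multiples_le (d c n : nat) : (0 < d)%N ->
  (\sum_(1 <= r < n.+1) ((d %| r) && (r %/ d <= c)) = minn c (n %/ d))%N.
Proof.
move=> d0; elim: n => [|n IH]; first by rewrite big_geq // div0n minn0.
rewrite big_nat_recr //= IH divnS //.
by case: (d %| n.+1)%N => /=; [rewrite add1n | rewrite add0n addn0]; lia.
Qed.

Lemma dvdp_XsubC_pow_count (K : fieldType) (zs : seq K) (s : K) k :
  (('X - s%:P) ^+ k %| \prod_(z <- zs) ('X - z%:P)) = (k <= count_mem s zs)%N.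
Proof.
elim: zs k => [|z zs IH] k.
  rewrite big_nil dvdp1 size_exp_XsubC /= leqn0; by case: k.
rewrite big_cons /=; have [->|zs'] := eqVneq z s.
  case: k => [|k]; first by rewrite expr0 dvd1p.
  by rewrite exprS dvdp_mul2l ?polyXsubC_eq0 // IH add1n.
rewrite add0n -IH Gauss_dvdpr //; apply: coprimep_expl.
by rewrite coprimep_XsubC2 // subr_eq0.
Qed.

(** * Frobenius orbits and sums over monic polynomials *)

Section FrobeniusOrbits.
Variables (F : finFieldType) (K : fieldType) (j : {rmorphism F -> K}).
Let q := #|F|.

Let q_gt0 : (0 < q)%N.
Proof. by apply/card_gt0P; exists 0. Qed.

Let q_gt1 : (1 < q)%N.
Proof. exact: finNzRing_gt1. Qed.

(** The embedding is an argument so that the morphism structure can be inferred: x^q is additive on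
    K because K contains F. *)
Definition frobenius (_ : {rmorphism F -> K}) (x : K) : K := x ^+ q.
Local Notation frob := (frobenius j).

Fact frob_is_nmod : nmod_morphism frob.
Proof.
by split=> [|x y]; [rewrite /frobenius expr0n eqn0Ngt q_gt0 | exact: expf_card_add j x y].
Qed.
HB.instance Definition _ := GRing.isNmodMorphism.Build K K frob frob_is_nmod.
Fact frob_is_monoid : monoid_morphism frob.
Proof. by split=> [|x y]; rewrite /frobenius ?expr1n ?exprMn. Qed.
HB.instance Definition _ := GRing.isMonoidMorphism.Build K K frob frob_is_monoid.

Lemma frob_iter (x : K) i : x ^+ (q ^ i) = iter i frob x.
Proof. by elim: i => [|i IH]; rewrite ?expn0 ?expr1 //= -IH /frobenius -exprM expnSr. Qed.

Lemma frob_fixedP (x : K) : reflect (exists c, j c = x) (x ^+ q == x).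
Proof.
apply: (iffP eqP) => [h|[c <-]]; last by rewrite -rmorphXn expf_card.
have := congr1 (map_poly j) (finField_genPoly F).
rewrite rmorphB /= map_polyXn map_polyX rmorph_prod => /(congr1 (horner^~ x)).
rewrite !hornerE h subrr => /esym/eqP; rewrite horner_prod prodf_seq_eq0 => /hasP [c _ /=].
by rewrite rmorphB /= map_polyX map_polyC hornerXsubC subr_eq0 => /eqP ->; exists c.
Qed.

Lemma frob_fixed_iter (s : K) r k : s ^+ (q ^ r) = s -> s ^+ (q ^ (k * r)) = s.
Proof.
by move=> h; elim: k => [|k IH]; rewrite ?expr1 // mulSn expnD exprM h.
Qed.

Lemma frob_period (s : K) r : (0 < r)%N -> s ^+ (q ^ r) = s ->
  exists d, [/\ (0 < d)%N, (d <= r)%N & forall t, (s ^+ (q ^ t) == s) = (d %| t)%N].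
Proof.
move=> r0 rs.
have ex : exists d, (0 < d)%N && (s ^+ (q ^ d) == s) by exists r; rewrite r0 rs eqxx.
case: (ex_minnP ex) => d /andP [d0 /eqP ds] dmin; exists d; split=> //.
  by apply: dmin; rewrite r0 rs eqxx.
move=> t; apply/eqP/idP => [h|/dvdnP [k ->]]; last exact: frob_fixed_iter.
rewrite /dvdn; case: posnP => // h0.
have := dmin (t %% d)%N; rewrite h0 /=.
have -> : s ^+ (q ^ (t %% d)) == s.
  apply/eqP; rewrite -[RHS]h {2}(divn_eq t d) expnD exprM frob_fixed_iter //.
by move=> /(_ isT); rewrite leqNgt ltn_pmod.
Qed.

(** For s of exact period d, [orbit_poly s (k * d)] is the k-th power of the minimal polynomial of s
    over F. *)
Definition orbit_poly (s : K) r : {poly K} := \prod_(i < r) ('X - (s ^+ (q ^ i))%:P).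

Lemma orbit_polyD (s : K) a b : s ^+ (q ^ a) = s ->
  orbit_poly s (a + b) = orbit_poly s a * orbit_poly s b.
Proof.
move=> h; rewrite /orbit_poly big_split_ord /=; congr (_ * _).
by apply: eq_bigr => i _; rewrite expnD exprM h.
Qed.

Lemma orbit_polyM (s : K) d k : s ^+ (q ^ d) = s ->
  orbit_poly s (k * d) = orbit_poly s d ^+ k.
Proof.
move=> h; elim: k => [|k IH]; first by rewrite mul0n /orbit_poly big_ord0 expr0.
by rewrite mulSn orbit_polyD // IH exprS.
Qed.

Lemma size_orbit_poly s r : size (orbit_poly s r) = r.+1.
Proof. by rewrite /orbit_poly size_prod_XsubC /index_enum -enumT size_enum_ord. Qed.

Lemma monic_orbit_poly s r : orbit_poly s r \is monic.
Proof. exact: monic_prod_XsubC. Qed.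

Lemma map_frob_orbit_poly (s : K) r : s ^+ (q ^ r) = s ->
  map_poly frob (orbit_poly s r) = orbit_poly s r.
Proof.
case: r => [|r] h; first by rewrite /orbit_poly big_ord0 rmorph1.
rewrite /orbit_poly rmorph_prod big_ord_recr [RHS]big_ord_recl mulrC /=.
have E i : map_poly frob ('X - (s ^+ (q ^ i))%:P) = 'X - (s ^+ (q ^ i.+1))%:P.
  by rewrite rmorphB /= map_polyX map_polyC /= /frobenius -exprM -expnSr.
rewrite E h expn0 expr1; congr (_ * _).
by apply: eq_bigr => i _; rewrite E.
Qed.

Lemma map_frob_map (g : {poly F}) : map_poly frob (map_poly j g) = map_poly j g.
Proof.
by apply/polyP => i; rewrite !coef_map /= /frobenius -rmorphXn expf_card.
Qed.

Lemma frob_injective : injective frob.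
Proof. exact: fmorph_inj. Qed.

Lemma frob_orbit_uniq (s : K) d : (forall i, (0 < i < d)%N -> s ^+ (q ^ i) != s) ->
  forall i i', (i < d)%N -> (i' < d)%N -> s ^+ (q ^ i) = s ^+ (q ^ i') -> i = i'.
Proof.
move=> ne.
have main i i' : (i < i')%N -> (i' < d)%N -> s ^+ (q ^ i) = s ^+ (q ^ i') -> False.
  move=> ii' i'd; rewrite -(subnK (ltnW ii')) expnD exprM !frob_iter => h.
  have inj : injective (iter i frob) by elim: (i) => [|m IHm] x y //= /frob_injective /IHm.
  have := ne (i' - i)%N; rewrite subn_gt0 ii' (leq_ltn_trans (leq_subr _ _) i'd).
  by move=> /(_ isT) /negP; apply; apply/eqP; rewrite frob_iter; apply: inj; rewrite -h.
move=> i i' id i'd h; case: (ltngtP i i') => // lt.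
  by case: (main _ _ lt i'd h).
by case: (main _ _ lt id (esym h)).
Qed.

Lemma dvdp_prod_XsubC_pow (P : {poly K}) (a : nat -> K) m k :
  (forall i i', (i < m)%N -> (i' < m)%N -> a i = a i' -> i = i') ->
  (forall i, (i < m)%N -> ('X - (a i)%:P) ^+ k %| P) ->
  (\prod_(i < m) ('X - (a i)%:P)) ^+ k %| P.
Proof.
elim: m => [|m IH] inj h; first by rewrite big_ord0 expr1n dvd1p.
rewrite big_ord_recr /= exprMn Gauss_dvdp.
  rewrite h // andbT; apply: IH => [i i' im i'm|i im]; last by apply: h; lia.
  by apply: inj; lia.
apply: coprimep_expl; apply: coprimep_expr; rewrite coprimep_XsubC rootE horner_prod.
rewrite prodf_seq_neq0; apply/allP => i _ /=; rewrite hornerXsubC subr_eq0.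
apply/eqP => E; have := ltn_ord i; rewrite (inj (nat_of_ord i) m) ?ltnn //.
by have := ltn_ord i; lia.
Qed.

(** Frobenius fixes g, so all conjugates of s have the same multiplicity in g, and below the period
    they are distinct. *)
Lemma orbit_poly_pow_dvd (g : {poly F}) s d k : (0 < d)%N ->
  (forall i, (0 < i < d)%N -> s ^+ (q ^ i) != s) ->
  (orbit_poly s d ^+ k %| map_poly j g) = (('X - s%:P) ^+ k %| map_poly j g).
Proof.
move=> d0 ne; apply/idP/idP => h.
  apply: dvdp_trans h; apply: dvdp_exp2r; case: d d0 {ne} => // d _.
  by rewrite /orbit_poly big_ord_recl expn0 expr1 dvdp_mulr.
apply: (@dvdp_prod_XsubC_pow _ (fun i => s ^+ (q ^ i))) => [i i'|i _]; first exact: frob_orbit_uniq.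
elim: i => [|i IH]; first by rewrite expn0 expr1.
rewrite -map_frob_map; have := IH; rewrite -(dvdp_map frob) rmorphXn rmorphB /= map_polyX map_polyC /=.
by rewrite /frobenius -exprM -expnSr.
Qed.

(** Otherwise the first [size g] conjugates of s would be too many distinct roots of g. *)
Lemma root_period (g : {poly F}) s : g != 0 -> root (map_poly j g) s ->
  exists2 r, (0 < r < size g)%N & s ^+ (q ^ r) = s.
Proof.
move=> g0 rs.
have [/existsP [i /andP [i0 /eqP h]]|] := boolP [exists i : 'I_(size g), (0 < i)%N && (s ^+ (q ^ i) == s)].
  by exists i => //; rewrite i0 ltn_ord.
rewrite negb_exists => /forallP ne.
have g0' : map_poly j g != 0 by rewrite map_poly_eq0.
have h : forall i, (0 < i < size g)%N -> s ^+ (q ^ i) != s.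
  by move=> i /andP [i0 i1]; have := ne (Ordinal i1); rewrite /= i0.
suff : (size [seq s ^+ (q ^ i) | i <- iota 0 (size g)] < size (map_poly j g))%N.
  by rewrite size_map size_iota size_map_poly ltnn.
apply: max_poly_roots => //.
  apply/allP => x /mapP [i _ ->]; elim: i => [|i IH]; first by rewrite expn0 expr1.
  by rewrite -map_frob_map expnSr exprM -/(frobenius j _); apply: rmorph_root.
rewrite map_inj_in_uniq ?iota_uniq // => i i'; rewrite !mem_iota /= !add0n.
by move=> a b; exact: (frob_orbit_uniq h a b).
Qed.

(** The default 0 is met only at coefficients outside the image of j, which do not occur when
    Frobenius fixes P. *)
Definition descend (P : {poly K}) : {poly F} :=
  \poly_(i < size P) odflt 0 [pick c | j c == P`_i].

Lemma descendK (P : {poly K}) : map_poly frob P = P -> map_poly j (descend P) = P.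
Proof.
move=> h; apply/polyP => i; rewrite coef_map coef_poly.
case: (leqP (size P) i) => [si|_].
  rewrite nth_default //.
  exact: rmorph0.
case: pickP => [c /eqP //|ne]; have := congr1 (fun R : {poly K} => R`_i) h; rewrite coef_map /=.
by move/eqP/frob_fixedP => [c ec]; have := ne c; rewrite ec eqxx.
Qed.
End FrobeniusOrbits.

Section FixedPoints.
Variables (F : finFieldType) (K : closedFieldType) (j : {rmorphism F -> K}).
Let q := #|F|.
Let q_gt1 : (1 < q)%N.
Proof. exact: finNzRing_gt1. Qed.

(** X^(q^r) - X has derivative -1, hence distinct roots. The statement is informative so that a
    function r -> list of points can be extracted from it. *)
Lemma fixed_points r : (0 < r)%N ->
  {S : seq K | uniq S /\ size S = (q ^ r)%N & forall s, (s \in S) = (s ^+ (q ^ r) == s)}.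
Proof.
move=> r0; pose P : {poly K} := 'X^(q ^ r) - 'X.
have qr : (1 < q ^ r)%N by rewrite -(expn0 q) ltn_exp2l.
have sP : size P = (q ^ r).+1.
  by rewrite size_polyDl size_polyXn // size_polyN size_polyX.
have lP : lead_coef P = 1.
  by rewrite lead_coefDl ?lead_coefXn // size_polyN size_polyX size_polyXn.
have [S PE] := closed_field_poly_normal P; rewrite lP scale1r in PE.
exists S; last first.
  by move=> s; rewrite -root_prod_XsubC -PE rootE !hornerE subr_eq0.
split; last by have := size_prod_XsubC S id; rewrite -PE sP => -[].
rewrite -separable_prod_XsubC -PE unlock derivB derivXn derivX.
have qK0 : (q ^ r)%:R = 0 :> K.
  rewrite natrX -(rmorph_nat j).
  by rewrite natr_card_eq0 rmorph0 expr0n eqn0Ngt r0.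
rewrite -[_ *+ _]mulr_natr -polyC_natr qK0 polyC0 mulr0 sub0r -scaleN1r.
by rewrite coprimepZr ?oppr_eq0 ?oner_eq0 // coprimep1.
Qed.

(** Only r = k d contributes, and there the orbit polynomial is a k-th power, which divides g
    exactly up to k = multiplicity of s. The degree of g ensures that the range of r cuts nothing
    off. *)
Lemma sum_period_mult (g : {poly F}) (zs : seq K) s d :
  map_poly j g = \prod_(z <- zs) ('X - z%:P) -> (0 < d)%N ->
  (forall t, (s ^+ (q ^ t) == s) = (d %| t)%N) ->
  (\sum_(1 <= r < (size zs).+1) ((s ^+ (q ^ r) == s) && (dvdp (orbit_poly F s r) (map_poly j g)))
    = count_mem s zs)%N.
Proof.
move=> gE d0 dP.
have ds : s ^+ (q ^ d) = s by apply/eqP; rewrite dP.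
have ne i : (0 < i < d)%N -> s ^+ (q ^ i) != s.
  by move=> /andP [i0 id]; rewrite dP; apply/negP => /dvdn_leq; lia.
have E r : ((s ^+ (q ^ r) == s) && (dvdp (orbit_poly F s r) (map_poly j g)))
    = ((d %| r) && (r %/ d <= count_mem s zs))%N.
  rewrite dP; case dr: (d %| r)%N => //=; have /dvdnP [k ->] := dr.
  by rewrite mulnK // orbit_polyM // orbit_poly_pow_dvd // gE dvdp_XsubC_pow_count.
under eq_bigr => r _ do rewrite E.
rewrite sum_multiples_le //; apply/minn_idPl.
rewrite leq_divRL //.
have : orbit_poly F s d ^+ count_mem s zs %| map_poly j g.
  by rewrite orbit_poly_pow_dvd // gE dvdp_XsubC_pow_count.
have g0 : map_poly j g != 0 by rewrite gE monic_neq0 // monic_prod_XsubC.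
move=> /(dvdp_leq g0); rewrite -orbit_polyM // size_orbit_poly gE.
by rewrite size_prod_XsubC ltnS.
Qed.

(* Counts the Frobenius-fixed pairs (r, s) by summing over s the multiplicity of s as a root. *)
Lemma sum_orbit_poly_dvd (g : {poly F}) n (fp : nat -> seq K) : g \is monic -> size g = n.+1 ->
  (forall r, (0 < r)%N -> uniq (fp r) /\ forall s, (s \in fp r) = (s ^+ (q ^ r) == s)) ->
  (\sum_(1 <= r < n.+1) \sum_(s <- fp r) (dvdp (orbit_poly F s r) (map_poly j g)) = n)%N.
Proof.
move=> gm sg fpP; have [zs gE] := closed_field_poly_normal (map_poly j g).
rewrite lead_coef_map (monicP gm) rmorph1 scale1r in gE.
have szs : size zs = n.
  by have := size_prod_XsubC zs id; rewrite -gE size_map_poly sg => -[].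
have g0 := monic_neq0 gm.
(* One set of points for all r allows the two sums to be exchanged; the roots of g are included so
   that each of them is met once. *)
pose U := undup (zs ++ flatten [seq fp r | r <- index_iota 1 n.+1]).
have E r : (1 <= r < n.+1)%N -> (\sum_(s <- fp r) (dvdp (orbit_poly F s r) (map_poly j g)) =
   \sum_(s <- U) ((s ^+ (q ^ r) == s) && (dvdp (orbit_poly F s r) (map_poly j g))))%N.
  move=> r1; have [r0 _] := andP r1; have [uf memf] := fpP r r0.
  rewrite [RHS](bigID (fun s => s ^+ (q ^ r) == s)) /= [X in _ = (_ + X)%N]big1 ?addn0; last first.
    by move=> s /negbTE ->.
  rewrite -[RHS]big_filter; under [RHS]eq_big_seq => s.
    by rewrite mem_filter => /andP [-> _]; over.
  apply: perm_big; apply: uniq_perm => //; first by rewrite filter_uniq ?undup_uniq.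
  move=> s; rewrite mem_filter mem_undup mem_cat -memf.
  case sf: (s \in fp r) => //=; apply/esym/orP; right.
  by apply/flattenP; exists (fp r) => //; apply/mapP; exists r; rewrite // mem_index_iota.
rewrite big_nat_cond; under eq_bigr => r /andP [r1 _] do rewrite E //.
rewrite -big_nat_cond exchange_big /=.
have per s : s \in U -> exists2 r, (0 < r)%N & s ^+ (q ^ r) = s.
  rewrite mem_undup mem_cat => /orP [sz|/flattenP [_ /mapP [r r1 ->] sf]].
    have [|r /andP [r0 _] h] := @root_period F K j g s g0; last by exists r.
    by rewrite gE root_prod_XsubC.
  move: r1; rewrite mem_index_iota => /andP [r0 _]; exists r => //.
  by have [_ memf] := fpP r r0; move: sf; rewrite memf => /eqP.
rewrite -[RHS]szs -szs; under eq_big_seq => s sU.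
  have [r r0 rs] := per s sU; have [d [d0 _ dP]] := frob_period r0 rs.
  by rewrite (sum_period_mult gE d0 dP); over.
rewrite -[RHS]sum1_size (eq_bigr (fun s => \sum_(z <- zs | z == s) 1%N)); last first.
  by move=> s _; rewrite sum1_count.
rewrite (exchange_big_dep xpredT) //=; apply: eq_big_seq => z zz.
rewrite -big_filter (_ : [seq i <- U | z == i] = [:: z]) ?big_seq1 //.
rewrite -(filter_pred1_uniq (undup_uniq _) (_ : z \in U)) ?mem_undup ?mem_cat ?zz //.
by apply: eq_filter => x /=; rewrite eq_sym.
Qed.

End FixedPoints.

Section MonicEnumeration.
Variable F : finFieldType.

Definition monic_of n (c : 'rV[F]_n) : {poly F} := 'X^n + rVpoly c.

Lemma size_monic_of n (c : 'rV[F]_n) : size (monic_of c) = n.+1.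
Proof. by rewrite size_polyDl size_polyXn // ltnS size_poly. Qed.

Lemma monic_of_monic n (c : 'rV[F]_n) : monic_of c \is monic.
Proof. by rewrite monicE lead_coefDl ?lead_coefXn // size_polyXn ltnS size_poly. Qed.

Lemma monic_ofK n (f : {poly F}) : f \is monic -> size f = n.+1 ->
  monic_of (poly_rV (f - 'X^n) : 'rV_n) = f.
Proof.
move=> fm sf; rewrite /monic_of poly_rV_K ?subrKC //; last first.
  apply/leq_sizeP => i; rewrite leq_eqVlt coefB coefXn => /orP [/eqP <-|ni].
    by rewrite eqxx; have := monicP fm; rewrite lead_coefE sf => ->; rewrite subrr.
  by rewrite gtn_eqF // nth_default ?subrr // sf.
Qed.

Lemma monic_of_inj n : injective (@monic_of n).
Proof. by move=> c c' /addrI /(congr1 (@poly_rV _ n)); rewrite !rVpolyK. Qed.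

Variable psi : {poly F} -> algC.
Hypothesis psiM : {morph psi : f g / f * g}.

Definition monic_sum n : algC := \sum_(c : 'rV[F]_n) psi (monic_of c).

Lemma monic_sum_multiples (D : {poly F}) r n : D \is monic -> size D = r.+1 -> (r <= n)%N ->
  \sum_(c : 'rV[F]_n | D %| monic_of c) psi (monic_of c) = psi D * monic_sum (n - r).
Proof.
move=> Dm sD rn; rewrite /monic_sum mulr_sumr.
have D0 := monic_neq0 Dm.
pose h (c : 'rV[F]_(n - r)) : 'rV[F]_n := poly_rV (D * monic_of c - 'X^n).
pose h' (c : 'rV[F]_n) : 'rV[F]_(n - r) := poly_rV (monic_of c %/ D - 'X^(n - r)).
have hE c : monic_of (h c) = D * monic_of c.
  apply: monic_ofK; first by rewrite monicMl // monic_of_monic.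
  by rewrite size_monicM ?monic_neq0 ?monic_of_monic // sD size_monic_of /=; lia.
rewrite (reindex_onto h h') /=; last first.
  move=> c Dc; apply: monic_of_inj; rewrite hE monic_ofK.
  - by rewrite mulrC divpK.
  - by rewrite -(monicMr _ Dm) divpK // monic_of_monic.
  - by rewrite size_divp // size_monic_of sD /=; lia.
apply: eq_big => [c|c _]; last by rewrite hE psiM.
rewrite hE dvdp_mulr ?dvdpp //=; apply/eqP; apply: monic_of_inj.
rewrite /h' hE mulKp // monic_ofK ?monic_of_monic ?size_monic_of //.
Qed.

Variables (K : closedFieldType) (j : {rmorphism F -> K}) (fp : nat -> seq K).
Hypothesis fpP : forall r, (0 < r)%N -> uniq (fp r) /\ forall s, (s \in fp r) = (s ^+ (#|F| ^ r) == s).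

(** The r-th coefficient of T L'(T) / L(T), where L(T) is the sum of the [monic_sum n] T^n. *)
Definition orbit_sum r : algC := \sum_(s <- fp r) psi (descend j (orbit_poly F s r)).

Lemma map_descend_orbit_poly r s : (0 < r)%N -> s \in fp r ->
  map_poly j (descend j (orbit_poly F s r)) = orbit_poly F s r.
Proof.
by move=> r0; have [_ ->] := fpP r0 => /eqP h; apply: descendK; apply: map_frob_orbit_poly.
Qed.

(* n A_n = sum_f (deg f) psi(f), and deg f counts the divisors of f of the form prod_{i<r} (X - s^(q^i)). *)
Lemma monic_sum_newton n :
  n%:R * monic_sum n = \sum_(1 <= r < n.+1) orbit_sum r * monic_sum (n - r).
Proof.
rewrite {1}/monic_sum mulr_sumr.
have E (c : 'rV[F]_n) : n%:R * psi (monic_of c) = \sum_(1 <= r < n.+1) \sum_(s <- fp r)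
    (dvdp (orbit_poly F s r) (map_poly j (monic_of c)))%:R * psi (monic_of c).
  rewrite -{1}(sum_orbit_poly_dvd j (monic_of_monic c) (size_monic_of c) fpP) natr_sum mulr_suml.
  by apply: eq_bigr => r _; rewrite natr_sum mulr_suml.
under eq_bigr => c _ do rewrite E.
rewrite exchange_big /=; rewrite big_nat_cond [RHS]big_nat_cond.
apply: eq_bigr => r /andP [/andP [r0 rn] _].
rewrite exchange_big /= /orbit_sum mulr_suml; apply: eq_big_seq => s sf.
have DE := map_descend_orbit_poly r0 sf; set D := descend _ _ in DE *.
rewrite -(@monic_sum_multiples D r n) //; last 2 first.
- by rewrite -(map_monic j) DE monic_orbit_poly.
- by rewrite -(size_map_poly j) DE size_orbit_poly.
rewrite [RHS]big_mkcond /=; apply: eq_bigr => c _.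
by rewrite -DE dvdp_map; case: (D %| _); rewrite ?mul1r ?mul0r.
Qed.
End MonicEnumeration.

Lemma real_expr_unbounded (x D : algC) : 1 < x -> D \is Num.real -> exists n, D < x ^+ n.
Proof.
move=> x1 Dr; have x0 : 0 < x - 1 by rewrite subr_gt0.
have bern n : 1 + n%:R * (x - 1) <= x ^+ n.
  elim: n => [|n IH]; first by rewrite mul0r addr0 expr0.
  rewrite exprS; apply: le_trans (ler_wpM2l _ IH); last by rewrite ltW // (lt_trans ltr01).
  rewrite -subr_ge0.
  have -> : x * (1 + n%:R * (x - 1)) - (1 + n.+1%:R * (x - 1)) = n%:R * (x - 1) ^+ 2.
    by rewrite -addn1 natrD; ring.
  by rewrite mulr_ge0 ?ler0n // exprn_ge0 // ltW.
pose t := `|D| / (x - 1).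
have t0 : 0 <= t by rewrite divr_ge0 // ltW.
exists (Num.bound t); apply: lt_le_trans (bern _).
have : D <= `|D| by apply: real_ler_norm.
move=> /le_lt_trans; apply.
have : `|D| = t * (x - 1) by rewrite /t divfK // gt_eqF.
move=> ->; apply: (@lt_trans _ _ ((Num.bound t)%:R * (x - 1))).
  by rewrite ltr_pM2r // archi_boundP.
by rewrite ltrDr ltr01.
Qed.

(** With A = a^u and B = b^u, the identity (A - B)^2 = 2 (A^2 + B^2) - (A + B)^2 uses the hypothesis
    for u and for 2u and bounds A - B, hence A, by (C + 1) r^u. Letting u grow removes the
    constant. *)
Lemma power_sum2_bound (a b r C : algC) : 0 < r ->
  (forall u, (0 < u)%N -> `|a ^+ u + b ^+ u| <= C * r ^+ u) -> `|a| <= r.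
Proof.
move=> r0 h.
have rN u : 0 < r ^+ u by rewrite exprn_gt0.
have C0 : 0 <= C.
  by have := le_trans (normr_ge0 _) (h 1%N isT); rewrite expr1 pmulr_lge0.
have h1 u : (0 < u)%N -> `|a| ^+ u <= (C + 1) * r ^+ u.
  move=> u0; set A := a ^+ u; set B := b ^+ u; set R := r ^+ u.
  have hA : `|A + B| <= C * R by exact: h.
  have hA2 : `|A ^+ 2 + B ^+ 2| <= C * R ^+ 2.
    by have := h (u * 2)%N; rewrite !exprM; apply; rewrite muln_gt0 u0.
  have R0 : 0 <= R by rewrite ltW // rN.
  have E1 : `|(A - B) ^+ 2| <= ((C + 1) * R) ^+ 2.
    have -> : (A - B) ^+ 2 = (A ^+ 2 + B ^+ 2) + (A ^+ 2 + B ^+ 2) - (A + B) ^+ 2 by ring.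
    apply: le_trans (ler_normB _ _) _; apply: le_trans (lerD (ler_normD _ _) (lexx _)) _.
    have h3 : `|(A + B) ^+ 2| <= (C * R) ^+ 2 by rewrite normrX lerXn2r // nnegrE ?mulr_ge0.
    apply: le_trans (lerD (lerD hA2 hA2) h3) _; rewrite -subr_ge0.
    have -> : ((C + 1) * R) ^+ 2 - (C * R ^+ 2 + C * R ^+ 2 + (C * R) ^+ 2) = R ^+ 2 by ring.
    exact: exprn_ge0.
  have E2 : `|A - B| <= (C + 1) * R.
    by rewrite normrX in E1; rewrite -(@ler_pXn2r _ 2) ?nnegrE ?mulr_ge0 ?addr_ge0.
  have E3 : `|A *+ 2| <= ((C + 1) * R) *+ 2.
    have -> : A *+ 2 = (A + B) + (A - B) by ring.
    apply: le_trans (ler_normD _ _) _; rewrite mulr2n lerD //.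
    by apply: le_trans hA _; rewrite ler_wpM2r // lerDl ler01.
  by move: E3; rewrite normrMn ler_pMn2r // /A normrX.
have : `|a| / r \is Num.real by rewrite ger0_real // divr_ge0 // ltW.
have [//|ra _] := real_leP (normr_real a) (gtr0_real r0).
have x1 : 1 < `|a| / r by rewrite ltr_pdivlMr // mul1r.
have Dr : C + 1 + 1 \is Num.real by rewrite ger0_real // !addr_ge0.
have [n] := real_expr_unbounded x1 Dr.
case: n => [|n]; rewrite ?expr0.
  by rewrite le_gtF // lerDr addr_ge0.
rewrite expr_div_n ltr_pdivlMr // => h2.
have := lt_le_trans h2 (h1 n.+1 isT); rewrite ltr_pM2r // le_gtF //.
by rewrite lerDl ler01.
Qed.

Lemma card_nonzero (R : finNzRingType) : #|[pred x : R | x != 0]| = #|R|.-1.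
Proof.
by rewrite [in RHS](cardD1 (0 : R)) /=; apply: eq_card => a; rewrite !inE andbT.
Qed.

(** * Character sums over a line *)

Section Weil.
Variables (F L : finFieldType) (iota : {rmorphism F -> L}) (y : L).
Let q := #|F|.
Hypothesis cardL : #|L| = (q ^ 4)%N.
Hypothesis y_free : forall f : {poly F}, (size f <= 4)%N -> (map_poly iota f).[y] = 0 -> f = 0.
Variable chi : L -> algC.
Hypotheses (chi0 : chi 0 = 0) (chi1 : chi 1 = 1) (chiM : {morph chi : a b / a * b}).
Hypothesis chiF : forall c, c != 0 -> chi (iota c) = 1.
Hypothesis chi_sum : \sum_x chi x = 0.
Hypothesis chi_norm : forall x, `|chi x| <= 1.

Let q_gt1 : (1 < q)%N. Proof. exact: finNzRing_gt1. Qed.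

(** A Dirichlet character modulo the minimal polynomial of y, which has degree 4, and trivial on the
    constants. *)
Let psi (f : {poly F}) := chi (map_poly iota f).[y].
Let psiM : {morph psi : f g / f * g}.
Proof. by move=> f g; rewrite /psi rmorphM hornerM chiM. Qed.
Let A n := monic_sum psi n.

Let ev4 (c : 'rV[F]_4) : L := (map_poly iota (rVpoly c)).[y].
Let ev4_bij : bijective ev4.
Proof.
apply: inj_card_bij; last by rewrite card_mx mul1n cardL.
move=> c c' h; apply: (can_inj (@rVpolyK _ _)); apply/eqP; rewrite -subr_eq0; apply/eqP.
apply: y_free; last by rewrite rmorphB hornerD hornerN -/(ev4 c) -/(ev4 c') h subrr.
by rewrite -raddfB size_poly.
Qed.

Let A0 : A 0%N = 1.
Proof.
rewrite /A /monic_sum (big_pred1 0) => [|c]; last by rewrite /= (thinmx0 c) eqxx.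
by rewrite /psi /monic_of linear0 addr0 expr0 rmorph1 hornerC chi1.
Qed.

(** Adding polynomials of degree below 4 moves f(y) uniformly through L, over which chi sums to
    0. *)
Let A_ge4 n : (4 <= n)%N -> A n = 0.
Proof.
move=> n4.
pose w (v : 'rV[F]_4) : 'rV[F]_n := poly_rV (rVpoly v).
have wE v : rVpoly (w v) = rVpoly v.
  by apply: poly_rV_K; apply: leq_trans (size_poly _ _) n4.
have E v : A n = \sum_(c : 'rV[F]_n) chi ((map_poly iota (monic_of c)).[y] + ev4 v).
  rewrite /A /monic_sum (reindex_inj (addIr (w v))) /=; apply: eq_bigr => c _.
  have h : rVpoly (c + w v) = rVpoly c + rVpoly v by rewrite linearD /= wE.
  by rewrite /psi /monic_of h addrA rmorphD /= hornerD.
have : \sum_(v : 'rV[F]_4) A n = 0.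
  under eq_bigr => v _ do rewrite (E v).
  rewrite exchange_big /=; apply: big1 => c _.
  rewrite -[RHS]chi_sum [RHS](reindex_inj (addrI (map_poly iota (monic_of c)).[y])) /=.
  by rewrite [RHS](reindex ev4) //; apply: onW_bij.
rewrite sumr_const => /eqP; rewrite mulrn_eq0 => /orP [|/eqP //].
by rewrite card_mx mul1n expn_eq0 (gtn_eqF (ltnW q_gt1)).
Qed.

Let T m := \sum_(c : 'rV[F]_m) psi (rVpoly c).

Let T_step m : T m.+1 = T m + (q.-1)%:R * A m.
Proof.
pose h (z : F * 'rV[F]_m) : 'rV[F]_m.+1 := poly_rV (rVpoly z.2 + z.1 *: 'X^m).
have hE z : rVpoly (h z) = rVpoly z.2 + z.1 *: 'X^m.
  apply: poly_rV_K; apply: leq_trans (size_polyD _ _) _; rewrite geq_max.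
  rewrite (leq_trans (size_poly _ _)) //=; apply: leq_trans (size_scale_leq _ _) _.
  by rewrite size_polyXn.
have hb : bijective h.
  apply: inj_card_bij => [[a c] [a' c'] /(congr1 (@rVpoly _ _))|].
    rewrite !hE /= => E.
    have ea : a = a'.
      have := congr1 (fun f : {poly F} => f`_m) E; rewrite !coefD !coefZ !coefXn eqxx !mulr1.
      by rewrite !nth_default ?add0r // size_poly.
    by move: E; rewrite ea => /addIr /(congr1 (@poly_rV _ m)); rewrite !rVpolyK => ->.
  by rewrite card_prod !card_mx !mul1n expnS.
rewrite /T (reindex h) /=; last exact: onW_bij.
under eq_bigr => z _ do rewrite hE.
rewrite -(pair_bigA _ (fun a c => psi (rVpoly c + a *: 'X^m))) /= (bigD1 0) //=; congr (_ + _).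
  by apply: eq_bigr => c _; rewrite scale0r addr0.
rewrite /q -card_nonzero -[in RHS]sum1_card natr_sum mulr_suml; apply: eq_bigr => a a0; rewrite mul1r.
have inj : injective (fun c : 'rV[F]_m => a *: c) by move=> c c'; apply: scalerI.
rewrite (reindex_inj inj) /A /monic_sum; apply: eq_bigr => c _.
have -> : rVpoly (a *: c) + a *: 'X^m = a%:P * monic_of c.
  by rewrite linearZ /= -scalerDr mul_polyC addrC.
by rewrite psiM {1}/psi map_polyC hornerC chiF // mul1r.
Qed.

(** The trivial zero of the L-polynomial at 1, due to chi being trivial on F^*. At y the polynomials
    of degree below 4 take every value of L once, so T 4 = 0; sorting them by leading coefficient,
    which chi ignores, gives q - 1 times the sum in question. *)
Let A_sum0 : 1 + A 1%N + A 2%N + A 3%N = 0.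
Proof.
have T0 : T 0%N = 0.
  rewrite /T (big_pred1 0) => [|c]; last by rewrite /= (thinmx0 c) eqxx.
  by rewrite /psi linear0 rmorph0 horner0 chi0.
have T4 : T 4%N = 0.
  by rewrite -[RHS]chi_sum [RHS](reindex ev4) //; apply: onW_bij.
have : (q.-1)%:R * (1 + A 1%N + A 2%N + A 3%N) = 0.
  by rewrite -[RHS]T4 !T_step T0 A0; ring.
move/eqP; rewrite mulf_eq0 pnatr_eq0 => /orP [|/eqP //].
by move: q_gt1; case: (q) => [|[|]].
Qed.

Section OrbitSumBound.
Variables (K : closedFieldType) (jL : {rmorphism L -> K}) (fp : nat -> seq K).
Hypothesis fpP : forall r, (0 < r)%N -> uniq (fp r) /\ forall s, (s \in fp r) = (s ^+ (q ^ r) == s).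
Let j : {rmorphism F -> K} := jL \o iota.
Let y' := jL y.

Let frob_sub (a b : K) e : (a - b) ^+ (q ^ e) = a ^+ (q ^ e) - b ^+ (q ^ e).
Proof.
elim: e => [|e IH]; first by rewrite expn0 !expr1.
rewrite expnSr !exprM IH; apply/eqP; rewrite eq_sym subr_eq; apply/eqP.
by rewrite -(expf_card_add j) subrK.
Qed.

Let y4 t : y' ^+ (q ^ (t * 4)) = y'.
Proof. by apply: frob_fixed_iter; rewrite -cardL -rmorphXn expf_card. Qed.

Let y_orbit k : (0 < k < 4)%N -> y' ^+ (q ^ k) != y'.
Proof.
move=> /andP [k0 k4]; apply/eqP => h.
have DE : map_poly j (descend j (orbit_poly F y' k)) = orbit_poly F y' k.
  by apply: descendK; apply: map_frob_orbit_poly.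
set D := descend _ _ in DE.
have sD : size D = k.+1 by rewrite -(size_map_poly j) DE size_orbit_poly.
suff D0 : D = 0 by move: sD; rewrite D0 size_poly0.
apply: y_free; first by rewrite sD.
apply: (fmorph_inj jL); rewrite rmorph0 -horner_map -map_poly_comp DE -/y' /orbit_poly.
by case: k k0 {k4 h DE D sD} => // k _; rewrite big_ord_recl expn0 expr1 hornerM hornerXsubC subrr mul0r.
Qed.

(** The value at y' of the orbit polynomial of length 4, as a polynomial in s: since y'^(q^4) = y',
    the factor y' - s^(q^i) is the q^i-th power of y'^(q^(4 - i)) - s. Only i = 0 has the root y',
    so that root is simple, as Stepanov's method requires. *)
Let h : {poly K} := \prod_(i < 4) ((y' ^+ (q ^ (4 - i)))%:P - 'X) ^+ (q ^ i).
Let h1 : {poly K} := - \prod_(i < 3) ((y' ^+ (q ^ (4 - lift ord0 i)))%:P - 'X) ^+ (q ^ lift ord0 i).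

Let hE : h = ('X - y'%:P) * h1.
Proof.
rewrite /h big_ord_recl /= subn0 expn0 expr1 (y4 1) /h1.
by rewrite -[y'%:P - 'X]opprB mulNr mulrN.
Qed.

Let h1y : h1.[y'] != 0.
Proof.
rewrite /h1 hornerN oppr_eq0 horner_prod prodf_seq_neq0; apply/allP => i _ /=.
rewrite horner_exp expf_neq0 // hornerD hornerN hornerC hornerX subr_eq0; apply: y_orbit.
by have := ltn_ord i; rewrite /= /bump /=; lia.
Qed.

Let h0 : h != 0.
Proof.
by rewrite hE mulf_neq0 ?polyXsubC_eq0 //; apply: contraNneq h1y => ->; rewrite horner0.
Qed.

Let orbit_value s t : (orbit_poly F s (t * 4)).[y'] = h.[s] ^+ (\sum_(i < t) (q ^ 4) ^ i).
Proof.
elim: t => [|t IH]; first by rewrite mul0n /orbit_poly !big_ord0 expr0 hornerC.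
rewrite mulSn addnC /orbit_poly big_split_ord /= hornerM -/(orbit_poly F s (t * 4)) IH.
rewrite [in RHS]big_ord_recr exprD /=; congr (_ * _).
rewrite /h !horner_prod -prodrXl; apply: eq_bigr => i _.
rewrite horner_exp !hornerE -expnM -exprM -expnD frob_sub -exprM -expnD; congr (_ - _).
  by rewrite -{1}(y4 t.+1); congr (y' ^+ (q ^ _)); have := ltn_ord i; lia.
by congr (s ^+ (q ^ _)); lia.
Qed.

(** Degrees 8 u suffice because [power_sum2_bound] will be applied to eighth powers. For R = |L|^u
    the points form the field with R^2 elements, and the value attached to s is (h(s)^m)^(R + 1)
    with R = d m + 1. Stepanov's method shows that each nonzero value is taken at most (m + C1) R
    times, against an average of about m R. *)
Lemma orbit_sum_bound : exists C : algC, forall u, (0 < u)%N ->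
  `|orbit_sum psi j fp (8 * u)| <= C * (#|L|%:R) ^+ u.
Proof.
pose Q0 := #|L|; pose d := (Q0 - 1)%N; pose D := (size h).-1; pose C1 := (d * D + D + 1)%N.
exists (d * C1 + D)%:R => u u0.
have Q01 : (2 < Q0)%N.
  have : (2 ^ 4 <= q ^ 4)%N by rewrite leq_exp2r.
  by rewrite -cardL -/Q0; lia.
pose m := (\sum_(i < u) Q0 ^ i)%N; pose R := (Q0 ^ u)%N.
have RE : R = (d * m).+1.
  by have := predn_exp Q0 u; rewrite -/R -/m /d subn1 => <-; rewrite prednK // expn_gt0 ltnW // ltnW.
have m0 : (0 < m)%N.
  by rewrite /m; case: u u0 {m R RE} => // u _; rewrite big_ord_recl expn0.
have [p [e [pF e0 qE]]] := finField_card_pX F.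
have pK : p \in [pchar K] by exact: rmorph_pchar j _ pF.
have pk : (p ^ (e * 4 * u))%N = R by rewrite /R /Q0 cardL (_ : q = (p ^ e)%N) // !expnM.
have RR : (q ^ (8 * u))%N = (R * R)%N.
  by rewrite /R /Q0 cardL -!expnM -expnD; congr expn; lia.
have [uf memf] : uniq (fp (8 * u)) /\ forall s, (s \in fp (8 * u)) = (s ^+ (q ^ (8 * u)) == s).
  by apply: fpP; lia.
pose val s : L := (map_poly iota (descend j (orbit_poly F s (8 * u)))).[y].
have valE s : s \in fp (8 * u) -> jL (val s) = (h.[s] ^+ m) ^+ R.+1.
  move=> sf; rewrite -horner_map -map_poly_comp -/y'.
  have -> : map_poly (jL \o iota) (descend j (orbit_poly F s (8 * u))) = orbit_poly F s (8 * u).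
    by apply: (@map_descend_orbit_poly F K j fp fpP _ _ _ sf); rewrite muln_gt0 u0.
  have -> : (8 * u = (u + u) * 4)%N by lia.
  rewrite orbit_value -exprM; congr (_ ^+ _); rewrite big_split_ord /= -cardL -/Q0 -/m mulnS.
  by congr addn; rewrite /m big_distrl /=; apply: eq_bigr => i _; rewrite expnD mulnC.
pose N g := count (fun s => val s == g) (fp (8 * u)).
have Nle g : g != 0 -> (N g <= (m + C1) * R)%N.
  move=> g0; rewrite /N -size_filter.
  have -> : (m + C1 = m + d * (size h).-1 + (size h).-1 + 1)%N by rewrite /C1 -/D; lia.
  rewrite -pk; apply: (stepanov (d := d) (c := jL g) pK _ m0 _ hE h1y) => //.
  - by rewrite /d; lia.
  - by rewrite pk.
  - by rewrite pk -RR -[RHS](y4 (2 * u)%N); congr (_ ^+ (q ^ _)%N); lia.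
  - by rewrite fmorph_eq0.
  - by rewrite filter_uniq.
  - move=> s; rewrite mem_filter pk -RR => /andP [/eqP <- sf]; rewrite valE //; split=> //.
    by apply/eqP; rewrite -memf.
have N0 : (N (0%R : L) <= D)%N.
  rewrite /N -size_filter /D -ltnS prednK ?lt0n ?size_poly_eq0 //.
  apply: max_poly_roots => //; last by rewrite filter_uniq.
  apply/allP => s; rewrite mem_filter => /andP [/eqP vs sf].
  have := valE s sf; rewrite vs rmorph0 => /esym/eqP; rewrite !expf_eq0 => /andP [_ /andP [_]].
  by rewrite rootE.
have Ntot : (\sum_g N g = R * R)%N.
  have r0 : (0 < 8 * u)%N by rewrite muln_gt0 u0.
  have [S [uS sS] memS] := fixed_points j r0.
  rewrite -RR -sS -(perm_size (uniq_perm uf uS _)); last by move=> s; rewrite memf memS.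
  rewrite -sum1_size (eq_bigr (fun g => \sum_(s <- fp (8 * u) | val s == g) 1%N)).
    rewrite (exchange_big_dep xpredT) //=; apply: eq_bigr => s _.
    by rewrite (big_pred1 (val s)) // => g; rewrite eq_sym.
  by move=> g _; rewrite sum1_count.
(* The defects e' are nonnegative, and their total is O(R) because the upper bounds add up to little
   more than the R^2 points. As chi sums to 0, the orbit sum is minus the chi-weighted sum of the
   defects: the one-sided bound is enough. *)
pose e' g := ((m + C1) * R - N g)%N.
have e'E g : g != 0 -> (e' g + N g = (m + C1) * R)%N by move=> g0; rewrite /e' subnK // Nle.
have SE : orbit_sum psi j fp (8 * u) = - \sum_(g | g != 0) chi g * (e' g)%:R.
  have -> : orbit_sum psi j fp (8 * u) = \sum_g chi g * (N g)%:R.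
    rewrite /orbit_sum (eq_bigr (fun s => \sum_(g | g == val s) chi g)); last first.
      by move=> s _; rewrite big_pred1_eq.
    rewrite (exchange_big_dep xpredT) //=; apply: eq_bigr => g _.
    rewrite /N -sum1_count natr_sum mulr_sumr; apply: eq_big => [s|s _]; first by rewrite eq_sym.
    by rewrite mulr1.
  rewrite (bigD1 0) //= chi0 mul0r add0r -sumrN.
  have : \sum_(g | g != 0) chi g * ((m + C1) * R)%:R = 0.
    rewrite -mulr_suml; have := chi_sum; rewrite (bigD1 0) //= chi0 add0r => ->.
    by rewrite mul0r.
  move=> E0; rewrite (eq_bigr (fun g => chi g * ((m + C1) * R)%:R - chi g * (e' g)%:R)).
    by rewrite sumrB E0 sub0r sumrN.
  by move=> g g0; rewrite -(e'E g g0) natrD; ring.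
rewrite SE normrN; apply: le_trans (ler_norm_sum _ _ _) _.
apply: (@le_trans _ _ (\sum_(g | g != 0) (e' g)%:R)).
  by apply: ler_sum => g _; rewrite normrM normr_nat ler_piMl.
rewrite -natr_sum -natrX -natrM ler_nat -/R.
have E1 : (\sum_(g | g != 0%R) e' g + \sum_(g | g != 0%R) N g = d * ((m + C1) * R))%N.
  rewrite -big_split /= (eq_bigr (fun=> (m + C1) * R)%N) => [|g g0]; last exact: e'E.
  rewrite sum_nat_const; congr muln; rewrite /d /Q0 subn1 -card_nonzero.
  exact: eq_card.
have E2 : (N 0%R + \sum_(g | g != 0%R) N g = R * R)%N by rewrite -Ntot [RHS](bigD1 (0 : L)).
move: E1 E2 N0; move: (\sum_(g | g != 0%R) e' g)%N (\sum_(g | g != 0%R) N g)%N (N 0%R).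
clear -RE; move=> a b c E1 E2 N0.
have : (d * m * R = (R - 1) * R)%N by rewrite RE subn1.
have R1 : (1 <= R)%N by rewrite RE.
have : (D <= D * R)%N by rewrite leq_pmulr.
rewrite mulnDl mulnDr mulnA in E1.
by rewrite mulnDl -mulnA mulnBl mul1n; move: E1; lia.
Qed.
End OrbitSumBound.

(* L(T) = (1 - T)(1 + S T + B T^2) with S = 1 + A_1, and the orbit sums are minus its power sums. *)
Lemma weil_line_bound : `|1 + \sum_t chi (y + iota t)| ^+ 2 <= 4%:R * q%:R.
Proof.
have [K [jL _]] := countable_algebraic_closure L.
pose j : {rmorphism F -> K} := jL \o iota.
pose fp r := if r is r'.+1 then s2val (fixed_points j (ltn0Sn r')) else [::].
have fpP r : (0 < r)%N -> uniq (fp r) /\ forall s, (s \in fp r) = (s ^+ (q ^ r) == s).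
  case: r => // r _; rewrite /fp; case: fixed_points => S [uS _] memS /=; by split.
have [C hC] := orbit_sum_bound jL fpP.
pose Sr := orbit_sum psi j fp.
have newton n : n%:R * A n = \sum_(1 <= r < n.+1) Sr r * A (n - r) by exact: monic_sum_newton.
have A1E : A 1%N = \sum_t chi (y + iota t).
  rewrite /A /monic_sum (reindex (fun t : F => t%:M : 'rV[F]_1)) /=; last first.
    exists (fun c : 'rV_1 => c 0 0) => [t _|c _]; first by rewrite mxE eqxx.
    by apply/rowP => i; rewrite !mxE ord1 eqxx.
  apply: eq_bigr => t _; rewrite /psi /monic_of; congr (chi _).
  have -> : rVpoly (t%:M : 'rV[F]_1) = t%:P.
    apply/polyP => -[|i]; first by rewrite coefC (coef_rVpoly_ord _ (ord0 : 'I_1)) mxE eqxx.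
    by rewrite coefC nth_default // (leq_trans (size_poly _ _)).
  by rewrite rmorphD /= map_polyXn map_polyC hornerD hornerC hornerXn expr1.
rewrite -A1E; set S := 1 + A 1%N; pose B := 1 + A 1%N + A 2%N.
have [w1 w1E] : exists w : algC, w ^+ 2 + S * w + B = 0.
  have sz : size ('X^2 + (S *: 'X + B%:P) : {poly algC}) = 3.
    rewrite size_polyDl size_polyXn //; apply: leq_ltn_trans (size_polyD _ _) _.
    rewrite gtn_max (leq_ltn_trans (size_scale_leq _ _)) ?size_polyX //=.
    by rewrite (leq_ltn_trans (size_polyC_leq1 _)).
  have [|w] := closed_rootP ('X^2 + (S *: 'X + B%:P) : {poly algC}) _; first by rewrite sz.
  by rewrite rootE hornerD hornerXn hornerD hornerZ hornerX hornerC addrA => /eqP h; exists w.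
pose w2 := - S - w1.
have w12 : w1 * w2 = B by rewrite /w2 -[LHS]addr0 -w1E; ring.
have w1w2 : w1 + w2 = - S by rewrite /w2; ring.
have A1 : A 1%N = - (1 + w1 + w2) by rewrite -[RHS]opprK -addrA opprD w1w2 /S; ring.
have A2 : A 2%N = w1 * w2 + w1 + w2 by rewrite -addrA w1w2 w12 /B /S; ring.
have A3 : A 3%N = - (w1 * w2) by rewrite w12 /B -[RHS]add0r -A_sum0; ring.
pose Pw r : algC := - (1 + w1 ^+ r + w2 ^+ r).
have newtonP n : n%:R * A n = \sum_(1 <= r < n.+1) Pw r * A (n - r).
  case: n => [|[|[|[|k]]]].
  - by rewrite big_geq // mul0r.
  - by rewrite big_nat1 subnn A0 A1 /Pw !expr1; ring.
  - by rewrite big_ltn // big_nat1 subnn A0 A1 A2 /Pw !expr1; ring.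
  - by rewrite big_ltn // big_ltn // big_nat1 subnn A0 A1 A2 A3 /Pw !expr1; ring.
  have Z : \sum_(1 <= r < k.+1) Pw r * A (k.+4 - r) = 0.
    rewrite big_nat_cond; apply: big1 => r /andP [/andP [_ rk] _].
    by rewrite A_ge4 ?mulr0 //; lia.
  rewrite A_ge4 // mulr0 (@big_cat_nat _ _ _ k.+1) //; last by lia.
  rewrite Z [RHS]add0r.
  do 4!(rewrite big_ltn; last by lia).
  rewrite /= big_geq //= addr0.
  have -> : (k.+4 - k.+1 = 3)%N by lia.
  have -> : (k.+4 - k.+2 = 2)%N by lia.
  have -> : (k.+4 - k.+3 = 1)%N by lia.
  by rewrite subnn A0 A1 A2 A3 /Pw !exprS; ring.
(* As A 0 = 1, Newton's recursion determines the power sums from the A n. *)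
have SP n : (0 < n)%N -> Sr n = Pw n.
  elim/ltn_ind: n => n IH n0.
  have := newton n; rewrite newtonP !big_nat_recr //= subnn A0 !mulr1.
  rewrite (eq_big_nat _ _ (F2 := fun r => Sr r * A (n - r))); first by move/addrI.
  by move=> r /andP [r0 rn]; rewrite IH.
have rho1 : 1 <= (#|L|%:R : algC) by rewrite ler1n cardL expn_gt0 ltnW.
have rho0 : 0 < (#|L|%:R : algC) by apply: lt_le_trans rho1.
have sumb u : (0 < u)%N -> `|(w1 ^+ 8) ^+ u + (w2 ^+ 8) ^+ u| <= (C + 1) * #|L|%:R ^+ u.
  move=> u0; rewrite -!exprM.
  have -> : w1 ^+ (8 * u) + w2 ^+ (8 * u) = - Sr (8 * u)%N - 1.
    by rewrite SP ?muln_gt0 // /Pw; ring.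
  apply: le_trans (ler_normB _ _) _; rewrite normrN normr1 mulrDl mul1r.
  by apply: lerD; [exact: hC | exact: exprn_ege1].
have half w : `|w ^+ 8| <= #|L|%:R -> `|w| ^+ 2 <= q%:R.
  rewrite cardL natrX normrX (exprM _ 2 4) ler_pXn2r ?nnegrE ?exprn_ge0 //.
have b1 : `|w1| ^+ 2 <= q%:R by apply: half; exact: power_sum2_bound rho0 sumb.
have b2 : `|w2| ^+ 2 <= q%:R.
  by apply: half; apply: (power_sum2_bound rho0 (b := w1 ^+ 8)) => u u0; rewrite addrC; exact: sumb.
have -> : S = - (w1 + w2) by rewrite w1w2 opprK.
rewrite normrN; apply: (@le_trans _ _ ((`|w1| + `|w2|) ^+ 2)).
  by rewrite ler_pXn2r ?nnegrE ?addr_ge0 // ler_normD.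
have -> : 4%:R * q%:R = q%:R + q%:R + (q%:R + q%:R) :> algC by ring.
apply: le_trans (lerD (lerD b1 b1) (lerD b2 b2)); rewrite -subr_ge0.
have -> : `|w1| ^+ 2 + `|w1| ^+ 2 + (`|w2| ^+ 2 + `|w2| ^+ 2) - (`|w1| + `|w2|) ^+ 2
   = (`|w1| - `|w2|) ^+ 2 by ring.
by apply: real_exprn_even_ge0 => //; rewrite rpredB // normr_real.
Qed.
End Weil.

Lemma finField_generator (L : finFieldType) : exists w : L, w != 0 /\
  (forall x, x != 0 -> exists i, x = w ^+ i) /\ (forall i, (w ^+ i == 1) = (#|L|.-1 %| i)%N).
Proof.
have /cyclicP [u uE] := field_unit_group_cyclic [set: {unit L}].
exists (val u); split; first by rewrite -unitfE; exact: valP.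
split=> [x x0|i].
  have xu : x \is a GRing.unit by rewrite unitfE.
  have : FinRing.Unit xu \in <[u]>%g by rewrite -uE inE.
  by case/cycleP => i /(congr1 val) /= ->; exists i; rewrite FinRing.val_unitX.
rewrite -FinRing.val_unitX -FinRing.val_unit1 val_eqE -order_dvdn; congr (_ %| _)%N.
by rewrite orderE -uE card_finField_unit.
Qed.

(** * Character sums over subspaces *)

Section SubgroupSum.
Variables (L : finFieldType) (chi : L -> algC) (V : {set L}).
Hypotheses (chi0 : chi 0 = 0) (chi1 : chi 1 = 1) (chiM : {morph chi : a b / a * b}).
Hypothesis chi_sum : \sum_x chi x = 0.
Hypothesis chi_norm : forall x, x != 0 -> `|chi x| = 1.
Hypothesis V0 : 0 \in V.
Hypothesis VB : forall x y, x \in V -> y \in V -> x - y \in V.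

Let VD x y : x \in V -> y \in V -> x + y \in V.
Proof. by move=> xV yV; rewrite -[y]opprK -[- y]sub0r !VB. Qed.

(** For z != 0 the term is chi(1 + u / z), and u / z runs through all nonzero elements. *)
Let corr u : u != 0 -> \sum_z chi (z + u) * (chi z)^* = -1.
Proof.
move=> u0; rewrite (bigD1 0) //= chi0 conjC0 mulr0 add0r.
have E z : z != 0 -> chi (z + u) * (chi z)^* = chi (1 + u / z).
  move=> z0; have cz : chi z * (chi z)^* = 1 by rewrite -normCK chi_norm // expr1n.
  have -> : 1 + u / z = (z + u) / z by rewrite mulrDl divff.
  rewrite chiM; congr (_ * _).
  have cz0 : chi z != 0 by rewrite -normr_eq0 chi_norm // oner_eq0.
  by apply: (mulfI cz0); rewrite cz -chiM divff.
rewrite (eq_bigr (fun z => chi (1 + u / z))) //.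
have inv : {on [pred z : L | z != 0], bijective (fun z : L => u / z)}.
  exists (fun z => u / z) => z z0; rewrite invf_div mulrA mulrAC -mulrA; have /= z0' := z0.
  - by rewrite mulVKf.
  - by rewrite mulVKf.
rewrite (eq_bigl (fun z => u / z != 0)); last first.
  by move=> z; rewrite mulf_eq0 (negbTE u0) invr_eq0.
have := reindex _ inv => /(_ _ _ _ (fun t => chi (1 + t))) <-.
have := chi_sum; rewrite (reindex_inj (addrI 1)) (bigD1 0) //= addr0 chi1.
by move/eqP; rewrite addrC addr_eq0 => /eqP.
Qed.

(** The second moment over all translates of V equals |V| (|L| - |V|) by [corr], and each of the |V|
    translates by elements of V contributes |S|^2 to it. *)
Lemma subgroup_char_sum : `|\sum_(x in V) chi x| ^+ 2 <= #|L|%:R.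
Proof.
set S := \sum_(x in V) chi x.
pose Sy y := \sum_(v in V) chi (y + v).
have SyV y : y \in V -> Sy y = S.
  move=> yV; rewrite /S (reindex_inj (addrI y)) /Sy; apply: eq_bigl => v.
  by apply/idP/idP => h; [exact: VD | rewrite -[v](addKr y) addrC VB].
have diag v : \sum_y chi (y + v) * (chi (y + v))^* = (#|L|.-1)%:R.
  transitivity (\sum_y chi y * (chi y)^*); first by rewrite [RHS](reindex_inj (addIr v)).
  rewrite (bigD1 0) //= chi0 mul0r add0r.
  rewrite -card_nonzero -sum1_card natr_sum; apply: eq_bigr => y y0.
  by rewrite -normCK chi_norm // expr1n.
have off v v' : v != v' -> \sum_y chi (y + v) * (chi (y + v'))^* = -1.
  move=> vv'; rewrite -(corr (u := v - v')) ?subr_eq0 //.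
  rewrite [RHS](reindex_inj (addIr v')) /=; apply: eq_bigr => y _.
  by congr (chi _ * _); rewrite -addrA [v' + _]addrC subrK.
have tot : \sum_y `|Sy y| ^+ 2 = \sum_(v in V) ((#|L|.-1)%:R - (#|V| - 1)%:R).
  rewrite (eq_bigr (fun y => \sum_(v in V) \sum_(v' in V) chi (y + v) * (chi (y + v'))^*)).
  2: by move=> y _; rewrite normCK rmorph_sum big_distrlr.
  rewrite exchange_big /=; apply: eq_bigr => v vV.
  rewrite exchange_big /= (bigD1 v) //= diag; congr (_ + _).
  rewrite (eq_bigr (fun=> -1)) => [|v' /andP [_ ne]]; last by rewrite off // eq_sym.
  rewrite sumr_const mulNrn; congr (- _%:R).
  by rewrite (cardsD1 v) vV add1n subn1 /=; apply: eq_card => x; rewrite !inE andbC.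
have le1 : S * S^* *+ #|V| <= \sum_y `|Sy y| ^+ 2.
  rewrite -sumr_const [X in _ <= X](bigID (fun y => y \in V)) /=.
  have -> : \sum_(y in V) S * S^* = \sum_(y in V) `|Sy y| ^+ 2.
    by apply: eq_bigr => y yV; rewrite SyV // normCK.
  by rewrite lerDl sumr_ge0 // => y _; rewrite exprn_ge0.
have V1 : (0 < #|V|)%N by apply/card_gt0P; exists 0.
rewrite normCK -(@ler_pMn2r _ _ V1) //; apply: le_trans le1 _.
rewrite tot sumr_const ler_pMn2r //; apply: le_trans (_ : (#|L|.-1)%:R <= _).
  by rewrite lerBlDr lerDl ler0n.
by rewrite ler_nat leq_pred.
Qed.
End SubgroupSum.

Section Dlog.
Variables (F L : finFieldType) (iota : {rmorphism F -> L}) (n : nat).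
Hypothesis n_gt0 : (0 < n)%N.
Hypothesis cardL : #|L| = (#|F| ^ n)%N.
Let q := #|F|.
(** (q^n - 1) / (q - 1), the order of the quotient group L^* / F^*. *)
Definition proj_order (q n : nat) := (\sum_(i < n) q ^ i)%N.
Let M := proj_order q n.

Lemma proj_orderE : (#|L|.-1 = M * q.-1)%N.
Proof. by rewrite cardL predn_exp mulnC. Qed.

Variables (w : L).
Hypothesis w0 : w != 0.
Hypothesis w_gen : forall x, x != 0 -> exists i, x = w ^+ i.
Hypothesis w_order : forall i, (w ^+ i == 1) = (#|L|.-1 %| i)%N.

Definition dlog (x : L) : nat := odflt 0%N (omap (@nat_of_ord _) [pick i : 'I_(#|L|) | w ^+ i == x]).

Lemma dlogK x : x != 0 -> w ^+ dlog x = x.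
Proof.
move=> x0; rewrite /dlog; case: pickP => [i /eqP //|ne].
have [i xi] := w_gen x0.
have L1 : (0 < #|L|.-1)%N by have := finNzRing_gt1 L; case: #|L| => [|[]].
have im : (i %% #|L|.-1 < #|L|)%N.
  by apply: leq_trans (ltn_pmod _ L1) _; apply: leq_pred.
have := ne (Ordinal im); rewrite /= xi {2}(divn_eq i #|L|.-1) exprD mulnC exprM.
by have /eqP -> : w ^+ #|L|.-1 == 1 by [rewrite w_order]; rewrite expr1n mul1r eqxx.
Qed.

Lemma w_eq i i' : (w ^+ i == w ^+ i') = (i == i' %[mod #|L|.-1])%N.
Proof.
have main a b : (a <= b)%N -> (w ^+ a == w ^+ b) = (a == b %[mod #|L|.-1])%N.
  move=> ab; rewrite -(subnK ab) exprD -{1}[w ^+ a]mul1r.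
  rewrite (inj_eq (mulIf _)) ?expf_neq0 // eq_sym w_order [RHS]eq_sym.
  by have := eqn_modDr a (b - a) 0 #|L|.-1; rewrite add0n mod0n => ->.
by case: (leqP i i') => h; [exact: main | rewrite eq_sym [RHS]eq_sym main // ltnW].
Qed.

Lemma mod_proj_order i i' : i = i' %[mod #|L|.-1] -> i = i' %[mod M].
Proof.
have ML : (M %| #|L|.-1)%N by rewrite proj_orderE dvdn_mulr.
by move=> h; rewrite -(modn_dvdm i ML) h modn_dvdm.
Qed.

Lemma dlogM x y : x != 0 -> y != 0 -> dlog (x * y) = (dlog x + dlog y)%N %[mod M].
Proof.
move=> x0 y0; apply: mod_proj_order; apply/eqP; rewrite -w_eq.
by rewrite exprD !dlogK ?mulf_neq0.
Qed.

Lemma dlogF c : c != 0 -> (M %| dlog (iota c))%N.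
Proof.
move=> c0; have ic0 : iota c != 0 by rewrite fmorph_eq0.
have q1 : (0 < q.-1)%N by have := finNzRing_gt1 F; rewrite /q; case: #|F| => [|[]].
have c1 : c ^+ q.-1 = 1.
  by apply: (mulfI c0); rewrite -exprS prednK ?expf_card ?mulr1 // ltnW // finNzRing_gt1.
have : w ^+ (dlog (iota c) * q.-1) == 1 by rewrite exprM dlogK // -rmorphXn c1 rmorph1.
by rewrite w_order proj_orderE dvdn_pmul2r.
Qed.

Variable z : algC.
Hypothesis zM : M.-primitive_root z.

(** Since z has order M, only the class of x modulo F^* matters: these are the characters of L^*
    that are trivial on F^*, extended by 0. *)
Definition mchar (a : nat) (x : L) : algC := if x == 0 then 0 else z ^+ (a * dlog x).

Lemma mchar0 a : mchar a 0 = 0. Proof. by rewrite /mchar eqxx. Qed.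

Lemma z_exp_mod i i' : (i = i' %[mod M])%N -> z ^+ i = z ^+ i'.
Proof. by move=> h; apply/eqP; rewrite (eq_prim_root_expr zM); apply/eqP. Qed.

Lemma mchar_iota a c : c != 0 -> mchar a (iota c) = 1.
Proof.
move=> c0; rewrite /mchar fmorph_eq0 (negbTE c0) -[RHS](expr0 z); apply: z_exp_mod.
by rewrite mod0n; apply/eqP; rewrite -/(dvdn _ _) dvdn_mull // dlogF.
Qed.

Lemma mchar1 a : mchar a 1 = 1.
Proof. by rewrite -(rmorph1 iota) mchar_iota // oner_neq0. Qed.

Lemma mcharM a : {morph mchar a : x y / x * y}.
Proof.
move=> x y; rewrite /mchar mulf_eq0; have [_|x0] := eqVneq x 0; first by rewrite mul0r.
have [_|y0] /= := eqVneq y 0; first by rewrite mulr0.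
rewrite -exprD -mulnDr; apply: z_exp_mod.
by rewrite -modnMmr dlogM // modnMmr.
Qed.

Lemma mchar_norm a x : x != 0 -> `|mchar a x| = 1.
Proof.
move=> x0; rewrite /mchar (negbTE x0); have M0 := prim_order_gt0 zM.
have : `|z| ^+ M = 1 by rewrite -normrX (prim_expr_order zM) normr1.
move=> h; have : `|z| = 1 by apply/eqP; rewrite -(@pexpr_eq1 _ _ M) // h.
by move=> z1; rewrite normrX z1 expr1n.
Qed.

Lemma mchar_sum a : ~~ (M %| a)%N -> \sum_x mchar a x = 0.
Proof.
move=> na; pose c := mchar a w.
have c1 : c != 1.
  rewrite /c /mchar (negbTE w0) -(prim_order_dvd zM); apply: contra na => h.
  have : (a * dlog w = a * 1 %[mod M])%N.
    rewrite -modnMmr (mod_proj_order (_ : dlog w = 1 %[mod _])) ?modnMmr //.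
    by apply/eqP; rewrite -w_eq dlogK.
  by rewrite muln1 => h1; rewrite /dvdn -h1.
have : (1 - c) * \sum_x mchar a x = 0.
  rewrite mulrBl mul1r mulr_sumr [X in X - _](reindex_inj (mulfI w0)) /= -sumrB.
  by apply: big1 => x _; rewrite mcharM subrr.
by move/eqP; rewrite mulf_eq0 subr_eq0 eq_sym (negbTE c1) => /eqP.
Qed.
End Dlog.

(** * The action of polynomials *)

Section FrobeniusAction.
Variables (F L : finFieldType) (iota : {rmorphism F -> L}).
Let q := #|F|.

Definition act (P : {poly F}) (x : L) : L := \sum_(i < size P) iota P`_i * x ^+ (q ^ i).

Lemma act_widen N (P : {poly F}) x : (size P <= N)%N -> act P x = \sum_(i < N) iota P`_i * x ^+ (q ^ i).
Proof.
move=> sN; rewrite /act (big_ord_widen _ (fun i => iota P`_i * x ^+ (q ^ i)) sN).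
rewrite big_mkcond; apply: eq_bigr => i _; case: ltnP => // h.
by rewrite nth_default // rmorph0 mul0r.
Qed.

Lemma act0 x : act 0 x = 0. Proof. by rewrite /act size_poly0 big_ord0. Qed.

Lemma actDl P Q x : act (P + Q) x = act P x + act Q x.
Proof.
pose N := maxn (size P) (size Q).
rewrite (@act_widen N (P + Q)) ?size_polyD // (@act_widen N P) ?leq_maxl //.
rewrite (@act_widen N Q) ?leq_maxr // -big_split; apply: eq_bigr => i _ /=.
by rewrite coefD rmorphD mulrDl.
Qed.

Lemma actZl c P x : act (c *: P) x = iota c * act P x.
Proof.
rewrite (act_widen _ (size_scale_leq c P)) /act mulr_sumr; apply: eq_bigr => i _.
by rewrite coefZ rmorphM mulrA.
Qed.

Let powD e (x y : L) : (x + y) ^+ (q ^ e) = x ^+ (q ^ e) + y ^+ (q ^ e).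
Proof.
elim: e => [|e IH]; first by rewrite !expn0 !expr1.
by rewrite expnSr !exprM IH (expf_card_add iota).
Qed.

Lemma actDr P x y : act P (x + y) = act P x + act P y.
Proof. by rewrite /act -big_split; apply: eq_bigr => i _ /=; rewrite powD mulrDr. Qed.

Lemma act_0r P : act P 0 = 0.
Proof. by apply/eqP; rewrite -(inj_eq (addIr (act P 0))) -actDr !add0r. Qed.

Lemma actBr P x y : act P (x - y) = act P x - act P y.
Proof. by apply/eqP; rewrite eq_sym subr_eq -actDr subrK. Qed.

Lemma actX P x : act ('X * P) x = act P x ^+ q.
Proof.
have sX : (size ('X * P)%R <= (size P).+1)%N.
  by rewrite mulrC; have [->|P0] := eqVneq P 0; rewrite ?mul0r ?size_poly0 // size_mulX.
rewrite (act_widen _ sX) big_ord_recl coefXM /= rmorph0 mul0r add0r.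
have S (r : seq 'I_(size P)) (G : 'I_(size P) -> L) : (\sum_(i <- r) G i) ^+ q = \sum_(i <- r) G i ^+ q.
  apply: (big_morph (fun x : L => x ^+ q)); first by move=> a b; exact: expf_card_add iota a b.
  by rewrite expr0n gtn_eqF // ltnW // finNzRing_gt1.
rewrite /act S; apply: eq_bigr => i _.
by rewrite coefXM /= exprMn -rmorphXn expf_card -exprM -expnSr.
Qed.

Lemma act_pow P x : act P (x ^+ q) = act P x ^+ q.
Proof.
have S (r : seq 'I_(size P)) (G : 'I_(size P) -> L) : (\sum_(i <- r) G i) ^+ q = \sum_(i <- r) G i ^+ q.
  apply: (big_morph (fun x : L => x ^+ q)); first by move=> a b; exact: expf_card_add iota a b.
  by rewrite expr0n gtn_eqF // ltnW // finNzRing_gt1.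
rewrite /act S; apply: eq_bigr => i _; rewrite exprMn -rmorphXn expf_card.
by rewrite -!exprM mulnC.
Qed.

Lemma act_C c x : act c%:P x = iota c * x.
Proof. by rewrite (act_widen _ (size_polyC_leq1 c)) big_ord1 coefC expn0 expr1. Qed.

Lemma actM P Q x : act (P * Q) x = act P (act Q x).
Proof.
elim/poly_ind: P Q x => [|P c IH] Q x; first by rewrite mul0r !act0.
rewrite mulrDl !actDl -mulrA IH actX mul_polyC actZl act_C; congr (_ + _).
by rewrite mulrC actX act_pow.
Qed.

Lemma act_Xn k x : act 'X^k x = x ^+ (q ^ k).
Proof.
elim: k => [|k IH]; first by rewrite expr0 -polyC1 act_C rmorph1 mul1r expn0 expr1.
by rewrite exprS actX IH -exprM -expnSr.
Qed.

Lemma act1 x : act 1 x = x.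
Proof. by rewrite -polyC1 act_C rmorph1 mul1r. Qed.

Lemma actN P x : act (- P) x = - act P x.
Proof. by rewrite -scaleN1r actZl rmorphN1 mulN1r. Qed.

Definition act_ker (f : {poly F}) : {set L} := [set x | act f x == 0].

Lemma act_kerP f x : reflect (act f x = 0) (x \in act_ker f).
Proof. by rewrite inE; apply: eqP. Qed.

Lemma act_ker0 f : 0 \in act_ker f. Proof. by rewrite inE act_0r. Qed.

Lemma act_kerB f x y : x \in act_ker f -> y \in act_ker f -> x - y \in act_ker f.
Proof. by rewrite !inE actBr => /eqP -> /eqP ->; rewrite subr0. Qed.

Lemma act_ker_dvd f g x : f %| g -> x \in act_ker f -> x \in act_ker g.
Proof. by case/dvdpP => h ->; rewrite !inE actM => /eqP ->; rewrite act_0r. Qed.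

Lemma card_act_ker_le f : f != 0 -> (#|act_ker f| <= q ^ (size f).-1)%N.
Proof.
move=> f0; pose P : {poly L} := \sum_(i < size f) iota f`_i *: 'X^(q ^ i).
have q1 : (1 < q)%N := finNzRing_gt1 F.
have sf : (0 < size f)%N by rewrite lt0n size_poly_eq0.
have Pc : P`_(q ^ (size f).-1) = iota (lead_coef f).
  rewrite /P coef_sum.
  have lt : ((size f).-1 < size f)%N by rewrite prednK.
  rewrite (bigD1 (Ordinal lt)) //= coefZ coefXn eqxx mulr1 big1 ?addr0 // => i ne.
  rewrite coefZ coefXn eqn_exp2l // (_ : ((size f).-1 == i) = false) ?mulr0 //.
  by apply/negbTE; apply: contraNneq ne => h; apply/eqP/val_inj.
have P0 : P != 0.
  by apply/eqP => P0; move: Pc; rewrite P0 coef0 => /esym/eqP; rewrite fmorph_eq0 lead_coef_eq0 (negbTE f0).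
have sP : (size P <= (q ^ (size f).-1).+1)%N.
  apply: leq_trans (size_sum _ _ _) _; apply/bigmax_leqP => i _.
  apply: leq_trans (size_scale_leq _ _) _; rewrite size_polyXn ltnS leq_exp2l //.
  by rewrite -ltnS prednK.
rewrite cardE -ltnS; apply: leq_trans sP; apply: max_poly_roots => //; last exact: enum_uniq.
apply/allP => x; rewrite mem_enum inE rootE /P horner_sum => /eqP h; apply/eqP.
by rewrite -[RHS]h /act; apply: eq_bigr => i _; rewrite hornerZ hornerXn.
Qed.

Variable n : nat.
Hypothesis n_gt0 : (0 < n)%N.
Hypothesis cardL : #|L| = (q ^ n)%N.

Lemma act_Xn1 x : act ('X^n - 1) x = 0.
Proof. by rewrite actDl act_Xn actN act1 -cardL expf_card subrr. Qed.

Lemma Xn1_neq0 : 'X^n - 1 != 0 :> {poly F}.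
Proof. by rewrite -size_poly_eq0 size_XnsubC. Qed.

Lemma dvd_Xn1_neq0 (f : {poly F}) : f %| 'X^n - 1 -> f != 0.
Proof. by apply: contraTneq => ->; rewrite dvd0p Xn1_neq0. Qed.

(** The roots of the associated linearised polynomials give the upper bound, for f and for its
    cofactor h. The map h sends L into the kernel of f with fibres of at most q^(deg h) elements,
    which gives the lower bound. *)
Lemma card_act_ker f : f %| 'X^n - 1 -> #|act_ker f| = (q ^ (size f).-1)%N.
Proof.
move=> fd; have f0 := dvd_Xn1_neq0 fd.
apply/eqP; rewrite eqn_leq card_act_ker_le //=.
have /dvdpP [h hE] := fd.
have h0 : h != 0 by apply/eqP => h0; move: Xn1_neq0; rewrite hE h0 mul0r eqxx.
have dg : ((size h).-1 + (size f).-1 = n)%N.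
  have := congr1 (fun p : {poly F} => size p) hE; rewrite size_XnsubC // size_mul //.
  have : (0 < size f)%N by rewrite lt0n size_poly_eq0.
  have : (0 < size h)%N by rewrite lt0n size_poly_eq0.
  by move: (size h) (size f) => [|a] [|b] //= _ _; lia.
have fib y : (#|[set x | act h x == y]| <= q ^ (size h).-1)%N.
  have [->|[x0]] := set_0Vmem [set x | act h x == y]; first by rewrite cards0.
  rewrite inE => /eqP hx0; apply: leq_trans (card_act_ker_le h0).
  rewrite -(card_imset _ (addIr (- x0))); apply: subset_leq_card; apply/subsetP => z.
  by case/imsetP => x; rewrite !inE => /eqP hx ->; rewrite actBr hx hx0 subrr.
have tot : (#|L| <= #|act_ker f| * q ^ (size h).-1)%N.
  rewrite -[X in (X <= _)%N]sum1_card (partition_big (act h) (mem (act_ker f))) /=; last first.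
    by move=> x _; rewrite inE -actM mulrC -hE act_Xn1.
  rewrite -sum_nat_const; apply: leq_sum => y _.
  by apply: leq_trans (fib y); rewrite -sum1_card; apply: eq_leq; apply: eq_bigl => x; rewrite inE.
have q0 : (0 < q ^ (size h).-1)%N by rewrite expn_gt0 ltnW // finNzRing_gt1.
by rewrite -(leq_pmul2r q0); apply: leq_trans tot; rewrite cardL -dg -expnD addnC.
Qed.

(** When [rs] lists the distinct irreducible factors of f, these are the elements whose annihilator
    is f. *)
Definition exact_ker (f : {poly F}) (rs : seq {poly F}) : {set L} :=
  [set x in act_ker f | all (fun r => act (f %/ r) x != 0) rs].

Fixpoint coprime_list (rs : seq {poly F}) :=
  if rs is r :: rs' then all (coprimep r) rs' && coprime_list rs' else true.

(** For x killed by f / r, Bezout for r and r' shows that f / r' kills x only if f / (r r') does. On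
    that kernel the conditions for f and for f / r therefore agree, which is the recursion behind
    inclusion-exclusion. *)
Lemma exact_ker_cons f r rs : r %| f -> f != 0 -> all (fun r' => r' %| f) rs -> all (coprimep r) rs ->
  exact_ker f (r :: rs) = exact_ker f rs :\: exact_ker (f %/ r) rs /\
  exact_ker (f %/ r) rs \subset exact_ker f rs.
Proof.
move=> rf f0 rsf cop.
have r0 : r != 0 by apply: contraTneq rf => ->; rewrite dvd0p.
have fr : f %/ r %| f by rewrite divp_dvd.
have key x : act (f %/ r) x = 0 ->
    all (fun r' => act (f %/ r') x != 0) rs = all (fun r' => act (f %/ r %/ r') x != 0) rs.
  move=> h; apply: eq_in_all => r' r'in; congr (~~ _).
  have c := allP cop _ r'in; have r'f := allP rsf _ r'in.
  have r'0 : r' != 0 by apply: contraTneq r'f => ->; rewrite dvd0p.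
  have rr' : r * r' %| f by rewrite Gauss_dvdp // rf.
  have /dvdpP [g gE] := rr'.
  have E1 : f %/ r = g * r' by rewrite gE [r * r']mulrC mulrA mulpK.
  have E2 : f %/ r' = g * r by rewrite gE mulrA mulpK.
  have E3 : f %/ r %/ r' = g by rewrite E1 mulpK.
  rewrite E3 E2; rewrite E1 in h; apply/eqP/eqP => [h2|h2].
    have /Bezout_eq1_coprimepP [[u v] /= uv] := c.
    have -> : g = u * (g * r) + v * (g * r') by rewrite -[LHS]mul1r -uv; ring.
    by rewrite actDl [act (u * _) x]actM [act (v * _) x]actM h h2 !act_0r addr0.
  by rewrite mulrC actM h2 act_0r.
split; last first.
  apply/subsetP => x; rewrite !inE => /andP [/eqP h a].
  by rewrite key // a andbT; apply/eqP/act_kerP; apply: act_ker_dvd fr _; rewrite inE h.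
apply/setP => x; rewrite !inE /=.
case fx : (act f x == 0) => //=; last by rewrite andbF.
by have [h|h] /= := eqVneq (act (f %/ r) x) 0; rewrite ?andbT // key // andNb.
Qed.
Lemma coprime_quotient (f r r' : {poly F}) : r %| f -> r' %| f -> coprimep r r' -> r != 0 -> r' %| f %/ r.
Proof.
move=> rf r'f c r0; have rr' : r * r' %| f by rewrite Gauss_dvdp // rf.
by have /dvdpP [g ->] := rr'; rewrite mulrCA mulrC mulpK // dvdp_mull.
Qed.

Lemma exact_ker_sum (G : L -> algC) (beta : algC) (f : {poly F}) rs :
  (forall g : {poly F}, g %| 'X^n - 1 -> `|\sum_(x in act_ker g) G x| <= beta) ->
  f %| 'X^n - 1 -> all (fun r => r %| f) rs -> coprime_list rs ->
  `|\sum_(x in exact_ker f rs) G x| <= 2 ^+ size rs * beta.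
Proof.
move=> hb; elim: rs f => [|r rs IH] f fd.
  move=> _ _; rewrite expr0 mul1r; apply: le_trans (hb f fd).
  by rewrite le_eqVlt; apply/orP; left; apply/eqP; congr `|_|; apply: eq_bigl => x; rewrite inE andbT.
have f0 := dvd_Xn1_neq0 fd.
rewrite /= => /andP [rf rsf] /andP [cr crs].
have r0 : r != 0 by apply: contraTneq rf => ->; rewrite dvd0p.
have [-> sub] := exact_ker_cons rf f0 rsf cr.
have -> : \sum_(x in exact_ker f rs :\: exact_ker (f %/ r) rs) G x =
   \sum_(x in exact_ker f rs) G x - \sum_(x in exact_ker (f %/ r) rs) G x.
  apply/eqP; rewrite eq_sym subr_eq; apply/eqP.
  by rewrite addrC [LHS](big_setID (exact_ker (f %/ r) rs)) /= (setIidPr sub).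
have frd : f %/ r %| 'X^n - 1 by apply: dvdp_trans fd; apply: divp_dvd.
apply: le_trans (ler_normB _ _) _; rewrite exprS -mulrA mulr2n mulrDl !mul1r.
apply: lerD; first exact: IH.
apply: IH => //; apply/allP => r' r'in.
by apply: coprime_quotient => //; [exact: (allP rsf) | exact: (allP cr)].
Qed.

Lemma card_exact_ker (f : {poly F}) rs :
  f %| 'X^n - 1 -> all (fun r => r %| f) rs -> coprime_list rs ->
  #|exact_ker f rs|%:R = q%:R ^+ (size f).-1 * \prod_(r <- rs) (1 - q%:R ^- (size r).-1) :> algC.
Proof.
have q0 : (q%:R : algC) != 0 by rewrite pnatr_eq0 -lt0n ltnW // finNzRing_gt1.
elim: rs f => [|r rs IH] f fd.
  move=> _ _; rewrite big_nil mulr1 -natrX -card_act_ker //; congr (_%:R); apply: eq_card => x.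
  by rewrite inE andbT.
have f0 := dvd_Xn1_neq0 fd.
rewrite /= => /andP [rf rsf] /andP [cr crs].
have r0 : r != 0 by apply: contraTneq rf => ->; rewrite dvd0p.
have [-> sub] := exact_ker_cons rf f0 rsf cr.
have frd : f %/ r %| 'X^n - 1 by apply: dvdp_trans fd; apply: divp_dvd.
rewrite cardsD (setIidPr sub) natrB ?subset_leq_card // !IH //; last first.
  apply/allP => r' r'in.
  by apply: coprime_quotient => //; [exact: (allP rsf) | exact: (allP cr)].
rewrite big_cons size_divp // mulrA mulrBr mulr1 -mulrBl; congr (_ * _); congr (_ - _).
have le : ((size r).-1 <= (size f).-1)%N.
  by have := dvdp_leq f0 rf; move: (size r) (size f) => [|a] [|b].
have -> : (size f - (size r).-1).-1 = ((size f).-1 - (size r).-1)%N.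
  by clear; move: (size r) (size f) => [|a] [|b] /=; lia.
by rewrite expfB_cond // ?(negbTE q0).
Qed.

Local Notation g_of x := (g_poly q n x).

(** Frobenius shifts the coefficients of g cyclically; x leaves at the top and returns at the bottom
    as x^(q^n). *)
Lemma g_poly_mulX (x : L) : 'X * g_of x = g_of (x ^+ q) + x *: ('X^n - 1).
Proof.
pose t i := x ^+ (q ^ i) *: ('X^(n - i) : {poly L}).
have -> : 'X * g_of x = \sum_(0 <= i < n) t i.
  rewrite big_mkord /g_poly mulr_sumr; apply: eq_bigr => i _.
  by rewrite -scalerAr -exprS; congr (_ *: 'X^_); have := ltn_ord i; clear; lia.
have -> : g_of (x ^+ q) = \sum_(0 <= i < n) t i.+1.
  rewrite big_mkord /g_poly; apply: eq_bigr => i _.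
  by rewrite -exprM -expnS; congr (_ *: 'X^_); have := ltn_ord i; clear; lia.
have T := telescope_sumr t (leq0n n).
rewrite -[LHS](subKr (\sum_(0 <= i < n) t i.+1)) -sumrB T /t subn0 subnn expn0 expr1.
by rewrite -cardL expf_card opprB expr0 scalerBr.
Qed.

Lemma g_polyD (x y : L) : g_of (x + y) = g_of x + g_of y.
Proof. by rewrite /g_poly -big_split; apply: eq_bigr => i _ /=; rewrite powD scalerDl. Qed.

Lemma g_polyZ c (x : L) : g_of (iota c * x) = iota c *: g_of x.
Proof.
rewrite /g_poly scaler_sumr; apply: eq_bigr => i _; rewrite scalerA exprMn; congr (_ * _ *: _).
elim: (val i) => [|e IH]; first by rewrite expn0 expr1.
by rewrite expnSr exprM IH -rmorphXn expf_card.
Qed.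

Lemma size_g_poly (x : L) : (size (g_of x) <= n)%N.
Proof.
apply: leq_trans (size_sum _ _ _) _; apply/bigmax_leqP => i _.
apply: leq_trans (size_scale_leq _ _) _; rewrite size_polyXn.
by have := ltn_ord i; clear; lia.
Qed.

Lemma coef_g_poly (x : L) i : (i < n)%N -> (g_of x)`_(n.-1 - i) = x ^+ (q ^ i).
Proof.
move=> ni; rewrite /g_poly coef_sum (bigD1 (Ordinal ni)) //= coefZ coefXn eqxx mulr1 big1 ?addr0 //.
move=> k ne; rewrite coefZ coefXn; case: eqP => [h|_]; last by rewrite mulr0.
case/eqP: ne; apply: val_inj => /=; have := ltn_ord k; move: h ni; clear; move: (nat_of_ord k) => j; lia.
Qed.

Lemma g_poly_eq0 (x : L) : (g_of x == 0) = (x == 0).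
Proof.
apply/eqP/eqP => [h|->].
  by have := coef_g_poly x n_gt0; rewrite h coef0 expn0 expr1.
rewrite /g_poly; apply: big1 => i _; rewrite expr0n expn_eq0 gtn_eqF ?scale0r //.
by rewrite ltnW // finNzRing_gt1.
Qed.

(* Modulo X^n - 1, multiplying by a polynomial over F amounts to acting on the element. *)
Lemma g_poly_act (P : {poly F}) x :
  ('X^n - 1) %| map_poly iota P * g_of x - g_of (act P x).
Proof.
elim/poly_ind: P x => [|P c IH] x.
  by rewrite act0 rmorph0 mul0r sub0r (eqP (_ : g_of 0 == 0)) ?g_poly_eq0 // oppr0 dvdp0.
have -> : act (P * 'X + c%:P) x = act P (x ^+ q) + iota c * x.
  by rewrite actDl act_C mulrC actX act_pow.
rewrite g_polyD g_polyZ rmorphD rmorphM /= map_polyX map_polyC.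
have -> : (map_poly iota P * 'X + (iota c)%:P) * g_of x - (g_of (act P (x ^+ q)) + iota c *: g_of x)
   = (map_poly iota P * g_of (x ^+ q) - g_of (act P (x ^+ q))) + (map_poly iota P * x%:P) * ('X^n - 1).
  rewrite mulrDl -mulrA g_poly_mulX mulrDr -!mul_polyC; ring.
by rewrite dvdp_addr // dvdp_mull.
Qed.

(** Since g has degree below n, X^n - 1 divides it only when it is 0. Thus the annihilator of x is
    (X^n - 1) / gcd(X^n - 1, g), which ties [k_normal] to the action. *)
Lemma g_poly_dvd (P : {poly F}) x :
  (('X^n - 1) %| map_poly iota P * g_of x) = (act P x == 0).
Proof.
have h := g_poly_act P x.
have -> : (('X^n - 1) %| map_poly iota P * g_of x) = ('X^n - 1 %| g_of (act P x)).
  by rewrite -[map_poly iota P * g_of x](subrK (g_of (act P x))) dvdp_addr.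
apply/idP/eqP => [d|->]; last by rewrite (eqP (_ : g_of 0 == 0)) ?g_poly_eq0 // dvdp0.
apply/eqP; rewrite -g_poly_eq0; apply: contraTT d => g0.
by apply/negP => /(dvdp_leq g0); rewrite size_XnsubC // ltnNge size_g_poly.
Qed.

Lemma map_Xn1 : map_poly iota ('X^n - 1) = 'X^n - 1.
Proof. by rewrite rmorphB /= map_polyXn rmorph1. Qed.

(** Frobenius sends g for a to g for a^q, which is X g modulo X^n - 1, and X is prime to X^n - 1. So
    Frobenius fixes the monic gcd, whose coefficients then lie in F. *)
Lemma gcd_g_poly_descends (a : L) : exists D : {poly F},
  D %| 'X^n - 1 /\ map_poly iota D %= gcdp ('X^n - 1) (g_of a).
Proof.
set G := gcdp _ _.
have N0 : ('X^n - 1 : {poly L}) != 0 by rewrite -size_poly_eq0 size_XnsubC.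
have G0 : G != 0 by rewrite gcdp_eq0 (negbTE N0).
have lG : lead_coef G != 0 by rewrite lead_coef_eq0.
pose D1 := (lead_coef G)^-1 *: G.
have D1m : D1 \is monic by rewrite monicE lead_coefZ mulVf.
have D1G : D1 %= G by rewrite eqp_scale // invr_eq0.
have mg : map_poly (frobenius iota) (g_of a) = g_of (a ^+ q).
  rewrite /g_poly rmorph_sum /=; apply: eq_bigr => i _.
  by rewrite -!mul_polyC rmorphM /= map_polyC map_polyXn /= /frobenius -!exprM mulnC.
have mN : map_poly (frobenius iota) ('X^n - 1) = 'X^n - 1.
  by rewrite rmorphB /= map_polyXn rmorph1.
have cX : coprimep ('X^n - 1 : {poly L}) 'X.
  by rewrite coprimepX rootE !hornerE expr0n gtn_eqF // sub0r oppr_eq0 oner_neq0.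
have mG : map_poly (frobenius iota) G %= G.
  rewrite gcdp_map mg mN.
  have -> : g_of (a ^+ q) = (- a%:P) * ('X^n - 1) + 'X * g_of a.
    by rewrite g_poly_mulX mulNr mul_polyC [RHS]addrC addrK.
  exact: eqp_trans (gcdp_addl_mul _ _ _) (Gauss_gcdpr _ cX).
have mD : map_poly (frobenius iota) D1 = D1.
  apply/eqP; rewrite -eqp_monic // ?map_monic //.
  by apply: eqp_trans (eqp_trans mG _); rewrite ?eqp_map // eqp_sym.
exists (descend iota D1); rewrite descendK //; split=> //.
by rewrite -(dvdp_map iota) descendK // map_Xn1 (eqp_dvdl _ D1G) dvdp_gcdl.
Qed.

Lemma gcd_g_poly_cofactor (a : L) (D E : {poly F}) :
  D * E = 'X^n - 1 -> map_poly iota D %= gcdp ('X^n - 1) (g_of a) -> act E a = 0.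
Proof.
move=> DE Dg; apply/eqP; rewrite -g_poly_dvd.
have : map_poly iota D %| g_of a by rewrite (eqp_dvdl _ Dg) dvdp_gcdr.
case/dvdpP => H ->; rewrite mulrCA -rmorphM /= [E * D]mulrC DE map_Xn1.
by rewrite dvdp_mull.
Qed.

Lemma k_normal_cofactor k (a : L) : k_normal q n k.+1 a ->
  exists D E : {poly F}, [/\ D * E = 'X^n - 1, size D = k.+2 & act E a = 0].
Proof.
rewrite /k_normal => h; have [D [Dn Dg]] := gcd_g_poly_descends a.
have /dvdpP [E DE] := Dn; exists D, E; split; first by rewrite mulrC.
  rewrite -(size_map_poly iota) (eqp_size Dg); move: h.
  by case: (size _) => // m /= ->.
by apply: gcd_g_poly_cofactor Dg; rewrite mulrC.
Qed.

Lemma k_normal_exact (a : L) (f D2 : {poly F}) : D2 * f = 'X^n - 1 -> act f a = 0 ->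
  (forall P, act P a = 0 -> f %| P) -> k_normal q n (size D2).-1 a.
Proof.
move=> D2f fa fP; have [D [Dn Dg]] := gcd_g_poly_descends a.
have /dvdpP [E ED] := Dn; have DE : D * E = 'X^n - 1 by rewrite mulrC.
have [N0 f0 E0 D20] : [/\ ('X^n - 1 : {poly F}) != 0, f != 0, E != 0 & D2 != 0].
  split; first exact: Xn1_neq0.
  - by apply/eqP => z; move: Xn1_neq0; rewrite -D2f z mulr0 eqxx.
  - by apply/eqP => z; move: Xn1_neq0; rewrite -DE z mulr0 eqxx.
  - by apply/eqP => z; move: Xn1_neq0; rewrite -D2f z mul0r eqxx.
rewrite /k_normal -(eqp_size Dg) size_map_poly; congr _.-1; apply: eqp_size.
apply/andP; split.
  have /fP /dvdpP [h hE] := gcd_g_poly_cofactor DE Dg.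
  apply/dvdpP; exists h; apply: (mulIf f0).
  by rewrite D2f -DE hE mulrC mulrAC.
rewrite -(dvdp_map iota) (eqp_dvdr _ Dg) dvdp_gcd -map_Xn1 dvdp_map -D2f dvdp_mulr //=.
have f0' : map_poly iota f != 0 by rewrite map_poly_eq0.
rewrite -(dvdp_mul2r _ _ f0') -rmorphM /= D2f map_Xn1 [X in _ %| X]mulrC g_poly_dvd.
exact/eqP.
Qed.
End FrobeniusAction.

(** * Irreducible factors and exact annihilators *)

Lemma irreducible_factor (F : finFieldType) (h : {poly F}) : (1 < size h)%N ->
  exists r, [/\ irreducible_poly r, r \is monic & r %| h].
Proof.
move=> h1; have h0 : h != 0 by rewrite -size_poly_gt0 ltnW.
have mon (g : {poly F}) : (1 < size g)%N -> g %| h ->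
    [exists c : 'rV[F]_(size g).-1, monic_of c %| h] && (0 < (size g).-1)%N.
  move=> g1 gh; have g0 : g != 0 by rewrite -size_poly_gt0 ltnW.
  have lg : lead_coef g != 0 by rewrite lead_coef_eq0.
  rewrite -ltnS prednK ?(ltnW g1) // g1 andbT; apply/existsP.
  exists (poly_rV ((lead_coef g)^-1 *: g - 'X^((size g).-1))).
  rewrite monic_ofK ?(dvdpZl _ _ (_ : _ != 0)) ?invr_eq0 //.
    by rewrite monicE lead_coefZ mulVf.
  by rewrite size_scale ?invr_eq0 // prednK // ltnW.
have ex : exists m, [exists c : 'rV[F]_m, monic_of c %| h] && (0 < m)%N.
  by exists (size h).-1; apply: mon.
case: (ex_minnP ex) => m /andP [/existsP [c ch] m0] mmin.
exists (monic_of c); split=> //; last exact: monic_of_monic.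
split=> [|g g1 gc]; first by rewrite size_monic_of.
have c0 : monic_of c != 0 by rewrite monic_neq0 // monic_of_monic.
have g0 : g != 0 by apply: contraTneq gc => ->; rewrite dvd0p.
have g2 : (1 < size g)%N by move: g0 g1; rewrite -size_poly_gt0; case: (size g) => [|[]].
have := mmin _ (mon g g2 (dvdp_trans gc ch)) => le.
rewrite -dvdp_size_eqp // eqn_leq dvdp_leq //= size_monic_of.
by move: le g2; case: (size g).
Qed.

Lemma irreducible_coprime (F : fieldType) (r g : {poly F}) :
  irreducible_poly r -> ~~ (r %| g) -> coprimep r g.
Proof.
case=> r1 rP ng; rewrite /coprimep; apply: contraNT ng => h.
by have := rP _ h (dvdp_gcdl _ _) => /eqp_dvdl <-; apply: dvdp_gcdr.
Qed.

Lemma irreducible_eqp (F : fieldType) (r s : {poly F}) :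
  irreducible_poly r -> irreducible_poly s -> r %| s -> r %= s.
Proof. by case=> r1 _ [_ sP] rs; apply: sP => //; rewrite gtn_eqF. Qed.

Lemma distinct_irreducible_factors (F : finFieldType) (f : {poly F}) : f != 0 ->
  exists rs : seq {poly F}, [/\ forall r, r \in rs -> [/\ irreducible_poly r, r \is monic & r %| f],
    uniq rs, coprime_list rs & forall r, irreducible_poly r -> r %| f -> has (fun s => r %= s) rs].
Proof.
have [m] := ubnP (size f); elim: m f => // m IH f sf f0.
have [f1|f1] := leqP (size f) 1.
  exists [::]; split=> // r [r1 _] rf; have := dvdp_leq f0 rf.
  by rewrite leqNgt (leq_ltn_trans f1 r1).
have [r [ri rm rf]] := irreducible_factor f1; have /dvdpP [g gE] := rf.
have [r0 g0] : r != 0 /\ g != 0 by apply/andP; move: f0; rewrite gE mulf_eq0 negb_or andbC.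
have sg : (size g < m)%N.
  apply: leq_trans (_ : size f <= m)%N => //; have := ri.1; rewrite gE size_mul //.
  by rewrite -size_poly_gt0 in g0; move: (size r) (size g) g0 => [|[|a]] [|b] // _ _; rewrite addnS /=; lia.
have [rs [rsP urs crs rsA]] := IH g sg g0.
have rsP' s : s \in rs -> [/\ irreducible_poly s, s \is monic & s %| f].
  by move=> /rsP [a b c]; split=> //; rewrite gE dvdp_mulr.
have rsA' s : irreducible_poly s -> s %| f -> (s %= r) || has (fun t => s %= t) rs.
  move=> si sf'; case: (boolP (s %| r)) => sr; first by rewrite irreducible_eqp.
  by rewrite rsA ?orbT //; rewrite gE Gauss_dvdpl in sf' => //; apply: irreducible_coprime.
case: (boolP (r \in rs)) => rin.
  exists rs; split=> // s si sf'; have /orP [sr|//] := rsA' s si sf'.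
  by apply/hasP; exists r.
exists (r :: rs); split.
- by move=> s; rewrite inE => /orP [/eqP ->|/rsP'].
- by rewrite /= rin.
- rewrite /= crs andbT; apply/allP => s sin; apply: irreducible_coprime => //.
  apply/negP => rs'; have [si sm _] := rsP s sin.
  have := irreducible_eqp ri si rs'; rewrite eqp_monic // => /eqP E.
  by rewrite E sin in rin.
- exact: rsA'.
Qed.

(** By Bezout the gcd g of P and f kills a. If g were a proper divisor, some s in [rs] would divide
    f / g, and f / s, a multiple of g, would kill a. *)
Lemma exact_ker_annihilator (F L : finFieldType) (iota : {rmorphism F -> L}) (f : {poly F}) rs (a : L) :
  f != 0 -> (forall r, irreducible_poly r -> r %| f -> has (fun s => r %= s) rs) ->
  a \in exact_ker iota f rs -> forall P, act iota P a = 0 -> f %| P.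
Proof.
move=> f0 rsA; rewrite !inE => /andP [/eqP fa /allP rsa] P Pa.
have [[u v] /= uv] := Bezoutp P f; set g := gcdp P f in uv.
have ga : act iota g a = 0.
  have /eqpP [[c1 c2] /= /andP [c10 c20] cE] := uv.
  have : act iota (c2 *: g) a = 0 by rewrite -cE actZl actDl !actM Pa fa !act_0r addr0 mulr0.
  by rewrite actZl => /eqP; rewrite mulf_eq0 fmorph_eq0 (negbTE c20) => /eqP.
have gf : g %| f := dvdp_gcdr _ _; have /dvdpP [h hE] := gf.
have [h0 g0] : h != 0 /\ g != 0 by apply/andP; move: f0; rewrite hE mulf_eq0 negb_or.
have [h1|h1] := leqP (size h) 1.
  have : g %= f.
    rewrite -dvdp_size_eqp // hE size_mul // eq_sym; move: h1; rewrite -size_poly_gt0 in h0.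
    by move: h0; case: (size h) => [|[]].
  by move/eqp_dvdl <-; apply: dvdp_gcdl.
have [r [ri _ rh]] := irreducible_factor h1.
have /hasP [s sin rs'] : has (fun s => r %= s) rs by apply: rsA => //; rewrite hE dvdp_mulr.
have : s %| h by rewrite -(eqp_dvdl _ rs').
case/dvdpP => h' h'E; have s0 : s != 0 by apply: contraNneq h0 => s0; rewrite h'E s0 mulr0.
have := rsa s sin; rewrite hE h'E mulrAC mulpK // actM ga act_0r eqxx //.
Qed.

Lemma avoid_union (T : finType) (I : eqType) (A : seq I) (S : {set T}) (W : I -> {set T}) :
  (\sum_(r <- A) #|W r| < #|S|)%N -> exists2 x, x \in S & all (fun r => x \notin W r) A.
Proof.
elim: A S => [|r A IH] S; first by rewrite big_nil => /card_gt0P [x xS]; exists x.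
rewrite big_cons => h; have [|x] := IH (S :\: W r).
  have := cardsID (W r) S; have := subset_leq_card (subsetIr S (W r)); move: h; clear; lia.
by rewrite !inE => /andP [nx xS] xA; exists x => //=; rewrite nx.
Qed.

Lemma mode1_identity (rc Q b k2 s1 sg : algC) (s : nat) :
  (1 - rc) * (Q - 1 + b) - k2 * b * s1 - (Q * sg - s%:R + (k2 - 1) * b *+ s)
  = ((1 - rc - sg) * Q - k2 * b * (s1 + s%:R)) + (1 - rc) * (b - 1) + (1 + b) *+ s.
Proof. by rewrite -[(k2 - 1) * b *+ s]mulr_natr -[(1 + b) *+ s]mulr_natr; ring. Qed.

(** * Existence criteria *)

Section Criteria.
Variables (F L : finFieldType) (iota : {rmorphism F -> L}) (n : nat).
Hypothesis n_gt0 : (0 < n)%N.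
Hypothesis cardL : #|L| = (#|F| ^ n)%N.
Let q := #|F|.
Let M := proj_order q n.
Let q_gt1 : (1 < q)%N. Proof. exact: finNzRing_gt1. Qed.

Variables (w : L).
Hypothesis w0 : w != 0.
Hypothesis w_gen : forall x, x != 0 -> exists i, x = w ^+ i.
Hypothesis w_order : forall i, (w ^+ i == 1) = (#|L|.-1 %| i)%N.
Local Notation log := (dlog w).

Lemma proj_order_gt0 : (0 < M)%N.
Proof. by rewrite /M /proj_order; case: n n_gt0 => // m _; rewrite big_ord_recl expn0. Qed.

Lemma power_generator t : coprime t #|L|.-1 -> primitive_elt (w ^+ t).
Proof.
move=> co; split; first by rewrite expf_neq0.
have N0 : (0 < #|L|.-1)%N by have := finNzRing_gt1 L; case: #|L| => [|[]].
move=> y y0; have [a _ /dvdnP [c ac]] := Bezoutl t N0; rewrite gcdnC in ac.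
have co' : gcdn t #|L|.-1 = 1%N by apply/eqP.
rewrite co' in ac.
have ta : w ^+ (t * a) = w^-1.
  apply: (mulfI w0); rewrite divff // mulnC -exprS -add1n ac.
  by apply/eqP; rewrite w_order dvdn_mull.
have yV : y^-1 != 0 by rewrite invr_eq0.
have [i yi] := w_gen yV.
by exists (a * i)%N; rewrite -exprM mulnA exprM ta exprVn -yi invrK.
Qed.

Lemma iota_power b : exists2 c : F, c != 0 & iota c = w ^+ (M * b).
Proof.
have : w ^+ (M * b) ^+ q == w ^+ (M * b).
  rewrite -exprM; have -> : (M * b * q = M * b + b * #|L|.-1)%N.
    rewrite (proj_orderE cardL) -/M -/q -{1}(prednK (ltnW q_gt1)).
    by clear; move: (q.-1) => k; lia.
  by rewrite exprD; have /eqP -> : w ^+ (b * #|L|.-1) == 1; rewrite ?w_order ?dvdn_mull // mulr1.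
case/(frob_fixedP iota) => c ec; exists c => //.
by rewrite -(fmorph_eq0 iota) ec expf_neq0.
Qed.

Lemma scale_primitive a : a != 0 -> (forall l, prime l -> (l %| M)%N -> ~~ (l %| log a)%N) ->
  exists2 c : F, c != 0 & primitive_elt (iota c * a).
Proof.
(* The factor from F is w^(M b). A prime of M does not divide log a by hypothesis; every other prime
   of q - 1 divides exactly one of b and log a. Hence M b + log a is prime to M (q - 1). *)
move=> a0 ha; pose b := (\prod_(l <- primes q.-1 | ~~ (l %| log a)) l)%N.
have [c c0 ec] := iota_power b; exists c => //.
rewrite ec -(dlogK w_gen w_order a0) -exprD; apply: power_generator.
have q1 : (0 < q.-1)%N by move: q_gt1; case: (q) => [|[]].
rewrite (proj_orderE cardL) -/M -/q.
apply/negP => /negP; rewrite /coprime => nc.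
have [l lp /andP [l1 l2]] : exists2 l, prime l & (l %| M * b + log a)%N && (l %| M * q.-1)%N.
  exists (pdiv (gcdn (M * b + log a) (M * q.-1))).
    apply: pdiv_prime; rewrite ltn_neqAle eq_sym nc gcdn_gt0.
    by rewrite muln_gt0 proj_order_gt0 q1 orbT.
  by rewrite -dvdn_gcd pdiv_dvd.
case lM : (l %| M)%N.
  by move: l1; rewrite dvdn_addr ?(negbTE (ha l lp lM)) // dvdn_mulr.
move: l2; rewrite Euclid_dvdM // lM /= => lq.
have lprimes : l \in primes q.-1 by rewrite mem_primes lp q1.
case la : (l %| log a)%N.
  move: l1; rewrite dvdn_addl // Euclid_dvdM // lM /= /b.
  rewrite Euclid_dvd_prod // big_has_cond => /hasP [k].
  rewrite mem_primes => /and3P [kp _ _] /andP [nk].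
  by rewrite dvdn_prime2 // => /eqP lk; move: nk; rewrite -lk la.
have lb : (l %| M * b)%N by rewrite dvdn_mull // /b (big_rem l lprimes) /= la dvdn_mulr.
by move: l1; rewrite dvdn_addr // la.
Qed.

Variable z : algC.
Hypothesis zM : M.-primitive_root z.
Let beta : algC := sqrtC (q%:R ^+ n).

Lemma act_ker_char_sum (g : {poly F}) a : ~~ (M %| a)%N ->
  `|\sum_(x in act_ker iota g) mchar w z a x| <= beta.
Proof.
move=> na; have b0 : 0 <= beta by rewrite sqrtC_ge0 exprn_ge0 // ler0n.
rewrite -(@ler_pXn2r _ 2) ?nnegrE // sqrtCK -natrX -cardL.
apply: subgroup_char_sum.
- exact: mchar0.
- exact: (mchar1 iota cardL w_gen w_order zM).
- exact: (mcharM cardL w0 w_gen w_order zM).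
- exact: (mchar_sum cardL w0 w_gen w_order zM).
- exact: (@mchar_norm F L n w z zM a).
- exact: act_ker0.
- by move=> x y; apply: act_kerB.
Qed.

Lemma nonzero_char_sum (X : {set L}) a : 
  \sum_(x in X :\ 0) z ^+ (a * log x) = \sum_(x in X) mchar w z a x.
Proof.
rewrite [RHS](bigID (fun x => x == 0)) /= [X in _ = X + _]big1 ?add0r; last first.
  by move=> x /andP [_ /eqP ->]; rewrite mchar0.
apply: eq_big => [x|x]; first by rewrite !inE andbC.
by rewrite !inE => /andP [x0 _]; rewrite /mchar (negbTE x0).
Qed.

Variables (f D2 : {poly F}) (rs : seq {poly F}).
Hypothesis D2f : D2 * f = 'X^n - 1.
Hypothesis rsP : forall r, r \in rs -> [/\ irreducible_poly r, r \is monic & r %| f].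
Hypothesis rsC : coprime_list rs.
Hypothesis rsA : forall r, irreducible_poly r -> r %| f -> has (fun s => r %= s) rs.

Let f_dvd : f %| 'X^n - 1.
Proof. by rewrite -D2f dvdp_mull. Qed.
Let f0 : f != 0. Proof. exact: (dvd_Xn1_neq0 n_gt0 f_dvd). Qed.

Let rs_dvd : all (fun r => r %| f) rs.
Proof. by apply/allP => r /rsP [_ _ ->]. Qed.

Lemma exact_element_suffices a : a != 0 -> a \in exact_ker iota f rs ->
  (forall l, prime l -> (l %| M)%N -> ~~ (l %| log a)%N) ->
  exists b : L, primitive_elt b /\ k_normal q n (size D2).-1 b.
Proof.
move=> a0 aE aM; have [c c0 cprim] := scale_primitive a0 aM.
exists (iota c * a); split=> //; apply: (k_normal_exact (iota := iota) n_gt0 cardL D2f).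
  have := aE; rewrite !inE => /andP [/eqP fa _].
  by rewrite -(act_C iota) -actM mulrC actM fa act_0r.
move=> P Pc; apply: (exact_ker_annihilator f0 rsA aE).
apply: (mulfI (_ : iota c != 0)); first by rewrite fmorph_eq0.
by rewrite mulr0 -(act_C iota) -actM mulrC actM act_C.
Qed.

Let pz1 : z ^+ M = 1. Proof. exact: prim_expr_order zM. Qed.
Let pz2 j : z ^+ j = 1 -> (M %| j)%N.
Proof. by move/eqP; rewrite -(prim_order_dvd zM). Qed.
Let beta0 : 0 < beta.
Proof. by rewrite sqrtC_gt0 exprn_gt0 // ltr0n ltnW. Qed.

Variables (K R : seq nat).
Hypothesis KR : primes_of M (R ++ K).
Hypothesis KRM : forall l, prime l -> (l %| M)%N -> l \in R ++ K.
Hypothesis rec1 : rec_sum R < 1.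

Lemma sifted_element (X : {set L}) : (sift_count X log (R ++ K) > 0)%N ->
  exists2 a, a \in X & forall l, prime l -> (l %| M)%N -> ~~ (l %| log a)%N.
Proof.
case/card_gt0P => a; rewrite inE => /andP [aX /allP h]; exists a => // l lp lM.
exact: h (KRM lp lM).
Qed.

Lemma mode2_criterion : (0 < size rs)%N ->
  2 ^+ size K * (2 ^+ size rs * beta) * (size R).+1%:R <=
    (1 - rec_sum R) * (q%:R ^+ (size f).-1 * \prod_(r <- rs) (1 - q%:R ^- (size r).-1)) ->
  exists b : L, primitive_elt b /\ k_normal q n (size D2).-1 b.
Proof.
move=> rs0 h; pose X := exact_ker iota f rs.
(* The first member of [rs] keeps 0, where the logarithm is meaningless, out of the exact kernel. *)
have X0 : X :\ 0 = X.
  apply/setP => x; rewrite !inE; have [->|//] := eqVneq x 0.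
  rewrite act_0r eqxx /=; case: (rs) rs0 => // r rs' _ /=.
  by rewrite act_0r eqxx.
pose B := 2 ^+ size rs * beta.
have B0 : 0 < B by rewrite mulr_gt0 // exprn_gt0 // ltr0n.
have hB j : ~~ (M %| j)%N -> `|\sum_(x in X) z ^+ (j * log x)| <= B.
  move=> nj; rewrite -X0 nonzero_char_sum; apply: (exact_ker_sum (n := n)) => // g _.
  exact: act_ker_char_sum.
have [a aX aM] : exists2 a, a \in X & forall l, prime l -> (l %| M)%N -> ~~ (l %| log a)%N.
  apply: sifted_element; rewrite -(ltr0n algC).
  have rec1' : 0 <= 1 - rec_sum R by rewrite subr_ge0 ltW.
  apply: lt_le_trans (sift_count_lower proj_order_gt0 pz1 pz2 (ltW B0) hB KR rec1').
  rewrite mulr_gt0 //.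
    apply: sift_density_gt0; have /and3P [aP _ _] := KR.
    by move: aP; rewrite all_cat => /andP [_]; apply: sub_all => l; apply: prime_gt1.
  rewrite subr_gt0 mulrDr /X (card_exact_ker iota n_gt0 cardL) //.
  by apply: le_lt_trans h _; rewrite ltrDl mulr_gt0 // subr_gt0.
apply: (@exact_element_suffices a) => //.
by move: aX; rewrite -X0 inE => /andP []; rewrite inE.
Qed.

(** The elements of ker f that survive R ++ K are weighed against those of the kernels of f / r that
    survive K alone. Lower and upper bound then carry the same factor [sift_density K], which
    cancels. *)
Lemma mode1_criterion :
  2 ^+ size K * beta * ((size R).+1 + size rs)%:R <=
    (1 - rec_sum R - \sum_(r <- rs) q%:R ^- (size r).-1) * q%:R ^+ (size f).-1 ->
  exists b : L, primitive_elt b /\ k_normal q n (size D2).-1 b.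
Proof.
move=> h; pose V := act_ker iota f; pose W r := act_ker iota (f %/ r).
have hB (g : {poly F}) j : ~~ (M %| j)%N -> `|\sum_(x in act_ker iota g :\ 0) z ^+ (j * log x)| <= beta.
  by move=> nj; rewrite nonzero_char_sum; apply: act_ker_char_sum.
have cV (g : {poly F}) : g %| 'X^n - 1 -> (#|act_ker iota g :\ 0|%:R : algC) = q%:R ^+ (size g).-1 - 1.
  move=> gd; have := cardsD1 0 (act_ker iota g); rewrite act_ker0 (card_act_ker iota n_gt0 cardL gd).
  by move=> E; rewrite -natrX E natrD addrC addKr.
have rec1' : 0 <= 1 - rec_sum R by rewrite subr_ge0 ltW.
have pK : primes_of M K by apply: primes_of_sub KR; exact: suffix_subseq.
have d0 : 0 < sift_density K.
  apply: sift_density_gt0; case/and3P: pK => aP _ _.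
  by apply: sub_all aP => l; exact: prime_gt1.
have lowV := sift_count_lower proj_order_gt0 pz1 pz2 (ltW beta0) (hB f) KR rec1'.
have upW r := sift_count_upper proj_order_gt0 pz1 pz2 (ltW beta0) (hB (f %/ r)) pK.
have wd r : r \in rs -> f %/ r %| 'X^n - 1.
  by move=> /rsP [_ _ rf]; apply: dvdp_trans f_dvd; apply: divp_dvd.
pose bad := (\sum_(r <- rs) sift_count (W r :\ 0%R) log K)%N.
have lt : (bad < sift_count (V :\ 0%R) log (R ++ K))%N.
  rewrite -(ltr_nat algC); apply: lt_le_trans lowV.
  rewrite /bad natr_sum.
  apply: (@le_lt_trans _ _ (\sum_(r <- rs) sift_density K *
      (q%:R ^+ (size f).-1 * q%:R ^- (size r).-1 - 1 + (2 ^+ size K - 1) * beta))).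
    rewrite big_seq [X in _ <= X]big_seq; apply: ler_sum => r rin.
    apply: le_trans (upW r) _; rewrite cV ?wd // le_eqVlt; apply/orP; left; apply/eqP.
    congr (_ * (_ - 1 + _)).
    have [_ _ rf] := rsP rin; rewrite size_divp //; last by apply: contraTneq rf => ->; rewrite dvd0p.
    have le : ((size r).-1 <= (size f).-1)%N.
      by have := dvdp_leq f0 rf; clear; move: (size r) (size f) => [|a] [|b].
    have -> : (size f - (size r).-1).-1 = ((size f).-1 - (size r).-1)%N.
      by clear; move: (size r) (size f) => [|a] [|b] /=; lia.
    by rewrite expfB_cond // pnatr_eq0 gtn_eqF // ltnW.
  rewrite -mulr_sumr ltr_pM2l // cV //.
  rewrite big_split /= sumrB -mulr_sumr !big_const_seq !iter_addr_0 count_predT.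
  set Q := q%:R ^+ _ in h *; set sg := \sum_(r <- rs) _ in h *; set k2 := 2 ^+ size K in h *.
  set rc := rec_sum R in h *; set s := size rs in h *.
  rewrite -subr_gt0; rewrite -subr_ge0 in h.
  have b1 : 1 < beta by rewrite -sqrtC1 ltr_sqrtC ?exprn_egt1 ?gtn_eqF ?ltr1n // nnegrE ?exprn_ge0.
  have -> : (1 - rc) * (Q - 1 + beta) - k2 * beta * (size R).+1%:R - (Q * sg - 1 *+ s + ((k2 - 1) * beta) *+ s)
     = ((1 - rc - sg) * Q - k2 * beta * ((size R).+1 + s)%:R) + (1 - rc) * (beta - 1) + (1 + beta) *+ s.
    by rewrite natrD; exact: mode1_identity.
  have rc1 : 0 < 1 - rc by rewrite subr_gt0.
  rewrite ltr_wpDr ?mulrn_wge0 ?addr_ge0 ?(ltW beta0) // ltr_wpDl // mulr_gt0 // subr_gt0 //.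
have [x xS xr] := avoid_union lt.
move: xS; rewrite inE => /andP [xV xa]; move: xV; rewrite !inE => /andP [x0 fx].
apply: (@exact_element_suffices x) => //.
  rewrite inE inE fx /=; apply/allP => r rin; apply/negP => /eqP fr.
  have := allP xr r rin; rewrite inE => /negP; apply.
  rewrite !inE x0 fr eqxx /=; move: xa; rewrite /avoids all_cat => /andP [_ ->] //.
by move=> l lp lM; have /allP h' := xa; apply: h'; apply: KRM.
Qed.
End Criteria.

(** * Degrees of the irreducible divisors of X^n - 1 *)

Lemma coprimep_prodr (F : fieldType) (r : {poly F}) rs :
  all (coprimep r) rs -> coprimep r (\prod_(s <- rs) s).
Proof.
elim: rs => [|s rs IH]; first by rewrite big_nil coprimep1.
by rewrite big_cons coprimepMr /= => /andP [-> /IH].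
Qed.

Lemma coprime_list_prod_dvd (F : finFieldType) (P : {poly F}) rs :
  coprime_list rs -> all (fun r => r %| P) rs -> \prod_(r <- rs) r %| P.
Proof.
elim: rs => [|r rs IH]; first by rewrite big_nil dvd1p.
rewrite big_cons /= => /andP [cr crs] /andP [rP rsP].
by rewrite Gauss_dvdp ?rP ?IH // coprimep_prodr.
Qed.

Lemma coprime_list_filter (F : finFieldType) (a : pred {poly F}) (rs : seq {poly F}) :
  coprime_list rs -> coprime_list (filter a rs).
Proof.
elim: rs => //= r rs IH /andP [cr /IH crs]; case: (a r) => //=; rewrite crs andbT.
by apply/allP => s; rewrite mem_filter => /andP [_]; exact: (allP cr).
Qed.

Lemma size_prod_degrees (F : finFieldType) (rs : seq {poly F}) : all (fun r => r != 0) rs ->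
  (size (\prod_(r <- rs) r)).-1 = (\sum_(r <- rs) (size r).-1)%N.
Proof.
elim: rs => [|r rs IH] /=; first by rewrite !big_nil size_poly1.
move=> /andP [r0 rs0]; rewrite !big_cons -IH // size_mul //; last first.
  by rewrite prodf_seq_neq0; apply: sub_all rs0.
have : \prod_(s <- rs) s != 0 by rewrite prodf_seq_neq0; apply: sub_all rs0.
move: r0; rewrite -!size_poly_gt0; clear.
by move: (size r) (size (\prod_(s <- rs) s)) => [|a] [|b] // _ _; rewrite addnS.
Qed.

(** Up to a constant r is the orbit polynomial of any of its roots, so its degree is their
    period. *)
Lemma irreducible_dvd_root (F : finFieldType) (K : closedFieldType) (j : {rmorphism F -> K}) (r : {poly F}) :
  irreducible_poly r -> exists s : K, [/\ root (map_poly j r) s,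
    s ^+ (#|F| ^ (size r).-1) = s & forall P : {poly F}, root (map_poly j P) s -> r %| P].
Proof.
move=> ri; have [r1 rP] := ri.
have r0 : r != 0 by rewrite -size_poly_gt0 ltnW.
have [s sr] : exists s, root (map_poly j r) s.
  by apply/closed_rootP; rewrite size_map_poly gtn_eqF.
have [t /andP [t0 _] st] := root_period r0 sr.
have [d [d0 _ dP]] := frob_period t0 st.
have sd : s ^+ (#|F| ^ d) = s by apply/eqP; rewrite dP.
have ne i : (0 < i < d)%N -> s ^+ (#|F| ^ i) != s.
  by move=> /andP [i0 id]; rewrite dP; apply/negP => /dvdn_leq; clear -i0 id; lia.
have DE : map_poly j (descend j (orbit_poly F s d)) = orbit_poly F s d.
  by apply: descendK; apply: map_frob_orbit_poly.
set D := descend _ _ in DE.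
have Ddvd (P : {poly F}) : root (map_poly j P) s -> D %| P.
  rewrite -dvdp_XsubCl -(dvdp_map j) DE -[X in X %| _]expr1 -[orbit_poly _ _ _]expr1.
  by rewrite orbit_poly_pow_dvd.
have sD : size D = d.+1 by rewrite -(size_map_poly j) DE size_orbit_poly.
have Dr : D %= r.
  by apply: rP; [rewrite sD eqSS gtn_eqF | exact: Ddvd].
exists s; split=> //; first by rewrite -(eqp_size Dr) sD.
by move=> P /Ddvd; rewrite (eqp_dvdl _ Dr).
Qed.

Lemma expr_gcd1 (R : comNzRingType) (x : R) a b : (0 < a)%N -> x ^+ a = 1 -> x ^+ b = 1 -> x ^+ gcdn a b = 1.
Proof.
move=> a0 xa xb; have [k _ /dvdnP [c kc]] := Bezoutl b a0.
have : x ^+ (gcdn a b + k * b) = 1 by rewrite kc mulnC exprM xa expr1n.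
by rewrite exprD mulnC exprM xb expr1n mulr1.
Qed.

(** A root s of r satisfies s^n = 1 and s^(q^(deg r) - 1) = 1. *)
Lemma irreducible_dvd_Xn1 (F : finFieldType) (r : {poly F}) n : (0 < n)%N -> irreducible_poly r ->
  r %| 'X^n - 1 -> r %| 'X^(gcdn n (#|F| ^ (size r).-1 - 1)) - 1.
Proof.
move=> n0 ri rn; have [K [j _]] := countable_algebraic_closure F.
have [s [sr sq sP]] := irreducible_dvd_root j ri.
have rootX m : root (map_poly j ('X^m - 1)) s = (s ^+ m == 1).
  by rewrite rootE rmorphB /= map_polyXn rmorph1 !hornerE subr_eq0.
have sn : s ^+ n = 1.
  by apply/eqP; rewrite -rootX; apply: root_dvdp sr; rewrite dvdp_map.
apply: sP; rewrite rootX; apply/eqP; apply: expr_gcd1 => //.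
have s0 : s != 0 by apply: contra_eq_neq sn => ->; rewrite expr0n gtn_eqF // eq_sym oner_neq0.
have q0 : (0 < #|F| ^ (size r).-1)%N by rewrite expn_gt0 ltnW // finNzRing_gt1.
by apply: (mulfI s0); rewrite -exprS subn1 prednK // sq mulr1.
Qed.

Section DegreeCounts.
Variables (F : finFieldType) (n : nat) (f : {poly F}) (rs : seq {poly F}).
Hypotheses (n_gt0 : (0 < n)%N) (f0 : f != 0) (f_dvd : f %| 'X^n - 1).
Hypothesis rsP : forall r, r \in rs -> [/\ irreducible_poly r, r \is monic & r %| f].
Hypothesis rsC : coprime_list rs.

(** The factors of degree d all divide X^g - 1 for g = gcd(n, q^d - 1), hence so does their
    product. *)
Lemma degree_count d : (0 < d)%N ->
  (d * count (fun r : {poly F} => (size r).-1 == d) rs <= gcdn n (#|F| ^ d - 1))%N.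
Proof.
move=> d0; set a := fun r : {poly F} => _; pose g := gcdn n (#|F| ^ d - 1).
have g0 : (0 < g)%N by rewrite gcdn_gt0 n_gt0.
have X0 : ('X^g - 1 : {poly F}) != 0 by rewrite -size_poly_eq0 size_XnsubC.
have h : \prod_(r <- filter a rs) r %| 'X^g - 1.
  apply: coprime_list_prod_dvd; first exact: coprime_list_filter.
  apply/allP => r; rewrite mem_filter => /andP [/eqP rd /rsP [ri _ rf]].
  by rewrite /g -rd; apply: irreducible_dvd_Xn1 => //; exact: dvdp_trans f_dvd.
have := dvdp_leq X0 h; rewrite size_XnsubC // => hs.
have E : (size (\prod_(r <- filter a rs) r)).-1 = (d * count a rs)%N.
  rewrite size_prod_degrees; last first.
    by apply/allP => r; rewrite mem_filter => /andP [_ /rsP [_ rm _]]; rewrite monic_neq0.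
  rewrite big_filter -sum1_count big_distrr /= muln1; apply: eq_bigr => r /eqP //.
by rewrite -E; move: hs; clear; case: (size _).
Qed.

Lemma degree_sum : (\sum_(r <- rs) (size r).-1 <= (size f).-1)%N.
Proof.
rewrite -size_prod_degrees; last by apply/allP => r /rsP [_ rm _]; rewrite monic_neq0.
have : \prod_(r <- rs) r %| f.
  by apply: coprime_list_prod_dvd => //; apply/allP => r /rsP [_ _ ->].
move/(dvdp_leq f0); clear; move: (size f) (size _) => a b; lia.
Qed.

Lemma degree_gt0 r : r \in rs -> (0 < (size r).-1)%N.
Proof. by case/rsP => -[r1 _] _ _; rewrite -ltnS prednK // ltnW. Qed.
End DegreeCounts.

(** * The criteria in integer arithmetic *)

Section NatCriteria.
Variables (F L : finFieldType) (iota : {rmorphism F -> L}) (n : nat).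
Hypothesis n4 : (4 <= n)%N.
Hypothesis cardL : #|L| = (#|F| ^ n)%N.
Let q := #|F|.
Let M := proj_order q n.
Let n_gt0 : (0 < n)%N. Proof. exact: leq_trans n4. Qed.
Let q_gt1 : (1 < q)%N. Proof. exact: finNzRing_gt1. Qed.
Variables (f D2 : {poly F}) (rs : seq {poly F}).
Hypothesis D2f : D2 * f = 'X^n - 1.
Hypothesis sD2 : size D2 = 3.
Hypothesis rsP : forall r, r \in rs -> [/\ irreducible_poly r, r \is monic & r %| f].
Hypothesis rsC : coprime_list rs.
Hypothesis rsA : forall r, irreducible_poly r -> r %| f -> has (fun s => r %= s) rs.
Variables (K R : seq nat).
Hypothesis KR : primes_of M (R ++ K).
Hypothesis KRM : forall l, prime l -> (l %| M)%N -> l \in R ++ K.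

Lemma size_cofactor : (size f).-1 = (n - 2)%N.
Proof.
have := congr1 (fun p : {poly F} => size p) D2f; rewrite size_XnsubC //.
have f0 : f != 0.
  by apply/eqP => f0; move: (@Xn1_neq0 F n n_gt0); rewrite -D2f f0 mulr0 eqxx.
have D20 : D2 != 0 by rewrite -size_poly_gt0 sD2.
rewrite size_mul // sD2; rewrite -size_poly_gt0 in f0; move: f0 n4; clear.
by move: (size f) => [|a] // _ h /= [<-]; rewrite subn2.
Qed.

Let qn0 : 0 < (q%:R : algC). Proof. by rewrite ltr0n ltnW. Qed.

Let beta_sq : sqrtC (q%:R ^+ n) ^+ 2 = q%:R ^+ n :> algC. Proof. exact: sqrtCK. Qed.

(** A kernel of q^(n - 2) elements faces character sums of size q^(n/2); squaring leaves the
    exponent n - 4, which is why this method gives nothing for n = 4. *)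
Let le_of_squares (a b : nat) : (a ^ 2 <= b ^ 2 * q ^ (n - 4))%N ->
  a%:R * sqrtC (q%:R ^+ n) <= b%:R * q%:R ^+ (n - 2) :> algC.
Proof.
move=> h; rewrite -(@ler_pXn2r _ 2) ?nnegrE ?mulr_ge0 ?exprn_ge0 ?ler0n ?sqrtC_ge0 ?exprn_ge0 ?ler0n //.
rewrite exprMn beta_sq exprMn -exprM.
have -> : ((n - 2) * 2 = (n - 4) + n)%N by move: n4; clear; lia.
rewrite exprD mulrA ler_pM2r ?exprn_gt0 //.
by rewrite -!natrX -natrM ler_nat.
Qed.

(** S is a common denominator: recS / S and sigS / S bound the two sums of reciprocals, and dd / S
    is what they leave of 1. *)
Lemma mode1_nat (S recS sigS dd k s Om : nat) : (0 < S)%N -> (recS + sigS + dd = S)%N ->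
  rec_sum R * S%:R <= recS%:R -> (\sum_(r <- rs) q%:R ^- (size r).-1) * S%:R <= sigS%:R :> algC ->
  rec_sum R < 1 ->
  (size K <= k)%N -> (size R <= s)%N -> (size rs <= Om)%N ->
  ((S * 2 ^ k * (s + 1 + Om)) ^ 2 <= dd ^ 2 * q ^ (n - 4))%N ->
  exists b : L, primitive_elt b /\ k_normal q n 2 b.
Proof.
move=> S0 E hrec hsig rec1 hK hR hrs h.
have [w [w0 [w_gen w_order]]] := finField_generator L.
have [z zM] := C_prim_root_exists (proj_order_gt0 F n_gt0).
have := mode1_criterion iota n_gt0 cardL w0 w_gen w_order zM D2f rsP rsA KR KRM rec1.
rewrite sD2; apply; rewrite size_cofactor.
have S0' : 0 < (S%:R : algC) by rewrite ltr0n.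
rewrite -(ler_pM2l S0'); have := le_of_squares h => h2.
apply: le_trans (_ : dd%:R * q%:R ^+ (n - 2) <= _); last first.
  rewrite mulrA ler_pM2r ?exprn_gt0 // mulrC !mulrBl mul1r.
  rewrite lerBrDr lerBrDr -[X in _ <= X%:R]E.
  by rewrite !natrD [X in _ <= X]addrC -addrA lerD // addrC lerD.
apply: le_trans h2; set b := sqrtC _; have b0 : 0 <= b by rewrite sqrtC_ge0 exprn_ge0 // ler0n.
have -> : S%:R * (2 ^+ size K * b * ((size R).+1 + size rs)%:R) =
  (S * 2 ^ size K * (size R + 1 + size rs))%:R * b.
  by rewrite !natrM natrX addn1; ring.
rewrite ler_wpM2r // ler_nat; apply: leq_mul; last by rewrite !leq_add.
by rewrite leq_mul2l; apply/orP; right; rewrite leq_exp2l.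
Qed.

Lemma mode2_nat (S recS dd prodS k s Om : nat) : (0 < S)%N -> (recS + dd = S)%N ->
  rec_sum R * S%:R <= recS%:R ->
  prodS%:R <= (\prod_(r <- rs) (1 - q%:R ^- (size r).-1)) * S%:R :> algC ->
  rec_sum R < 1 -> (0 < size rs)%N ->
  (size K <= k)%N -> (size R <= s)%N -> (size rs <= Om)%N ->
  ((S * S * 2 ^ (k + Om) * (s + 1)) ^ 2 <= (dd * prodS) ^ 2 * q ^ (n - 4))%N ->
  exists b : L, primitive_elt b /\ k_normal q n 2 b.
Proof.
move=> S0 E hrec hprod rec1 rs0 hK hR hrs h.
have [w [w0 [w_gen w_order]]] := finField_generator L.
have [z zM] := C_prim_root_exists (proj_order_gt0 F n_gt0).
have := mode2_criterion iota n_gt0 cardL w0 w_gen w_order zM D2f rsP rsC rsA KR KRM rec1 rs0.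
rewrite sD2; apply; rewrite size_cofactor.
have S0' : 0 < (S%:R : algC) by rewrite ltr0n.
rewrite -(ler_pM2l S0') -(ler_pM2l S0'); have := le_of_squares h => h2.
have hd : dd%:R <= S%:R * (1 - rec_sum R).
  by rewrite mulrBr mulr1 lerBrDr -[X in _ <= X%:R]E natrD addrC lerD2r mulrC.
apply: le_trans (_ : (dd * prodS)%:R * q%:R ^+ (n - 2) <= _); last first.
  set P := \prod_(r <- rs) _ in hprod *.
  have -> : S%:R * (S%:R * ((1 - rec_sum R) * (q%:R ^+ (n - 2) * P))) =
     (S%:R * (1 - rec_sum R)) * (P * S%:R) * q%:R ^+ (n - 2) by ring.
  by rewrite ler_pM2r ?exprn_gt0 // natrM ler_pM.
apply: le_trans h2; set b := sqrtC _; have b0 : 0 <= b by rewrite sqrtC_ge0 exprn_ge0 // ler0n.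
have -> : S%:R * (S%:R * (2 ^+ size K * (2 ^+ size rs * b) * (size R).+1%:R)) =
  (S * S * 2 ^ (size K + size rs) * (size R + 1))%:R * b.
  by rewrite !natrM natrX exprD addn1; ring.
rewrite ler_wpM2r // ler_nat; apply: leq_mul; last by rewrite leq_add2r.
by rewrite leq_mul2l; apply/orP; right; rewrite leq_exp2l // leq_add.
Qed.
End NatCriteria.

(** * Lower bounds for unknown primes *)

Fixpoint dominated (ps cov : seq nat) : bool :=
  match ps, cov with
  | [::], _ => true
  | p :: ps', d :: cov' => (d <= p)%N && dominated ps' cov'
  | _, _ => false
  end.

Lemma dominated_size ps cov : dominated ps cov -> (size ps <= size cov)%N.
Proof. by elim: ps cov => [|p ps IH] [|d cov] //= /andP [_ /IH]. Qed.

Lemma dominated_drop k ps cov : dominated ps cov -> dominated (drop k ps) (drop k cov).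
Proof.
elim: k ps cov => [|k IH] [|p ps] [|d cov] //=.
by move=> /andP [_ /IH].
Qed.

Lemma dominated_rec_sum S ps cov : all (fun d => 0 < d)%N cov -> dominated ps cov ->
  rec_sum ps * S%:R <= (\sum_(d <- cov) (S %/ d + 1))%N%:R.
Proof.
elim: ps cov => [|p ps IH] [|d cov] //=; rewrite /rec_sum ?big_nil ?mul0r ?ler0n //.
move=> /andP [d0 c0] /andP [dp dom]; rewrite !big_cons mulrDl natrD; apply: lerD; last exact: IH.
have p0 : 0 < (p%:R : algC) by rewrite ltr0n (leq_trans d0).
rewrite mulrC ler_pdivrMr // -natrM ler_nat; apply: leq_trans (leq_mul (leqnn _) dp).
by rewrite mulnDl mul1n {1}(divn_eq S d) leq_add2l ltnW // ltn_pmod.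
Qed.

(** Lower bounds for the increasing primes of an unknown number at most B: D lists the candidates
    below T, every later prime is replaced by T itself, and the list ends when the remaining budget
    B is exhausted. *)
Fixpoint cover fuel T (D : seq nat) B : seq nat :=
  match fuel with
  | 0 => [::]
  | fuel'.+1 =>
    if D is d :: D' then if d <= B then d :: cover fuel' T D' (B %/ d) else [::]
    else if T <= B then T :: cover fuel' T [::] (B %/ T) else [::]
  end%N.

(** The least remaining prime p is at least the head d of D, because p >= T or p lies in the
    increasing list D. Hence B / d still bounds the product of the other primes, and the list cannot
    end too early. *)
Lemma cover_dominates fuel T D B ps : all (leq 2) ps -> sorted ltn ps ->
  sorted ltn D -> all (fun d => 0 < d < T)%N D -> (0 < T)%N ->
  all (fun p => (p < T)%N ==> (p \in D)) ps ->
  (\prod_(p <- ps) p <= B)%N -> (size ps <= fuel)%N -> dominated ps (cover fuel T D B).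
Proof.
elim: fuel ps D B => [|fuel IH] [|p ps] D B //.
rewrite big_cons /= => /andP [p2 ps2] sps sD aD T0 /andP [pD psD] hB szf.
have sps' : sorted ltn ps := path_sorted sps.
have pp : (0 < \prod_(p <- ps) p)%N.
  elim: (ps) ps2 => [|a l IHl]; first by rewrite big_nil.
  by rewrite big_cons /= => /andP [a2 /IHl l0]; rewrite muln_gt0 (ltnW a2).
have pB : (p <= B)%N by apply: leq_trans hB; rewrite leq_pmulr.
have step d : (0 < d)%N -> (d <= p)%N -> (\prod_(p <- ps) p <= B %/ d)%N.
  by move=> d0 dp; rewrite leq_divRL // mulnC; apply: leq_trans hB; rewrite leq_mul2r dp orbT.
have gtp l : l \in ps -> (p < l)%N by move=> lps; have /allP := order_path_min ltn_trans sps; apply.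
case: D sD aD pD psD => [|d D] sD aD pD psD /=.
  have pT : (T <= p)%N by move: pD; rewrite in_nil implybF -leqNgt.
  by rewrite (leq_trans pT pB) /= pT /=; apply: IH => //; apply: step.
move: aD => /= /andP [/andP [d0 dT] aD].
have sD' : sorted ltn D := path_sorted sD.
have dmin : all (ltn d) D := order_path_min ltn_trans sD.
have dp : (d <= p)%N.
  case: (leqP T p) => [Tp|pT]; first exact: leq_trans (ltnW dT) Tp.
  move: pD; rewrite pT /= inE => /orP [/eqP -> //|pD].
  exact: ltnW (allP dmin _ pD).
rewrite (leq_trans dp pB) /= dp /=; apply: IH => //; last exact: step.
apply/allP => l lps; apply/implyP => lT; have := allP psD l lps; rewrite lT /= inE.
by rewrite gtn_eqF // (leq_ltn_trans dp (gtp l lps)).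
Qed.

Lemma cover_gt0 fuel T D B : (0 < T)%N -> all (fun d => 0 < d)%N D -> all (fun d => 0 < d)%N (cover fuel T D B).
Proof.
move=> T0; elim: fuel D B => [|fuel IH] [|d D] B //=.
  by move=> _; case: ifP => //= _; rewrite T0 IH.
by move=> /andP [d0 D0]; case: ifP => //= _; rewrite d0 IH.
Qed.

Lemma rec_sum_lt1 (R : seq nat) S recS : (0 < S)%N -> rec_sum R * S%:R <= recS%:R -> (recS < S)%N -> rec_sum R < 1.
Proof.
move=> S0 h lt; have S0' : 0 < (S%:R : algC) by rewrite ltr0n.
by rewrite -(ltr_pM2r S0') mul1r; apply: le_lt_trans h _; rewrite ltr_nat.
Qed.

Section ProjectiveOrderPrimes.
Variables (M T B fuel : nat) (D : seq nat).
Hypothesis M_gt0 : (0 < M)%N.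
Hypothesis sD : sorted ltn D.
Hypothesis aD : all (fun d => 0 < d < T)%N D.
Hypothesis T0 : (0 < T)%N.
Hypothesis DM : forall p, prime p -> (p %| M)%N -> (p < T)%N -> p \in D.
Hypothesis MB : (\prod_(p <- primes M) p <= B)%N.
Hypothesis Bfuel : (B < 2 ^ fuel)%N.

Lemma primes_dominated : dominated (primes M) (cover fuel T D B).
Proof.
have p2 : all (leq 2) (primes M).
  by apply/allP => p; rewrite mem_primes => /andP [pp _]; apply: prime_gt1.
apply: cover_dominates => //; first exact: sorted_primes.
  by apply/allP => p; rewrite mem_primes => /and3P [pp _ pM]; apply/implyP; apply: DM.
have : (2 ^ size (primes M) <= \prod_(p <- primes M) p)%N.
  elim: (primes M) p2 => [|p ps IH]; first by rewrite big_nil.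
  by rewrite big_cons /= expnS => /andP [a /IH b]; apply: leq_mul.
move=> h; rewrite -(leq_exp2l _ _ (isT : 1 < 2)%N).
exact: leq_trans h (leq_trans MB (ltnW Bfuel)).
Qed.

(** The k smallest primes play the role of K and the others that of R, as only large primes have
    small reciprocals. *)
Lemma primes_of_take_drop k : primes_of M (drop k (primes M) ++ take k (primes M)).
Proof.
apply/and3P; split.
- by rewrite all_cat andbC -all_cat cat_take_drop; apply/allP => p; rewrite mem_primes => /andP [].
- by rewrite uniq_catC cat_take_drop primes_uniq.
- by rewrite all_cat andbC -all_cat cat_take_drop; apply/allP => p; rewrite mem_primes => /and3P [].
Qed.

Lemma primes_take_drop_complete k l : prime l -> (l %| M)%N -> l \in drop k (primes M) ++ take k (primes M).
Proof.
by move=> lp lM; rewrite mem_cat orbC -mem_cat cat_take_drop mem_primes lp M_gt0 lM.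
Qed.

Lemma cover_rec_sum S k :
  rec_sum (drop k (primes M)) * S%:R <= (\sum_(d <- drop k (cover fuel T D B)) (S %/ d + 1))%N%:R.
Proof.
apply: dominated_rec_sum; last exact: dominated_drop primes_dominated.
have c0 : all (fun d => 0 < d)%N (cover fuel T D B).
  by apply: cover_gt0 => //; apply: sub_all aD => d /andP [].
by apply/allP => d /mem_drop; exact: (allP c0).
Qed.

Lemma cover_size k : (size (drop k (primes M)) <= size (drop k (cover fuel T D B)))%N.
Proof. exact: dominated_size (dominated_drop k primes_dominated). Qed.
End ProjectiveOrderPrimes.

Section CoverCriteria.
Variables (F L : finFieldType) (iota : {rmorphism F -> L}) (n : nat).
Hypothesis n4 : (4 <= n)%N.
Hypothesis cardL : #|L| = (#|F| ^ n)%N.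
Let q := #|F|.
Let M := proj_order q n.
Variables (f D2 : {poly F}) (rs : seq {poly F}).
Hypothesis D2f : D2 * f = 'X^n - 1.
Hypothesis sD2 : size D2 = 3.
Hypothesis rsP : forall r, r \in rs -> [/\ irreducible_poly r, r \is monic & r %| f].
Hypothesis rsC : coprime_list rs.
Hypothesis rsA : forall r, irreducible_poly r -> r %| f -> has (fun s => r %= s) rs.
Variables (T B fuel : nat) (D : seq nat).
Hypothesis sD : sorted ltn D.
Hypothesis aD : all (fun d => 0 < d < T)%N D.
Hypothesis T0 : (0 < T)%N.
Hypothesis DM : forall p, prime p -> (p %| M)%N -> (p < T)%N -> p \in D.
Hypothesis MB : (\prod_(p <- primes M) p <= B)%N.
Hypothesis Bfuel : (B < 2 ^ fuel)%N.
Let cov := cover fuel T D B.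
Let M_gt0 : (0 < M)%N. Proof. by apply: proj_order_gt0; apply: leq_trans n4. Qed.

Lemma cover_mode1 (S sigS k Om : nat) : let recS := (\sum_(d <- drop k cov) (S %/ d + 1))%N in
  (recS + sigS < S)%N -> (\sum_(r <- rs) q%:R ^- (size r).-1) * S%:R <= sigS%:R :> algC ->
  (size rs <= Om)%N ->
  ((S * 2 ^ k * (size (drop k cov) + 1 + Om)) ^ 2 <= (S - (recS + sigS)) ^ 2 * q ^ (n - 4))%N ->
  exists b : L, primitive_elt b /\ k_normal q n 2 b.
Proof.
move=> recS lt hsig hOm h; have S0 : (0 < S)%N by apply: leq_ltn_trans lt.
have hrec := cover_rec_sum sD aD T0 DM MB Bfuel S k.
apply: (mode1_nat iota n4 cardL D2f sD2 rsP rsA (primes_of_take_drop M k)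
  (primes_take_drop_complete M_gt0 k) S0 _ hrec hsig _ _ _ hOm h).
- by rewrite subnKC // ltnW.
- by apply: (rec_sum_lt1 S0 hrec); apply: leq_ltn_trans lt; rewrite leq_addr.
- by rewrite size_take; case: ltnP.
- exact: (cover_size sD aD T0 DM MB Bfuel k).
Qed.

Lemma cover_mode2 (S prodS k Om : nat) : let recS := (\sum_(d <- drop k cov) (S %/ d + 1))%N in
  (recS < S)%N -> prodS%:R <= (\prod_(r <- rs) (1 - q%:R ^- (size r).-1)) * S%:R :> algC ->
  (0 < size rs)%N -> (size rs <= Om)%N ->
  ((S * S * 2 ^ (k + Om) * (size (drop k cov) + 1)) ^ 2 <= ((S - recS) * prodS) ^ 2 * q ^ (n - 4))%N ->
  exists b : L, primitive_elt b /\ k_normal q n 2 b.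
Proof.
move=> recS lt hprod rs0 hOm h; have S0 : (0 < S)%N by apply: leq_ltn_trans lt.
have hrec := cover_rec_sum sD aD T0 DM MB Bfuel S k.
apply: (mode2_nat iota n4 cardL D2f sD2 rsP rsC rsA (primes_of_take_drop M k)
  (primes_take_drop_complete M_gt0 k) S0 _ hrec hprod _ rs0 _ _ hOm h).
- by rewrite subnKC // ltnW.
- exact: (rec_sum_lt1 S0 hrec).
- by rewrite size_take; case: ltnP.
- exact: (cover_size sD aD T0 DM MB Bfuel k).
Qed.
End CoverCriteria.

(** * Sums and products over a list of degrees *)

Definition ge5 (ds : seq nat) := count (leq 5) ds.

Section DegreeLists.
Variable q : nat.
Hypothesis q1 : (1 < q)%N.
Let q0 : 0 < (q%:R : algC). Proof. by rewrite ltr0n ltnW. Qed.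
Let qV d : 0 < (q%:R : algC) ^- d. Proof. by rewrite invr_gt0 exprn_gt0. Qed.
Let qV1 d : (0 < d)%N -> (q%:R : algC) ^- d < 1.
Proof. by move=> d0; rewrite invf_lt1 ?exprn_gt0 // exprn_egt1 ?ltr1n // -lt0n. Qed.
Let qV5 d : (5 <= d)%N -> (q%:R : algC) ^- d <= q%:R ^- 5.
Proof. by move=> d5; rewrite lef_pV2 ?posrE ?exprn_gt0 // ler_weXn2l // ler1n ltnW. Qed.

Lemma sum_by_degree ds : all (leq 1) ds ->
  \sum_(d <- ds) q%:R ^- d <= (count_mem 1 ds)%N%:R * q%:R ^- 1 + (count_mem 2 ds)%N%:R * q%:R ^- 2
    + (count_mem 3 ds)%N%:R * q%:R ^- 3 + (count_mem 4 ds)%N%:R * q%:R ^- 4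
    + (ge5 ds)%:R * q%:R ^- 5 :> algC.
Proof.
rewrite /ge5; elim: ds => [|d ds IH]; first by rewrite big_nil /= !mul0r !addr0.
move=> /andP [d1 /IH h]; rewrite big_cons.
have [d5|d5] := leqP 5 d.
  have -> : (count_mem 1 (d :: ds) = count_mem 1 ds)%N by rewrite /= gtn_eqF // (leq_trans _ d5).
  have -> : (count_mem 2 (d :: ds) = count_mem 2 ds)%N by rewrite /= gtn_eqF // (leq_trans _ d5).
  have -> : (count_mem 3 (d :: ds) = count_mem 3 ds)%N by rewrite /= gtn_eqF // (leq_trans _ d5).
  have -> : (count_mem 4 (d :: ds) = count_mem 4 ds)%N by rewrite /= gtn_eqF // (leq_trans _ d5).
  rewrite /= d5 natrD mulrDl mul1r [X in _ <= X]addrCA; exact: lerD (qV5 d5) h.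
by case: d d1 d5 => [|[|[|[|[|d]]]]] // _ _; rewrite /= ?eqxx /= ?natrD ?mulrDl ?mul1r ?add0n;
   apply: le_trans (lerD (lexx _) h) _; rewrite le_eqVlt; apply/orP; left; apply/eqP; ring.
Qed.

Lemma prod_by_degree ds : all (leq 1) ds ->
  (1 - q%:R ^- 1) ^+ count_mem 1%N ds * (1 - q%:R ^- 2) ^+ count_mem 2%N ds * (1 - q%:R ^- 3) ^+ count_mem 3%N ds
   * (1 - q%:R ^- 4) ^+ count_mem 4%N ds * (1 - q%:R ^- 5) ^+ ge5 ds <= \prod_(d <- ds) (1 - q%:R ^- d) :> algC.
Proof.
have u0 d : (0 < d)%N -> 0 <= 1 - (q%:R : algC) ^- d by move=> d0; rewrite subr_ge0 ltW // qV1.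
rewrite /ge5; elim: ds => [|d ds IH]; first by rewrite big_nil /= !expr0 !mulr1.
move=> /andP [d1 /IH h]; rewrite big_cons.
have ul d' : (0 < d')%N -> (1 - (q%:R : algC) ^- d') *
   ((1 - q%:R ^- 1) ^+ count_mem 1%N ds * (1 - q%:R ^- 2) ^+ count_mem 2%N ds * (1 - q%:R ^- 3) ^+ count_mem 3%N ds
   * (1 - q%:R ^- 4) ^+ count_mem 4%N ds * (1 - q%:R ^- 5) ^+ count (leq 5) ds) <= (1 - (q%:R : algC) ^- d') * \prod_(d <- ds) (1 - q%:R ^- d).
  by move=> d'0; apply: ler_wpM2l => //; apply: u0.
have [d5|d5] := leqP 5 d.
  have -> : (count_mem 1 (d :: ds) = count_mem 1 ds)%N by rewrite /= gtn_eqF // (leq_trans _ d5).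
  have -> : (count_mem 2 (d :: ds) = count_mem 2 ds)%N by rewrite /= gtn_eqF // (leq_trans _ d5).
  have -> : (count_mem 3 (d :: ds) = count_mem 3 ds)%N by rewrite /= gtn_eqF // (leq_trans _ d5).
  have -> : (count_mem 4 (d :: ds) = count_mem 4 ds)%N by rewrite /= gtn_eqF // (leq_trans _ d5).
  rewrite /= d5 add1n [(1 - q%:R ^- 5) ^+ _.+1]exprS [X in X <= _]mulrCA.
  apply: (@le_trans _ _ ((1 - q%:R ^- 5) * \prod_(d <- ds) (1 - q%:R ^- d))); first exact: ul.
  rewrite ler_wpM2r //; last by rewrite lerB // qV5.
  by apply: le_trans h; rewrite !mulr_ge0 // exprn_ge0 // u0.
case: d d1 d5 => [|[|[|[|[|d]]]]] // _ _; rewrite /= ?add0n ?add1n.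
- by apply: le_trans (ul 1%N isT); rewrite [(1 - q%:R ^- 1) ^+ _.+1]exprS !mulrA.
- by apply: le_trans (ul 2%N isT); rewrite [(1 - q%:R ^- 2) ^+ _.+1]exprS [in X in X <= _]mulrCA !mulrA.
- by apply: le_trans (ul 3%N isT); rewrite [(1 - q%:R ^- 3) ^+ _.+1]exprS [in X in X <= _]mulrCA !mulrA.
- by apply: le_trans (ul 4%N isT); rewrite [(1 - q%:R ^- 4) ^+ _.+1]exprS [in X in X <= _]mulrCA !mulrA.
Qed.

Lemma sum_degrees_split ds :
  (count_mem 1 ds + 2 * count_mem 2 ds + 3 * count_mem 3 ds + 4 * count_mem 4 ds + 5 * ge5 ds <= \sum_(d <- ds) d)%N.
Proof.
rewrite /ge5; elim: ds => [|d ds IH]; first by rewrite big_nil.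
rewrite big_cons; move: IH; case: d => [|[|[|[|[|d]]]]] /=; lia.
Qed.

Lemma size_degrees_split ds : all (leq 1) ds ->
  (size ds = count_mem 1 ds + count_mem 2 ds + count_mem 3 ds + count_mem 4 ds + ge5 ds)%N.
Proof.
rewrite /ge5; elim: ds => //= d ds IH /andP [d1 /IH ->].
by case: d d1 => [|[|[|[|[|d]]]]] //= _; lia.
Qed.

Variables (ds : seq nat) (tot A1 A2 A3 A4 : nat).
Hypothesis ds1 : all (leq 1) ds.
Hypothesis dsT : (\sum_(d <- ds) d <= tot)%N.
Hypotheses (hA1 : (count_mem 1 ds <= A1)%N) (hA2 : (count_mem 2 ds <= A2)%N)
  (hA3 : (count_mem 3 ds <= A3)%N) (hA4 : (count_mem 4 ds <= A4)%N).

(** Raising every degree d < 5 to 5 costs 5 - d, so five times the number of factors is at most the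
    total degree plus 4 A1 + 3 A2 + 2 A3 + A4. *)
Lemma number_of_factors_le : (size ds <= (tot + 4 * A1 + 3 * A2 + 2 * A3 + A4) %/ 5)%N.
Proof.
rewrite leq_divRL // size_degrees_split //; have := sum_degrees_split ds.
move: dsT hA1 hA2 hA3 hA4.
by move: (count_mem 1%N ds) (count_mem 2%N ds) (count_mem 3%N ds) (count_mem 4%N ds) (ge5 ds) (\sum_(d <- ds) d)%N; clear; lia.
Qed.

Let ge5_le : (ge5 ds <= tot %/ 5)%N.
Proof.
rewrite leq_divRL //; have := sum_degrees_split ds; move: dsT.
by move: (count_mem 1%N ds) (count_mem 2%N ds) (count_mem 3%N ds) (count_mem 4%N ds) (ge5 ds) (\sum_(d <- ds) d)%N; clear; lia.
Qed.

Lemma inv_scaled_le S d : q%:R ^- d * S%:R <= (S %/ q ^ d + 1)%N%:R :> algC.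
Proof.
rewrite mulrC ler_pdivrMr ?exprn_gt0 // -natrX -natrM ler_nat mulnDl mul1n.
by rewrite {1}(divn_eq S (q ^ d)) leq_add2l ltnW // ltn_pmod // expn_gt0 ltnW.
Qed.

Lemma degree_sum_scaled_le S : (\sum_(d <- ds) q%:R ^- d) * S%:R <=
  (A1 * (S %/ q ^ 1 + 1) + A2 * (S %/ q ^ 2 + 1) + A3 * (S %/ q ^ 3 + 1) + A4 * (S %/ q ^ 4 + 1)
    + tot %/ 5 * (S %/ q ^ 5 + 1))%N%:R :> algC.
Proof.
have S0 : 0 <= (S%:R : algC) by rewrite ler0n.
apply: le_trans (ler_wpM2r S0 (sum_by_degree ds1)) _.
have t c A d : (c <= A)%N -> c%:R * q%:R ^- d * S%:R <= (A * (S %/ q ^ d + 1))%N%:R :> algC.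
  move=> cA; rewrite -mulrA natrM; apply: ler_pM; rewrite ?ler0n ?ler_nat ?mulr_ge0 ?ler0n ?(ltW (qV _)) //.
  exact: inv_scaled_le.
rewrite !mulrDl !natrD.
exact: lerD (lerD (lerD (lerD (t _ _ _ hA1) (t _ _ _ hA2)) (t _ _ _ hA3)) (t _ _ _ hA4)) (t _ _ _ ge5_le).
Qed.

(** An integer lower bound for x (1 - 1 / N). *)
Definition dec N x := (x - (x %/ N + 1))%N.

Lemma dec_le N x (y : algC) : (0 < N)%N -> x%:R <= y -> (dec N x)%:R <= y * (1 - N%:R^-1).
Proof.
move=> N0 xy; have N0' : 0 < (N%:R : algC) by rewrite ltr0n.
have N1 : 0 <= 1 - (N%:R^-1 : algC) by rewrite subr_ge0 invf_le1 // ler1n.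
apply: le_trans (ler_wpM2r N1 xy); rewrite /dec.
have [h|h] := leqP (x %/ N + 1) x; last first.
  by rewrite (eqP (ltnW h : _ - _ == 0)%N) mulr_ge0 // ler0n.
rewrite natrB // mulrBr mulr1 lerD2l lerN2 ler_pdivrMr // -natrM ler_nat mulnDl mul1n.
by rewrite {1}(divn_eq x N) leq_add2l ltnW // ltn_pmod.
Qed.

Lemma iter_dec_le N x a (y : algC) : (0 < N)%N -> x%:R <= y -> (iter a (dec N) x)%:R <= y * (1 - N%:R^-1) ^+ a.
Proof.
move=> N0 xy; elim: a => [|a IH]; first by rewrite expr0 mulr1.
by rewrite exprSr mulrA /=; apply: dec_le.
Qed.

Lemma degree_prod_scaled_ge S :
  (iter (tot %/ 5) (dec (q ^ 5)) (iter A4 (dec (q ^ 4)) (iter A3 (dec (q ^ 3))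
    (iter A2 (dec (q ^ 2)) (iter A1 (dec (q ^ 1)) S)))))%:R
   <= (\prod_(d <- ds) (1 - q%:R ^- d)) * S%:R :> algC.
Proof.
have qd d : (0 < q ^ d)%N by rewrite expn_gt0 ltnW.
have S0 : 0 <= (S%:R : algC) by rewrite ler0n.
have h1 := iter_dec_le A1 (qd 1%N) (lexx (S%:R : algC)).
have h2 := iter_dec_le A2 (qd 2%N) h1.
have h3 := iter_dec_le A3 (qd 3%N) h2.
have h4 := iter_dec_le A4 (qd 4%N) h3.
have h5 := iter_dec_le (tot %/ 5) (qd 5%N) h4.
apply: le_trans h5 _; rewrite !natrX -!mulrA [X in _ <= X]mulrC ler_wpM2l // !mulrA.
apply: le_trans (prod_by_degree ds1).
have u0 d : (0 < d)%N -> 0 <= 1 - (q%:R : algC) ^- d by move=> d0; rewrite subr_ge0 ltW // qV1.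
have t d c A : (0 < d)%N -> (c <= A)%N -> (1 - (q%:R : algC) ^- d) ^+ A <= (1 - q%:R ^- d) ^+ c.
  move=> d0 cA; apply: ler_wiXn2l => //; first exact: u0.
  by rewrite lerBlDr lerDl ltW.
have e0 d a : (0 < d)%N -> 0 <= (1 - (q%:R : algC) ^- d) ^+ a by move=> d0; rewrite exprn_ge0 // u0.
by do !(apply: ler_pM; rewrite ?mulr_ge0 ?e0 ?t //).
Qed.
End DegreeLists.

(** By [degree_count], a bound for the number of irreducible factors of degree d. *)
Definition factor_bound q n d := (gcdn n (q ^ d - 1) %/ d)%N.
Definition omega_bound q n :=
  ((n - 2 + 4 * factor_bound q n 1 + 3 * factor_bound q n 2 + 2 * factor_bound q n 3 + factor_bound q n 4) %/ 5)%N.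
Definition sigma_bound q n S :=
  (factor_bound q n 1 * (S %/ q ^ 1 + 1) + factor_bound q n 2 * (S %/ q ^ 2 + 1) + factor_bound q n 3 * (S %/ q ^ 3 + 1)
    + factor_bound q n 4 * (S %/ q ^ 4 + 1) + (n - 2) %/ 5 * (S %/ q ^ 5 + 1))%N.
Definition density_bound q n S :=
  iter ((n - 2) %/ 5) (dec (q ^ 5)) (iter (factor_bound q n 4) (dec (q ^ 4)) (iter (factor_bound q n 3) (dec (q ^ 3))
    (iter (factor_bound q n 2) (dec (q ^ 2)) (iter (factor_bound q n 1) (dec (q ^ 1)) S)))).

(* The primes p < T missing from ps only help: each p in D \ ps contributes T / p >= 1. *)
Lemma size_large_primes T (D ps : seq nat) : uniq ps -> all (fun d => d <= T)%N D ->
  all (fun p => (p < T)%N ==> (p \in D)) ps ->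
  (T ^ size ps * \prod_(d <- D) d <= T ^ size D * \prod_(p <- ps) p)%N.
Proof.
elim: ps D => [|p ps IH] D.
  move=> _ h _; rewrite big_nil mul1n muln1; elim: D h => [|d D IH]; first by rewrite big_nil.
  by rewrite big_cons expnS /= => /andP [dT /IH]; apply: leq_mul.
move=> /= /andP [pps ups] DT /andP [/implyP pD psD]; rewrite big_cons expnS.
have [pT|Tp] := ltnP p T; last first.
  by rewrite -mulnA [X in (_ <= X)%N]mulnCA; apply: leq_mul => //; apply: IH.
have pD' := pD pT; rewrite (perm_big _ (perm_to_rem pD')) (perm_size (perm_to_rem pD')) big_cons /= expnS.
rewrite -!mulnA leq_mul2l; apply/orP; right.
rewrite mulnCA [X in (_ <= X)%N]mulnCA leq_mul2l; apply/orP; right.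
apply: IH => //; first by apply/allP => d /mem_rem; exact: (allP DT).
apply/allP => x xps; apply/implyP => xT; have := implyP (allP psD x xps) xT.
rewrite (perm_mem (perm_to_rem pD')) inE => /orP [/eqP xp|//].
by move: pps; rewrite -xp xps.
Qed.

Lemma prod_primes_le m : (0 < m)%N -> (\prod_(p <- primes m) p <= m)%N.
Proof.
move=> m0; rewrite {2}(prod_prime_decomp m0) prime_decompE big_map /= !big_seq.
apply: leq_prod => p; rewrite mem_primes => /and3P [pp _ pm].
by rewrite -{1}(expn1 p) leq_exp2l ?prime_gt1 // logn_gt0 mem_primes pp m0.
Qed.

(** * Criteria in terms of q, n and bounds for the primes *)

Section CombinedCriteria.
Variables (F L : finFieldType) (iota : {rmorphism F -> L}) (n : nat).
Hypothesis n5 : (5 <= n)%N.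
Hypothesis cardL : #|L| = (#|F| ^ n)%N.
Let q := #|F|.
Let M := proj_order q n.
Variables (f D2 : {poly F}).
Hypothesis D2f : D2 * f = 'X^n - 1.
Hypothesis sD2 : size D2 = 3.
Let n4 : (4 <= n)%N. Proof. exact: ltnW. Qed.
Let n_gt0 : (0 < n)%N. Proof. exact: leq_trans n5. Qed.
Let q_gt1 : (1 < q)%N. Proof. exact: finNzRing_gt1. Qed.
Let q0 : 0 < (q%:R : algC). Proof. by rewrite ltr0n ltnW. Qed.
Let f0 : f != 0.
Proof. by apply/eqP => f0; move: (@Xn1_neq0 F n n_gt0); rewrite -D2f f0 mulr0 eqxx. Qed.
Let f_dvd : f %| 'X^n - 1. Proof. by rewrite -D2f dvdp_mull. Qed.

Lemma factor_list : exists rs : seq {poly F},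
  [/\ forall r, r \in rs -> [/\ irreducible_poly r, r \is monic & r %| f], coprime_list rs,
     forall r, irreducible_poly r -> r %| f -> has (fun s => r %= s) rs & (0 < size rs)%N].
Proof.
have [rs [h1 _ h2 h3]] := distinct_irreducible_factors f0; exists rs; split => //.
have [|r [ri _ rf]] := @irreducible_factor F f.
  by have := size_cofactor n4 D2f sD2; move: n5; clear; move: (size f) => a; lia.
by have := h3 r ri rf; case: (rs).
Qed.

Section FactorDegrees.
Variable rs : seq {poly F}.
Hypothesis rsP : forall r, r \in rs -> [/\ irreducible_poly r, r \is monic & r %| f].
Hypothesis rsC : coprime_list rs.
Let ds := [seq (size r).-1 | r : {poly F} <- rs].

Lemma degrees_gt0 : all (leq 1) ds.
Proof. by apply/allP => d /mapP [r rrs ->]; apply: (degree_gt0 rsP). Qed.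

Lemma degrees_sum : (\sum_(d <- ds) d <= n - 2)%N.
Proof. by rewrite big_map -(size_cofactor n4 D2f sD2); apply: degree_sum. Qed.

Lemma degrees_count d : (0 < d)%N -> (count_mem d ds <= factor_bound q n d)%N.
Proof.
move=> d0; rewrite leq_divRL // mulnC; apply: leq_trans (degree_count n_gt0 f_dvd rsP rsC d0).
by rewrite count_map.
Qed.

Lemma factors_le : (size rs <= n - 2)%N.
Proof.
apply: leq_trans degrees_sum; have := degrees_gt0.
rewrite -(size_map (fun r : {poly F} => (size r).-1)) -/ds.
elim: ds => [|d l IH] // /andP [d1 /IH h]; rewrite big_cons /= -add1n; exact: leq_add.
Qed.

Lemma omega_le : (size rs <= omega_bound q n)%N.
Proof.
rewrite -(size_map (fun r : {poly F} => (size r).-1)).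
by apply: (number_of_factors_le q_gt1 degrees_gt0 degrees_sum); apply: degrees_count.
Qed.

Lemma degree_sum_le_trivial S : (\sum_(r <- rs) q%:R ^- (size r).-1) * S%:R <= ((n - 2) * (S %/ q + 1))%N%:R :> algC.
Proof.
have h : \sum_(d <- ds) q%:R ^- d <= (n - 2)%N%:R * (q%:R : algC)^-1.
  apply: le_trans (_ : (size ds)%:R * (q%:R)^-1 <= _); last first.
    by rewrite ler_wpM2r ?invr_ge0 ?ler0n // ler_nat size_map factors_le.
  elim: ds degrees_gt0 => [|d l IH]; first by rewrite big_nil mul0r.
  move=> /andP [d1 /IH h]; rewrite big_cons /= -addn1 natrD mulrDl mul1r addrC lerD //.
  by rewrite lef_pV2 ?posrE ?exprn_gt0 // -{1}(expr1 q%:R) ler_weXn2l // ler1n ltnW.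
rewrite big_map in h; apply: le_trans (ler_wpM2r _ h) _; first by rewrite ler0n.
by rewrite -mulrA natrM ler_wpM2l ?ler0n // -(expn1 q) -(expr1 q%:R) inv_scaled_le.
Qed.
End FactorDegrees.

Section SmallPrimes.
Variables (T B fuel : nat) (D : seq nat).
Hypothesis sD : sorted ltn D.
Hypothesis aD : all (fun d => 0 < d < T)%N D.
Hypothesis T0 : (0 < T)%N.
Hypothesis DM : forall p, prime p -> (p %| M)%N -> (p < T)%N -> p \in D.
Hypothesis MB : (\prod_(p <- primes M) p <= B)%N.
Hypothesis Bfuel : (B < 2 ^ fuel)%N.
Let cov := cover fuel T D B.

(** Two ways to bound the factors: degree by degree for a known q, or, for a range of q, as n - 2
    linear factors, where a lower bound for q suffices. *)
Lemma mode1_from_bounds S k sigS Om Q : (Q <= q ^ (n - 4))%N ->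
  let recS := (\sum_(d <- drop k cov) (S %/ d + 1))%N in
  (sigma_bound q n S <= sigS)%N && (omega_bound q n <= Om)%N
    || ((n - 2) * (S %/ q + 1) <= sigS)%N && (n - 2 <= Om)%N ->
  (recS + sigS < S)%N ->
  ((S * 2 ^ k * (size (drop k cov) + 1 + Om)) ^ 2 <= (S - (recS + sigS)) ^ 2 * Q)%N ->
  exists b : L, primitive_elt b /\ k_normal q n 2 b.
Proof.
move=> hQ recS hb lt h; have [rs [rsP rsC rsA _]] := factor_list.
have [hs ho] : (\sum_(r <- rs) q%:R ^- (size r).-1) * S%:R <= sigS%:R :> algC /\ (size rs <= Om)%N.
  case/orP: hb => /andP [h1 h2]; split.
  - apply: le_trans (_ : (sigma_bound q n S)%:R <= _); last by rewrite ler_nat.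
    by rewrite -(big_map (fun r : {poly F} => (size r).-1) predT (fun d => q%:R ^- d)); apply: degree_sum_scaled_le;
      do ?exact: degrees_count; [exact: q_gt1|exact: degrees_gt0|exact: degrees_sum].
  - exact: leq_trans (omega_le rsP rsC) h2.
  - apply: le_trans (degree_sum_le_trivial rsP rsC S) _; by rewrite ler_nat.
  - by apply: leq_trans (factors_le rsP rsC) _.
apply: (cover_mode1 iota n4 cardL D2f sD2 rsP rsA sD aD T0 DM MB Bfuel lt hs ho).
by apply: leq_trans h _; rewrite leq_mul2l hQ orbT.
Qed.

Lemma mode2_from_bounds S k Q : (Q <= q ^ (n - 4))%N ->
  let recS := (\sum_(d <- drop k cov) (S %/ d + 1))%N in
  let prodS := density_bound q n S in let Om := omega_bound q n in
  (recS < S)%N ->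
  ((S * S * 2 ^ (k + Om) * (size (drop k cov) + 1)) ^ 2 <= ((S - recS) * prodS) ^ 2 * Q)%N ->
  exists b : L, primitive_elt b /\ k_normal q n 2 b.
Proof.
move=> hQ recS prodS Om lt h; have [rs [rsP rsC rsA rs0]] := factor_list.
have hp : prodS%:R <= (\prod_(r <- rs) (1 - q%:R ^- (size r).-1)) * S%:R :> algC.
  by rewrite -(big_map (fun r : {poly F} => (size r).-1) predT (fun d => 1 - q%:R ^- d)); apply: degree_prod_scaled_ge;
    do ?exact: degrees_count; [exact: q_gt1|exact: degrees_gt0|exact: degrees_sum].
have ho : (size rs <= Om)%N := omega_le rsP rsC.
apply: (cover_mode2 iota n4 cardL D2f sD2 rsP rsC rsA sD aD T0 DM MB Bfuel lt hp rs0 ho).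
by apply: leq_trans h _; rewrite leq_mul2l hQ orbT.
Qed.
End SmallPrimes.

Let M_gt0 : (0 < M)%N. Proof. by apply: proj_order_gt0; apply: leq_trans n4. Qed.

Lemma proj_order_le : (M <= 2 * q ^ n.-1)%N.
Proof.
have E := proj_orderE cardL; rewrite cardL -/M -/q in E.
have q1 : (0 < q.-1)%N by move: q_gt1; clear; case: (q) => [|[]].
rewrite -(leq_pmul2l q1).
have qn0 : (0 < q ^ n)%N by rewrite expn_gt0 ltnW.
have h : (q ^ n <= q.-1 * (2 * q ^ n.-1))%N.
  rewrite mulnA -{1}(prednK n_gt0) expnS leq_mul2r; apply/orP; right.
  by move: q_gt1; clear; lia.
by apply: leq_trans h; rewrite mulnC -E leq_pred.
Qed.

Section AllPrimes.
Variables (T C : nat) (D : seq nat).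
Hypothesis DT : all (fun d => d <= T)%N D.
Hypothesis TC : (T ^ size D <= C * \prod_(d <- D) d)%N.
Hypothesis D0 : all (fun d => 0 < d)%N D.
Hypothesis DM : forall p, prime p -> (p %| M)%N -> (p < T)%N -> p \in D.

Lemma number_of_primes : (T ^ size (primes M) <= C * (2 * q ^ n.-1))%N.
Proof.
have h : all (fun p => (p < T)%N ==> (p \in D)) (primes M).
  by apply/allP => p; rewrite mem_primes => /and3P [pp _ pM]; apply/implyP; apply: DM.
have pD : (0 < \prod_(d <- D) d)%N.
  by elim: (D) D0 => [|d l IH]; rewrite ?big_nil // big_cons muln_gt0 => /andP [-> /IH].
have h1 := size_large_primes (primes_uniq M) DT h.
have h2 := prod_primes_le M_gt0; have h3 := proj_order_le.
rewrite -(leq_pmul2r pD); apply: leq_trans h1 _.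
apply: leq_trans (leq_mul TC (leq_trans h2 h3)) _.
by rewrite mulnAC.
Qed.
End AllPrimes.

Lemma mode1_all_primes : (2 * (n - 2) <= q)%N ->
  ((2 * 2 ^ size (primes M) * n.-1) ^ 2 <= q ^ (n - 4))%N ->
  exists b : L, primitive_elt b /\ k_normal q n 2 b.
Proof.
move=> nq h; have [rs [rsP rsC rsA _]] := factor_list.
have pr := primes_of_take_drop M (size (primes M)).
have pc := @primes_take_drop_complete M M_gt0 (size (primes M)).
rewrite drop_size take_size in pr pc.
(* R is empty, and 2 (n - 2) <= q bounds the sum over the factors by 1/2: S = 2, recS = 0, sigS = dd
   = 1. *)
apply: (@mode1_nat F L iota n n4 cardL f D2 rs D2f sD2 rsP rsA _ _ pr pc 2 0 1 1 (size (primes M)) 0 (n - 2)) => //.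
- by rewrite /rec_sum big_nil mul0r.
- have h2 : \sum_(r <- rs) q%:R ^- (size r).-1 <= (n - 2)%N%:R * (q%:R : algC)^-1.
    apply: le_trans (_ : (size rs)%:R * (q%:R)^-1 <= _); last first.
      by rewrite ler_wpM2r ?invr_ge0 ?ler0n // ler_nat (factors_le rsP rsC).
    rewrite -(size_map (fun r : {poly F} => (size r).-1)).
    rewrite -(big_map (fun r : {poly F} => (size r).-1) predT (fun d => q%:R ^- d)).
    elim: (map _ rs) (degrees_gt0 rsP) => [|d l IH]; first by rewrite big_nil mul0r.
    move=> /andP [d1 /IH h']; rewrite big_cons /= -addn1 natrD mulrDl mul1r addrC lerD //.
    by rewrite lef_pV2 ?posrE ?exprn_gt0 // -{1}(expr1 q%:R) ler_weXn2l // ler1n ltnW.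
  apply: le_trans (ler_wpM2r (ler0n _ 2) h2) _.
  by rewrite mulrAC ler_pdivrMr // mul1r -natrM ler_nat mulnC.
- by rewrite /rec_sum big_nil ltr01.
- exact: factors_le.
- rewrite exp1n mul1n; apply: leq_trans h; rewrite leq_exp2r // leq_mul2l; apply/orP; right.
  by move: n5; clear; lia.
Qed.

(* Both sides are compared after raising to the 40th power. *)
Lemma mode2_all_primes (c w : nat) :
  (2 ^ (8 * size (primes M)) <= 2 ^ c * q ^ n.-1)%N ->
  (2 ^ (5 * c + 8 * w) <= q ^ (7 * n - 59))%N -> (59 <= 7 * n)%N ->
  (forall rs : seq {poly F}, (forall r, r \in rs -> [/\ irreducible_poly r, r \is monic & r %| f]) -> coprime_list rs ->
    (\prod_(r <- rs) (2%:R / (1 - q%:R ^- (size r).-1))) ^+ 5 <= 2%:R ^+ w * q%:R ^+ (n - 2) :> algC) ->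
  exists b : L, primitive_elt b /\ k_normal q n 2 b.
Proof.
move=> hs hq hn hw; have [rs [rsP rsC rsA rs0]] := factor_list.
have pr := primes_of_take_drop M (size (primes M)).
have pc := @primes_take_drop_complete M M_gt0 (size (primes M)).
rewrite drop_size take_size in pr pc.
have [g [g0 [g_gen g_order]]] := finField_generator L.
have [z zM] := C_prim_root_exists (proj_order_gt0 F n_gt0).
have rec1 : rec_sum [::] < 1 by rewrite /rec_sum big_nil ltr01.
have := mode2_criterion iota n_gt0 cardL g0 g_gen g_order zM D2f rsP rsC rsA pr pc rec1 rs0.
rewrite sD2; apply; rewrite (size_cofactor n4 D2f sD2) /rec_sum big_nil subr0 mul1r mulr1.
set k := size (primes M) in hs *.
have {hw} := hw rs rsP rsC; set W := \prod_(r <- rs) _ => hw.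
set b := sqrtC _; set P := \prod_(r <- rs) _.
have b0 : 0 <= b by rewrite sqrtC_ge0 exprn_ge0 // ler0n.
have one_sub_gt0 r : r \in rs -> 0 < 1 - (q%:R : algC) ^- (size r).-1.
  move=> rrs; rewrite subr_gt0 invf_lt1 ?exprn_gt0 // exprn_egt1 ?ltr1n // -lt0n.
  exact: (degree_gt0 rsP).
have P0 : 0 < P by rewrite /P big_seq; apply: prodr_gt0 => r; exact: one_sub_gt0.
have WP : 2%:R ^+ size rs = W * P.
  rewrite /W /P -big_split /= big_seq (eq_bigr (fun=> 2%:R)) => [|r rrs]; last first.
    by rewrite -mulrA mulVf ?mulr1 // gt_eqF // one_sub_gt0.
  by rewrite -big_seq big_const_seq count_predT iter_mulr mulr1.
have W0 : 0 <= W.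
  by rewrite /W big_seq; apply: prodr_ge0 => r rrs; rewrite divr_ge0 ?ler0n // ltW // one_sub_gt0.
rewrite WP.
have -> : 2 ^+ k * (W * P * b) = (2 ^+ k * W * b) * P by ring.
rewrite ler_pM2r //.
have q0' : 0 <= (q%:R : algC) ^+ (n - 2) by rewrite exprn_ge0 // ler0n.
have l0 : 0 <= 2 ^+ k * W * b by rewrite !mulr_ge0 // exprn_ge0.
(* 40 is a common multiple of the exponents 8 and 5 in the bounds for the primes and for the
   factors, and it is even because of the square root. *)
rewrite -(@ler_pXn2r _ 40) ?nnegrE // !exprMn -!exprM.
have -> : b ^+ 40 = q%:R ^+ (20 * n).
  by rewrite (_ : 40 = 2 * 20)%N // exprM /b sqrtCK -exprM mulnC.
have h1 : 2 ^+ (k * 40) <= 2 ^+ (5 * c) * q%:R ^+ (5 * n.-1) :> algC.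
  have -> : (k * 40 = (8 * k) * 5)%N by clear; lia.
  rewrite (exprM _ _ 5) [(5 * c)%N]mulnC [(5 * n.-1)%N]mulnC (exprM _ c 5) (exprM _ n.-1 5) -exprMn.
  rewrite ler_pXn2r ?nnegrE ?mulr_ge0 ?exprn_ge0 ?ler0n //.
  by rewrite -!natrX -natrM ler_nat.
have h2 : W ^+ 40 <= 2 ^+ (8 * w) * q%:R ^+ (8 * (n - 2)) :> algC.
  rewrite (_ : 40 = 5 * 8)%N // (exprM _ 5 8) [(8 * w)%N]mulnC [(8 * (n - 2))%N]mulnC (exprM _ w 8) (exprM _ (n - 2) 8) -exprMn.
  by rewrite ler_pXn2r ?nnegrE ?mulr_ge0 ?exprn_ge0 ?ler0n.
apply: le_trans (ler_wpM2r _ (ler_pM _ _ h1 h2)) _; rewrite ?exprn_ge0 ?ler0n //.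
have -> : ((n - 2) * 40 = (7 * n - 59) + (5 * n.-1 + 8 * (n - 2) + 20 * n))%N by move: hn n5; clear; lia.
rewrite [in X in _ <= X]exprD.
have -> : 2 ^+ (5 * c) * q%:R ^+ (5 * n.-1) * (2 ^+ (8 * w) * q%:R ^+ (8 * (n - 2))) * q%:R ^+ (20 * n)
   = 2 ^+ (5 * c + 8 * w) * q%:R ^+ (5 * n.-1 + 8 * (n - 2) + 20 * n) :> algC.
  by rewrite !exprD; ring.
by rewrite ler_pM2r ?exprn_gt0 // -!natrX ler_nat.
Qed.
End CombinedCriteria.

(** * Binary verification of the criteria *)

Lemma to_nat_add a b : N.to_nat (a + b)%num = (N.to_nat a + N.to_nat b)%N. Proof. lia. Qed.
Lemma to_nat_sub a b : N.to_nat (a - b)%num = (N.to_nat a - N.to_nat b)%N. Proof. lia. Qed.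
Lemma to_nat_mul a b : N.to_nat (a * b)%num = (N.to_nat a * N.to_nat b)%N. Proof. lia. Qed.
Lemma to_nat_divmod a b : (b <> 0)%num ->
  N.to_nat a = (N.to_nat (a / b)%num * N.to_nat b + N.to_nat (a mod b)%num)%N /\ (N.to_nat (a mod b)%num < N.to_nat b)%N.
Proof.
move=> b0; have := N.mod_lt a b b0; have := N.div_mod' a b.
by move: (a / b)%num (a mod b)%num => x y; lia.
Qed.
Lemma to_nat_div a b : N.to_nat (a / b)%num = (N.to_nat a %/ N.to_nat b)%N.
Proof.
case: (N.eq_dec b 0%num) => [->|b0]; first by rewrite divn0; case: a.
by have [-> lt] := to_nat_divmod a b0; rewrite divnMDl ?(leq_ltn_trans _ lt) // divn_small // addn0.
Qed.
Lemma to_nat_mod a b : N.to_nat (a mod b)%num = (N.to_nat a %% N.to_nat b)%N.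
Proof.
case: (N.eq_dec b 0%num) => [->|b0]; first by rewrite modn0; case: a.
by have [-> lt] := to_nat_divmod a b0; rewrite modnMDl modn_small.
Qed.
Lemma to_nat_pow a b : N.to_nat (a ^ b)%num = (N.to_nat a ^ N.to_nat b)%N.
Proof. by rewrite N2Nat.inj_pow; elim: (N.to_nat b) => //= m ->; rewrite expnS. Qed.
Lemma to_nat_leb a b : (a <=? b)%num = (N.to_nat a <= N.to_nat b)%N. Proof. lia. Qed.
Lemma to_nat_ltb a b : (a <? b)%num = (N.to_nat a < N.to_nat b)%N. Proof. lia. Qed.
Lemma to_nat_eqb a b : (a =? b)%num = (N.to_nat a == N.to_nat b)%N. Proof. lia. Qed.
Lemma to_nat_gcd a b : N.to_nat (N.gcd a b) = gcdn (N.to_nat a) (N.to_nat b).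
Proof.
have dvd x y : N.divide x y <-> (N.to_nat x %| N.to_nat y)%N.
  split=> [[z ->]|/dvdnP [z zE]]; first by rewrite to_nat_mul dvdn_mull.
  by exists (N.of_nat z); apply: N2Nat.inj; rewrite to_nat_mul Nat2N.id.
apply/eqP; rewrite eqn_dvd dvdn_gcd -[gcdn _ _]Nat2N.id; apply/andP; split.
  by apply/andP; split; apply/dvd; [apply: N.gcd_divide_l|apply: N.gcd_divide_r].
by apply/dvd; apply: N.gcd_greatest; apply/dvd; rewrite Nat2N.id ?dvdn_gcdl ?dvdn_gcdr.
Qed.
Definition to_natE :=
  (to_nat_add, to_nat_sub, to_nat_mul, to_nat_div, to_nat_mod, to_nat_pow, to_nat_leb, to_nat_ltb, to_nat_eqb, to_nat_gcd).

Fixpoint cover_N fuel (T : N) (D : seq N) (B : N) : seq N :=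
  match fuel with
  | 0 => [::]
  | fuel'.+1 =>
    if D is d :: D' then if (d <=? B)%num then d :: cover_N fuel' T D' (B / d)%num else [::]
    else if (T <=? B)%num then T :: cover_N fuel' T [::] (B / T)%num else [::]
  end%N.

Lemma cover_NE fuel T D B :
  map N.to_nat (cover_N fuel T D B) = cover fuel (N.to_nat T) (map N.to_nat D) (N.to_nat B).
Proof.
elim: fuel D B => [|fuel IH] [|d D] B //=; rewrite to_natE.
  by case: ifP => //= _; rewrite IH to_natE.
by case: ifP => //= _; rewrite IH to_natE.
Qed.

Section Tests.
Variable S : N.

(** Length and scaled reciprocal sum of every tail, in one pass. The k-th tail stands for R when k
    primes are put into K, and [exists_tail] tries all k, doubling its argument K = 2^k along the
    way. *)
Fixpoint tails_N (cov : seq N) : seq (N * N) :=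
  if cov is d :: c then
    let t := tails_N c in
    if t is (s, r) :: _ then ((s + 1)%num, (r + (S / d + 1))%num) :: t else t
  else [:: (0%num, 0%num)].

Definition rec_nat (c : seq N) := (\sum_(d <- map N.to_nat c) (N.to_nat S %/ d + 1))%N.

Lemma tails_N_head c : exists t, tails_N c = (N.of_nat (size c), N.of_nat (rec_nat c)) :: t.
Proof.
rewrite /rec_nat; elim: c => [|d c [t IH]]; first by exists [::]; rewrite /= big_nil.
rewrite /= IH; exists ((N.of_nat (size c), N.of_nat (rec_nat c)) :: t); congr ((_, _) :: _); first by lia.
by rewrite big_cons addnC Nat2N.inj_add -/(rec_nat c); congr (_ + _)%num; apply: N2Nat.inj; rewrite !to_natE Nat2N.id.
Qed.

Fixpoint exists_tail (test : N -> N -> N -> bool) (K : N) (t : seq (N * N)) :=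
  if t is (s, r) :: t' then if test K s r then true else exists_tail test (2 * K)%num t' else false.

Lemma exists_tailP test K c : exists_tail test K (tails_N c) ->
  exists k, test (2 ^ N.of_nat k * K)%num (N.of_nat (size (drop k c))) (N.of_nat (rec_nat (drop k c))).
Proof.
elim: c K => [|d c IH] K.
  rewrite /=; case: ifP => // h _; exists 0; rewrite /rec_nat /= big_nil.
  by case: (K) h.
have [t tE] := tails_N_head (d :: c); move: (tE); rewrite /=.
have [t' t'E] := tails_N_head c; rewrite t'E => -[_ _ _]; rewrite -t'E => h.
have {h} : test K (N.of_nat (size (d :: c))) (N.of_nat (rec_nat (d :: c))) || exists_tail test (2 * K)%num (tails_N c).
  by move: tE h; rewrite /= t'E => -[-> -> _].
case/orP => [h|/IH [k hk]]; first by exists 0; rewrite drop0 (_ : (2 ^ N.of_nat 0 * K)%num = K) //; case: (K).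
exists k.+1; have -> : (2 ^ N.of_nat k.+1 * K)%num = (2 ^ N.of_nat k * (2 * K))%num; last exact: hk.
by rewrite Nat2N.inj_succ N.pow_succ_r' -N.mul_assoc N.mul_shuffle3.
Qed.

(** Conditionals are used in place of boolean conjunctions because evaluation is by value: the
    costly comparison must not be computed when the first one fails. *)
Definition test1 (sig Om Q K s r : N) : bool :=
  if (r + sig <? S)%num then ((S * K * (s + 1 + Om)) ^ 2 <=? (S - (r + sig)) ^ 2 * Q)%num else false.

Definition test2 (Om prodS Q K s r : N) : bool :=
  if (r <? S)%num then ((S * S * (K * 2 ^ Om) * (s + 1)) ^ 2 <=? ((S - r) * prodS) ^ 2 * Q)%num else false.
End Tests.

Definition factor_bound_N q n d : N := (N.gcd n (q ^ d - 1) / d)%num.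
Definition omega_N q n : N :=
  ((n - 2 + 4 * factor_bound_N q n 1 + 3 * factor_bound_N q n 2 + 2 * factor_bound_N q n 3 + factor_bound_N q n 4) / 5)%num.
Definition sigma_N q n S : N :=
  (factor_bound_N q n 1 * (S / q ^ 1 + 1) + factor_bound_N q n 2 * (S / q ^ 2 + 1) + factor_bound_N q n 3 * (S / q ^ 3 + 1)
    + factor_bound_N q n 4 * (S / q ^ 4 + 1) + (n - 2) / 5 * (S / q ^ 5 + 1))%num.
Definition dec_N (m x : N) : N := (x - (x / m + 1))%num.
Definition iter_N (a : N) f (x : N) := iter (N.to_nat a) f x.
Definition density_N q n S : N :=
  iter_N ((n - 2) / 5)%num (dec_N (q ^ 5)%num) (iter_N (factor_bound_N q n 4) (dec_N (q ^ 4)%num)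
   (iter_N (factor_bound_N q n 3) (dec_N (q ^ 3)%num)
    (iter_N (factor_bound_N q n 2) (dec_N (q ^ 2)%num) (iter_N (factor_bound_N q n 1) (dec_N (q ^ 1)%num) S)))).

Lemma factor_bound_NE q n d : N.to_nat (factor_bound_N q n d) = factor_bound (N.to_nat q) (N.to_nat n) (N.to_nat d).
Proof. by rewrite /factor_bound_N !to_natE. Qed.

Lemma omega_NE q n : N.to_nat (omega_N q n) = omega_bound (N.to_nat q) (N.to_nat n).
Proof. by rewrite /omega_N ![in LHS](to_natE, factor_bound_NE). Qed.

Lemma sigma_NE q n S : N.to_nat (sigma_N q n S) = sigma_bound (N.to_nat q) (N.to_nat n) (N.to_nat S).
Proof. by rewrite /sigma_N ![in LHS](to_natE, factor_bound_NE). Qed.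

Lemma iter_dec_NE a m x : N.to_nat (iter_N a (dec_N m) x) = iter (N.to_nat a) (dec (N.to_nat m)) (N.to_nat x).
Proof. by rewrite /iter_N; elim: (N.to_nat a) => //= b IH; rewrite /dec_N /dec !to_natE IH. Qed.

Lemma density_NE q n S : N.to_nat (density_N q n S) = density_bound (N.to_nat q) (N.to_nat n) (N.to_nat S).
Proof. by rewrite /density_N ![in LHS](iter_dec_NE, to_natE, factor_bound_NE). Qed.

(** Common denominator of all rounded fractions; any positive value is sound, and a larger one loses
    less to rounding. *)
Definition scale : N := (2 ^ 20)%num.

Lemma size_nat_bound B : (N.to_nat B < 2 ^ N.size_nat B)%N.
Proof.
have := N.size_gt B; rewrite -N.ltb_lt to_nat_ltb to_nat_pow; congr (_ < _ ^ _)%N.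
by case: (B) => // p /=; elim: p => //= p <-; lia.
Qed.

Section TestSoundness.
Variables (F L : finFieldType) (iota : {rmorphism F -> L}) (n : nat).
Hypothesis n5 : (5 <= n)%N.
Hypothesis cardL : #|L| = (#|F| ^ n)%N.
Let q := #|F|.
Let M := proj_order q n.
Variables (f D2 : {poly F}).
Hypothesis D2f : D2 * f = 'X^n - 1.
Hypothesis sD2 : size D2 = 3.
Variables (T B : N) (D : seq N).
Let Dn := map N.to_nat D.
Hypothesis sD : sorted ltn Dn.
Hypothesis aD : all (fun d => 0 < d < N.to_nat T)%N Dn.
Hypothesis DM : forall p, prime p -> (p %| M)%N -> (p < N.to_nat T)%N -> p \in Dn.
Hypothesis MB : (\prod_(p <- primes M) p <= N.to_nat B)%N.
Let cov := cover_N (N.size_nat B) T D B.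

Let Bfuel : (N.to_nat B < 2 ^ N.size_nat B)%N := size_nat_bound B.

Let covE k : map N.to_nat (drop k cov) = drop k (cover (N.size_nat B) (N.to_nat T) Dn (N.to_nat B)).
Proof. by rewrite map_drop cover_NE. Qed.

Hypothesis T0 : (0 < N.to_nat T)%N.

Lemma test1_sound sig Om Q : (N.to_nat Q <= q ^ (n - 4))%N ->
  (sigma_bound q n (N.to_nat scale) <= N.to_nat sig)%N && (omega_bound q n <= N.to_nat Om)%N
    || ((n - 2) * (N.to_nat scale %/ q + 1) <= N.to_nat sig)%N && (n - 2 <= N.to_nat Om)%N ->
  exists_tail (test1 scale sig Om Q) 1%num (tails_N scale cov) ->
  exists b : L, primitive_elt b /\ k_normal q n 2 b.
Proof.
move: scale => S hQ hb /exists_tailP [k]; rewrite /test1 N.mul_1_r; case: ifP => // h1 h2.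
have E : size (drop k (cover (N.size_nat B) (N.to_nat T) Dn (N.to_nat B))) = size (drop k cov) by rewrite -covE size_map.
apply: (mode1_from_bounds iota n5 cardL D2f sD2 sD aD T0 DM MB Bfuel hQ hb (k := k)).
  by rewrite -covE; move: h1; rewrite !to_natE Nat2N.id.
by rewrite E -covE; move: h2; rewrite !to_natE !Nat2N.id.
Qed.

Lemma test2_sound qN nN Q : N.to_nat qN = q -> N.to_nat nN = n -> (N.to_nat Q <= q ^ (n - 4))%N ->
  exists_tail (test2 scale (omega_N qN nN) (density_N qN nN scale) Q) 1%num (tails_N scale cov) ->
  exists b : L, primitive_elt b /\ k_normal q n 2 b.
Proof.
move: scale => S eq en hQ; have := density_NE qN nN S; have := omega_NE qN nN; rewrite eq en.
move: (omega_N _ _) (density_N _ _ _) => om de omE deE /exists_tailP [k]; rewrite /test2 N.mul_1_r; case: ifP => // h1 h2.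
have E : size (drop k (cover (N.size_nat B) (N.to_nat T) Dn (N.to_nat B))) = size (drop k cov) by rewrite -covE size_map.
apply: (mode2_from_bounds iota n5 cardL D2f sD2 sD aD T0 DM MB Bfuel hQ (S := N.to_nat S) (k := k)).
  by rewrite -covE; move: h1; rewrite !to_natE Nat2N.id.
rewrite E -covE expnD; move: h2; rewrite !to_natE !Nat2N.id omE deE.
by [].
Qed.
End TestSoundness.

Definition small_primes : seq N :=
  [:: 2; 3; 5; 7; 11; 13; 17; 19; 23; 29; 31; 37; 41; 43; 47; 53; 59; 61; 67; 71; 73; 79; 83; 89; 97; 101; 103; 107;
     109; 113; 127; 131; 137; 139; 149; 151; 157; 163; 167; 173; 179; 181; 191; 193; 197; 199; 211; 223; 227; 229; 233;
     239; 241; 251]%num.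

Lemma small_primesP p : prime p -> (p < 256)%N -> p \in map N.to_nat small_primes.
Proof.
have : all (fun p => prime p ==> (p \in map N.to_nat small_primes)) (iota 0 256) by vm_compute.
by move=> /allP h pp p256; apply: (implyP (h p _)); rewrite ?mem_iota.
Qed.

(** Dividing by p while p^2 divides B keeps the set of primes and lowers B towards its radical,
    which shortens [cover]. The limit on the rounds affects only the gain. *)
Fixpoint strip_loop k (p B : N) : N :=
  if k is k'.+1 then if (B mod (p * p) =? 0)%num then strip_loop k' p (B / p)%num else B else B.
Definition strip (B p : N) : N := strip_loop 10 p B.

Lemma strip_step (B p : N) : (0 < N.to_nat B)%N -> (N.to_nat (p * p)%num %| N.to_nat B)%N ->
  (0 < N.to_nat (B / p)%num)%N /\ primes (N.to_nat (B / p)%num) = primes (N.to_nat B).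
Proof.
rewrite !to_natE; move: (N.to_nat B) (N.to_nat p) => b {B p} p b0 /dvdnP [c bE].
have p0 : (0 < p)%N by case: p b0 bE => //; rewrite !muln0 => + E; rewrite E.
have -> : (b %/ p = c * p)%N by rewrite bE mulnA mulnK.
move: b0; rewrite bE !muln_gt0 p0 !andbT => c0; split=> //.
apply: (irr_sorted_eq ltn_trans ltnn); rewrite ?sorted_primes // => l.
rewrite !mem_primes !muln_gt0 c0 p0 /=; case: (boolP (prime l)) => //= lp.
by rewrite !Euclid_dvdM // orbb.
Qed.

Lemma stripP B ps : (0 < N.to_nat B)%N ->
  (0 < N.to_nat (foldl strip B ps))%N /\ primes (N.to_nat (foldl strip B ps)) = primes (N.to_nat B).
Proof.
elim: ps B => //= p ps IH B B0; have [h0 h1] : (0 < N.to_nat (strip B p))%N /\ primes (N.to_nat (strip B p)) = primes (N.to_nat B).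
  rewrite /strip; elim: 10%N B B0 {IH} => //= k IHk B B0; case: ifP => // h.
  have [a b] : (0 < N.to_nat (B / p)%num)%N /\ primes (N.to_nat (B / p)%num) = primes (N.to_nat B).
    by apply: strip_step => //; move: h; rewrite to_nat_eqb to_nat_mod.
  by have [c ->] := IHk _ a.
by have [a ->] := IH _ h0.
Qed.

Definition individual_test (q n : N) : bool :=
  let M := ((q ^ n - 1) / (q - 1))%num in
  let D := [seq p <- small_primes | (M mod p =? 0)%num] in
  let B := foldl strip M D in
  let t := tails_N scale (cover_N (N.size_nat B) 256 D B) in
  let Q := (q ^ (n - 4))%num in
  if exists_tail (test1 scale (sigma_N q n scale) (omega_N q n) Q) 1%num t then true
  else exists_tail (test2 scale (omega_N q n) (density_N q n scale) Q) 1%num t.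

(** For 2^j <= q < 2^(j + 1): B comes from M <= 2 q^(n - 1), and elsewhere q is replaced by 2^j. *)
Definition range_test (T : N) (D : seq N) (n j : N) : bool :=
  let B := (2 ^ ((j + 1) * (n - 1) + 1))%num in
  exists_tail (test1 scale ((n - 2) * (scale / 2 ^ j + 1)) (n - 2) (2 ^ (j * (n - 4))))%num 1%num
    (tails_N scale (cover_N (N.size_nat B) T D B)).

(** A necessary condition for q to be a prime power with exponent at most 10; it discards most other
    q before the expensive tests. *)
Fixpoint prime_power_test (ps : seq N) (q : N) : bool :=
  if ps is p :: ps' then if (q mod p =? 0)%num then (p ^ 10 mod q =? 0)%num else prime_power_test ps' q else true.

Lemma prime_power_testP ps q p e : all (fun r => prime (N.to_nat r)) ps -> prime p -> (0 < e)%N -> (e <= 10)%N ->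
  N.to_nat q = (p ^ e)%N -> prime_power_test ps q.
Proof.
move=> psP pp e0 e10 qE; elim: ps psP => // r ps IH; cbn [all prime_power_test] => /andP [rp /IH {}IH]; case: ifP => // h.
move: h; rewrite to_nat_eqb to_nat_mod qE -/(dvdn _ _) Euclid_dvdX // e0 andbT dvdn_prime2 // => /eqP E.
rewrite !to_natE qE E; exact: dvdn_exp2l.
Qed.

Lemma small_primes_prime : all (fun r => prime (N.to_nat r)) small_primes.
Proof. by vm_compute. Qed.

(** Modulo p, q is a root of 1 + X + ... + X^4, so q^5 = 1: either 5 divides p - 1, or q = 1 modulo
    p and the sum is 5. *)
Lemma prime_dvd_quintic q p : prime p -> (p %| proj_order q 5)%N -> p = 5%N \/ (p %% 5 = 1)%N.
Proof.
move=> pp pM; have ch := pchar_Fp pp; pose x : 'F_p := q%:R.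
have sx : \sum_(i < 5) x ^+ i = 0.
  have : (proj_order q 5)%:R = 0 :> 'F_p by apply/eqP; rewrite -(dvdn_pcharf ch).
  rewrite /proj_order natr_sum => h; rewrite -[RHS]h; apply: eq_bigr => i _; exact: esym (natrX _ _ _).
have x5 : x ^+ 5 = 1 by apply/eqP; rewrite -subr_eq0 subrX1 sx mulr0.
have x0 : x != 0 by apply/eqP => x0; move/eqP: x5; rewrite x0 expr0n /= eq_sym oner_eq0.
have xp : x ^+ p.-1 = 1.
  apply: (mulfI x0); rewrite mulr1 -exprS prednK ?prime_gt0 //.
  by have := expf_card x; rewrite card_Fp.
have p1 : (0 < p.-1)%N by rewrite -ltnS prednK ?prime_gt1 ?prime_gt0.
have := expr_gcd1 (isT : 0 < 5)%N x5 xp.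
have [d5|d5] := boolP (5 %| p.-1)%N.
  by move=> _; right; move: d5; have := prime_gt0 pp; clear; lia.
have -> : gcdn 5 p.-1 = 1%N by apply/eqP; rewrite -/(coprime _ _) prime_coprime.
rewrite expr1 => x1; left; move/eqP: sx; rewrite x1 (eq_bigr (fun=> 1)) => [|i _]; last exact: expr1n.
by rewrite sumr_const card_ord -(dvdn_pcharf ch) dvdn_prime2 // => /eqP.
Qed.

Definition quintic_primes : seq N := [seq p <- small_primes | (p =? 5)%num || (p mod 5 =? 1)%num].
Definition quintic_primes512 : seq N :=
  quintic_primes ++ [:: 271; 281; 311; 331; 401; 421; 431; 461; 491]%num.

Lemma quintic_primesP p q : prime p -> (p %| proj_order q 5)%N -> (p < 512)%N ->
  p \in map N.to_nat quintic_primes512.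
Proof.
have : all (fun p => prime p && ((p == 5) || (p %% 5 == 1)%N) ==> (p \in map N.to_nat quintic_primes512)) (iota 0 512).
  by vm_compute.
move=> /allP h pp pM p512; apply: (implyP (h p _)); rewrite ?mem_iota // pp /=.
by case: (prime_dvd_quintic pp pM) => ->; rewrite ?eqxx ?orbT.
Qed.

Lemma quintic_primes256P p q : prime p -> (p %| proj_order q 5)%N -> (p < 256)%N -> p \in map N.to_nat quintic_primes.
Proof.
have : all (fun p => prime p && ((p == 5) || (p %% 5 == 1)%N) ==> (p \in map N.to_nat quintic_primes)) (iota 0 256).
  by vm_compute.
move=> /allP h pp pM p256; apply: (implyP (h p _)); rewrite ?mem_iota // pp /=.
by case: (prime_dvd_quintic pp pM) => ->; rewrite ?eqxx ?orbT.
Qed.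

Definition quintic_exceptions : seq (N * N) :=
  [seq (q, 5%num) | q <- [:: 4; 5; 9; 11; 16; 19; 25; 31; 41; 59; 61; 64; 71; 81; 101; 121; 131; 151; 181; 191; 251; 256]%num].
Definition sextic_exceptions : seq (N * N) :=
  [seq (q, 6%num) | q <- [:: 2; 3; 4; 5; 7; 8; 9; 11; 13; 16; 17; 19; 23; 25; 29; 31; 37; 43; 49; 61; 67; 79; 109]%num].
Definition exceptions : seq (N * N) := quintic_exceptions ++ sextic_exceptions ++
  [:: (8, 7); (2, 8); (3, 8); (5, 8); (9, 8); (2, 9); (4, 9); (2, 10); (3, 10); (11, 10); (2, 12); (3, 12); (4, 12);
      (5, 12); (7, 12); (13, 12); (2, 14); (2, 15); (4, 15); (2, 16); (3, 16); (2, 18); (2, 21); (2, 24); (5, 24)]%num.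

(** Pairs of n and a bound: every q below the bound is tested singly, larger q are left to the
    dyadic ranges and to the asymptotic criteria. *)
Definition grid : seq (N * N) :=
  [:: (5, 512); (6, 512); (7, 64)]%num ++ [seq (n, 32%num) | n <- map N.of_nat (iota 8 13)]
  ++ [seq (n, 2 * (n - 2))%num | n <- map N.of_nat (iota 21 91)].

(** 719 = 5 * 99 + 8 * 28, from the constants 2^99 of [primes_bound] and 2^28 of
    [omega_power_bound]. The argument r sharpens the integer logarithm: log2(q^r) / r approaches
    log2(q) from below. *)
Definition log_test (r n q : N) : bool :=
  if (20 <? n)%num then (r * 719 <=? N.log2 (q ^ r) * (7 * n - 59))%num else false.

Definition grid_test (n q : N) : bool :=
  if log_test 1 n q then true else
  if (N.gcd (q ^ 3 - q) n =? 1)%num then true else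
  if ~~ prime_power_test small_primes q then true else
  if log_test 16 n q then true else
  if (q, n) \in exceptions then true else individual_test q n.

Lemma grid_tested : all (fun nb : N * N => all (fun q => if (nb.2 <=? q)%num then true else grid_test nb.1 q) (map N.of_nat (iota 2 510))) grid.
Proof. by vm_compute. Qed.

Lemma range5_tested : all (range_test 256 quintic_primes 5) (map N.of_nat (iota 9 135)).
Proof. by vm_compute. Qed.

Lemma range6_tested : all (range_test 256 small_primes 6) (map N.of_nat (iota 9 37)).
Proof. by vm_compute. Qed.

Lemma range7_tested : all (range_test 256 small_primes 7) (map N.of_nat (iota 6 19)).
Proof. by vm_compute. Qed.

Lemma range20_tested : all (fun n => all (range_test 256 small_primes n) (map N.of_nat (iota 5 20)))
  (map N.of_nat (iota 8 13)).
Proof. by vm_compute. Qed.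

(** * A uniform bound for the product over the irreducible factors *)

Section OmegaPower.
Variable q : nat.
Hypothesis q1 : (1 < q)%N.

(* (2 / (1 - 1/x))^5 = x * weight x; weight x is at most 1 as soon as x > 36. *)
Definition weight (x : nat) : algC := (32 * x ^ 4)%N%:R / ((x - 1) ^ 5)%N%:R.

(** num / den is the larger of 1 and the weight of q^e, and [mul e] bounds the number of factors of
    degree e. Degrees from 6 on never matter, as 2^6 > 36. *)
Let num e := if (q ^ e <= 36)%N then (32 * (q ^ e) ^ 4)%N else 1%N.
Let den e := if (q ^ e <= 36)%N then ((q ^ e - 1) ^ 5)%N else 1%N.
Let mul e := ((q ^ e - 1) %/ e)%N.
Let cap e : algC := (num e)%:R / (den e)%:R.

Lemma weight_le1 x : (36 < x)%N -> weight x <= 1.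
Proof.
move=> x36; rewrite /weight ler_pdivrMr ?mul1r ?ltr0n ?expn_gt0 ?subn_gt0 ?(leq_trans _ x36) // ler_nat.
have [z ->] : exists z, x = (z + 37)%N by exists (x - 37)%N; rewrite subnK.
by rewrite -addnBA //= !expnS !expn0; clear; nia.
Qed.

Let qe e : (0 < e)%N -> (1 < q ^ e)%N. Proof. by move=> e0; rewrite -(expn0 q) ltn_exp2l. Qed.

Lemma weight_ge1 x : (1 < x)%N -> (x <= 36)%N -> ((x - 1) ^ 5 <= 32 * x ^ 4)%N.
Proof.
move=> x1 x36; have [y -> y35] : exists2 y, x = y.+1 & (y <= 35)%N by exists x.-1; move: x1 x36; clear; lia.
rewrite subn1 /=; apply: leq_trans (_ : 32 * y ^ 4 + 3 * y ^ 4 <= _)%N.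
  by rewrite -mulnDl expnS leq_mul2r y35 orbT.
have : (35 * y ^ 3 >= y ^ 4)%N by rewrite expnS leq_mul2r y35 orbT.
rewrite !expnS !expn0; clear; nia.
Qed.

Lemma weight_le_cap e : (0 < e)%N -> weight (q ^ e) <= cap e.
Proof.
move=> e0; rewrite /cap /num /den; case: leqP => h; last by rewrite divr1 weight_le1.
by [].
Qed.

Let den_gt0 e : (0 < e)%N -> (0 < den e)%N.
Proof. by move=> e0; rewrite /den; case: ifP => // _; rewrite expn_gt0 subn_gt0 qe. Qed.

Lemma cap_ge1 e : (0 < e)%N -> 1 <= cap e.
Proof.
move=> e0; rewrite /cap ler_pdivlMr ?mul1r ?ltr0n ?den_gt0 // ler_nat /num /den; case: ifP => // h.
by apply: weight_ge1 => //; apply: qe.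
Qed.

Lemma cap_large e : (5 < e)%N -> weight (q ^ e) <= 1.
Proof.
move=> e5; apply: weight_le1; apply: (@leq_trans (2 ^ 6)) => //.
by apply: leq_trans (_ : q ^ 6 <= _)%N; rewrite ?leq_exp2l // leq_exp2r.
Qed.

Let weight_ge0 x : 0 <= weight x. Proof. by rewrite divr_ge0 // ler0n. Qed.

Lemma prod_weight_le (ds : seq nat) : all (leq 1) ds ->
  \prod_(d <- ds) weight (q ^ d) <= \prod_(e <- [:: 1; 2; 3; 4; 5]%N) cap e ^+ count_mem e ds.
Proof.
elim: ds => [|d ds IH]; first by rewrite big_nil big1 // => e _; rewrite expr0.
move=> /andP [d1 /IH {}IH]; rewrite big_cons.
have -> : \prod_(e <- [:: 1; 2; 3; 4; 5]%N) cap e ^+ count_mem e (d :: ds) =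
  (\prod_(e <- [:: 1; 2; 3; 4; 5]%N) cap e ^+ (d == e)) * \prod_(e <- [:: 1; 2; 3; 4; 5]%N) cap e ^+ count_mem e ds.
  by rewrite -big_split; apply: eq_bigr => e _; rewrite /= exprD.
apply: ler_pM => //; first by apply: prodr_ge0 => e _.
have [d5|d5] := leqP d 5; last first.
  by rewrite big_seq big1 ?cap_large // => e; rewrite !inE => /or4P [/eqP->|/eqP->|/eqP->|/orP [/eqP->|/eqP->]]; rewrite gtn_eqF // (leq_trans _ d5).
case: d d1 d5 => [|[|[|[|[|[|d]]]]]] // _ _; rewrite !big_cons big_nil /= ?expr0 ?expr1 ?mulr1 ?mul1r; exact: weight_le_cap.
Qed.

Hypothesis table : (\prod_(e <- [:: 1; 2; 3; 4; 5]%N) num e ^ mul e <= 2 ^ 28 * \prod_(e <- [:: 1; 2; 3; 4; 5]%N) den e ^ mul e)%N.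

Lemma prod_weight_bound (ds : seq nat) : all (leq 1) ds ->
  (forall e, (0 < e)%N -> (e * count_mem e ds <= q ^ e - 1)%N) ->
  \prod_(d <- ds) weight (q ^ d) <= 2%:R ^+ 28.
Proof.
move=> ds1 hc; apply: le_trans (prod_weight_le ds1) _.
apply: (@le_trans _ _ (\prod_(e <- [:: 1; 2; 3; 4; 5]%N) cap e ^+ mul e)).
  rewrite !big_seq; apply: ler_prod => e ein.
  have e0 : (0 < e)%N by move: ein; rewrite !inE => /or4P [/eqP->|/eqP->|/eqP->|/orP [/eqP->|/eqP->]].
  have c1 := cap_ge1 e0.
  rewrite exprn_ge0 ?(le_trans ler01) //=; apply: ler_weXn2l => //.
  by rewrite leq_divRL // mulnC hc.
have -> : \prod_(e <- [:: 1; 2; 3; 4; 5]%N) cap e ^+ mul e =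
   (\prod_(e <- [:: 1; 2; 3; 4; 5]%N) num e ^ mul e)%N%:R / (\prod_(e <- [:: 1; 2; 3; 4; 5]%N) den e ^ mul e)%N%:R.
  by rewrite !natr_prod -prodf_div; apply: eq_bigr => e _; rewrite expr_div_n !natrX.
rewrite ler_pdivrMr; first by rewrite -natrX -natrM ler_nat.
by rewrite ltr0n !big_cons big_nil !muln_gt0 !expn_gt0 !den_gt0.
Qed.

(** Only finitely many prime powers q^e have a weight above 1, and few factors share a degree, so
    the weights multiply to at most 2^28 for every q; the extreme case is q = 3. *)
Lemma omega_power_bound (ds : seq nat) m : all (leq 1) ds -> (\sum_(d <- ds) d <= m)%N ->
  (forall e, (0 < e)%N -> (e * count_mem e ds <= q ^ e - 1)%N) ->
  (\prod_(d <- ds) (2%:R / (1 - q%:R ^- d))) ^+ 5 <= 2%:R ^+ 28 * q%:R ^+ m :> algC.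
Proof.
move=> ds1 dsm hc; rewrite -prodrXl.
have -> : \prod_(d <- ds) (2%:R / (1 - q%:R ^- d)) ^+ 5 = \prod_(d <- ds) weight (q ^ d) * q%:R ^+ (\sum_(d <- ds) d) :> algC.
  rewrite expr_sum -big_split /= !big_seq; apply: eq_bigr => d dds.
  have d0 : (0 < d)%N := allP ds1 d dds; have x1 := qe d0.
  rewrite /weight -!natrX; move: (q ^ d)%N x1 => x x1.
  rewrite !natrX natrM natrB ?(ltnW x1) // natrX.
  have x0 : (x%:R : algC) != 0 by rewrite pnatr_eq0 -lt0n ltnW.
  have xm : (x%:R : algC) - 1 != 0 by rewrite subr_eq0 pnatr_eq1 gtn_eqF.
  by field; rewrite x0 xm.
rewrite ler_pM ?prodr_ge0 ?exprn_ge0 ?ler0n //; first exact: prod_weight_bound.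
by rewrite ler_weXn2l // ler1n ltnW.
Qed.
End OmegaPower.

Definition omega_table (q : N) : bool :=
  let num e := (if q ^ e <=? 36 then 32 * (q ^ e) ^ 4 else 1)%num in
  let den e := (if q ^ e <=? 36 then (q ^ e - 1) ^ 5 else 1)%num in
  let mul e := ((if q ^ e <=? 36 then q ^ e - 1 else 0) / e)%num in
  (foldr (fun e acc => num e ^ mul e * acc) 1 [:: 1; 2; 3; 4; 5] <=?
   2 ^ 28 * foldr (fun e acc => den e ^ mul e * acc) 1 [:: 1; 2; 3; 4; 5])%num.

Lemma omega_table_checked : all omega_table (map N.of_nat (iota 2 35)).
Proof. by vm_compute. Qed.

Lemma omega_tableP q : (1 < q)%N -> 
  (\prod_(e <- [:: 1; 2; 3; 4; 5]%N) (if q ^ e <= 36 then 32 * (q ^ e) ^ 4 else 1) ^ ((q ^ e - 1) %/ e) <=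
   2 ^ 28 * \prod_(e <- [:: 1; 2; 3; 4; 5]%N) (if q ^ e <= 36 then (q ^ e - 1) ^ 5 else 1) ^ ((q ^ e - 1) %/ e))%N.
Proof.
move=> q1; have [q36|q36] := leqP q 36; last first.
  have big e : e \in [:: 1; 2; 3; 4; 5]%N -> (q ^ e <= 36)%N = false.
    move=> h; apply/negbTE; rewrite -ltnNge; apply: leq_trans q36 _; rewrite -{1}(expn1 q) leq_exp2l //.
    by move: h; rewrite !inE => /or4P [/eqP->|/eqP->|/eqP->|/orP [/eqP->|/eqP->]].
  rewrite [X in (X <= _)%N]big1_seq => [|e /andP [_ /big ->]]; last exact: exp1n.
  rewrite [X in (_ <= _ * X)%N]big1_seq => [|e /andP [_ /big ->]]; last exact: exp1n.
  by rewrite muln1 expn_gt0.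
have : omega_table (N.of_nat q).
  apply: (allP omega_table_checked); apply: map_f; rewrite mem_iota q1 /=.
  exact: q36.
rewrite /omega_table to_nat_leb to_nat_mul to_nat_pow.
have key (A : nat -> nat) (AN : N -> N) : (forall e, (0 < N.to_nat e)%N -> N.to_nat (AN e) = if (q ^ N.to_nat e <= 36)%N then A (N.to_nat e) else 1%N) ->
  N.to_nat (foldr (fun e acc => AN e ^ ((if N.of_nat q ^ e <=? 36 then N.of_nat q ^ e - 1 else 0) / e) * acc) 1 [:: 1; 2; 3; 4; 5])%num
   = (\prod_(e <- [:: 1; 2; 3; 4; 5]%N) (if q ^ e <= 36 then A e else 1) ^ ((q ^ e - 1) %/ e))%N.
  move=> h; have -> : [:: 1; 2; 3; 4; 5]%N = map N.to_nat [:: 1; 2; 3; 4; 5]%num by [].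
  rewrite big_map.
  have : all (fun e => 0 < N.to_nat e)%N [:: 1; 2; 3; 4; 5]%num by [].
  elim: [:: 1; 2; 3; 4; 5]%num => [|e l IH]; first by rewrite big_nil.
  move=> /= /andP [e0 /IH {}IH]; rewrite big_cons -IH to_nat_mul to_nat_pow to_nat_div h //; congr (_ * _)%N.
  case: (boolP (q ^ N.to_nat e <= 36)%N) => hq; last by rewrite !exp1n.
  by rewrite to_nat_leb to_nat_pow Nat2N.id (_ : (_ <= _)%N = true) // to_nat_sub to_nat_pow Nat2N.id.
rewrite (key (fun e => 32 * (q ^ e) ^ 4)%N) => [|e e0]; last first.
  by rewrite to_nat_leb to_nat_pow Nat2N.id; case: ifP => // _; rewrite to_nat_mul !to_nat_pow Nat2N.id.
rewrite (key (fun e => (q ^ e - 1) ^ 5)%N) => [|e e0]; last first.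
  by rewrite to_nat_leb to_nat_pow Nat2N.id; case: ifP => // _; rewrite to_nat_pow to_nat_sub to_nat_pow Nat2N.id.
by [].
Qed.

Lemma exp2_log_le q r e c : (0 < q)%N -> (0 < r)%N ->
  (N.of_nat r * N.of_nat c <=? N.log2 (N.of_nat q ^ N.of_nat r) * N.of_nat e)%num -> (2 ^ c <= q ^ e)%N.
Proof.
move=> q0 r0; set x := (N.of_nat q ^ N.of_nat r)%num; rewrite !to_natE !Nat2N.id => h.
have xE : N.to_nat x = (q ^ r)%N by rewrite to_nat_pow !Nat2N.id.
have x0 : (0 < x)%num by rewrite -N.ltb_lt to_nat_ltb xE expn_gt0 q0.
have [lo _] := N.log2_spec x x0; move: lo; rewrite -N.leb_le to_nat_leb to_nat_pow => lo.
rewrite -(@leq_exp2r _ _ r) // -!expnM [(e * r)%N]mulnC [(q ^ _)%N]expnM -xE.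
apply: leq_trans (_ : (2 ^ N.to_nat (N.log2 x)) ^ e <= _)%N.
  by rewrite -expnM leq_exp2l // [(c * r)%N]mulnC.
by case: (e) => // e'; rewrite leq_exp2r.
Qed.

Lemma dyadic_range q lo hi : (2 ^ lo <= q)%N -> (q < 2 ^ (lo + hi))%N ->
  exists2 j, j \in seq.iota lo hi & (2 ^ j <= q < 2 ^ j.+1)%N.
Proof.
move=> h1 h2; have q0 : (0 < q)%N by apply: leq_trans h1; rewrite expn_gt0.
exists (trunc_log 2 q); last exact: trunc_log_bounds.
have /andP [a b] := @trunc_log_bounds 2 q isT q0.
rewrite mem_iota -(@leq_exp2l 2) // -(@ltn_exp2l 2) // (leq_ltn_trans a h2) andbT.
by have := leq_ltn_trans h1 b; rewrite ltn_exp2l // ltnS leq_exp2l.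
Qed.

Lemma pow2_le a b q : (a <= b)%N -> (2 ^ b <= q)%N -> (2 ^ a <= q)%N.
Proof. by move=> ab; apply: leq_trans; rewrite leq_exp2l. Qed.

Lemma quintic_arith c s q : ((2 ^ 9) ^ s <= 2 ^ c * (2 * q ^ 4) -> 2 ^ (54 + 2 * c.+1) <= q ->
  (2 * 2 ^ s * 4) ^ 2 <= q ^ 1)%N.
Proof.
move=> h1 h2; rewrite expn1 -(@leq_exp2r _ _ 9) // -expnM.
have -> : (2 * 2 ^ s * 4 = 2 ^ 3 * 2 ^ s)%N by rewrite mulnAC mulnC.
rewrite expnMn -!expnM (_ : 3 * (2 * 9) = 54)%N //; apply: leq_trans (_ : 2 ^ 54 * (2 ^ c.+1 * q ^ 4) ^ 2 <= _)%N.
  have -> : (s * (2 * 9) = 9 * s * 2)%N by clear; lia.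
  by rewrite leq_mul2l (expnM 2 (9 * s) 2) leq_exp2r // (expnM 2 9 s) (expnSr 2 c) -mulnA h1 orbT.
rewrite expnMn mulnA -!expnM -expnD [(c.+1 * 2)%N]mulnC expnSr mulnC leq_mul2l.
by rewrite h2 orbT.
Qed.

(** * Case division on q and n *)

Section Dichotomy.
Variables (F L : finFieldType) (iota : {rmorphism F -> L}) (n : nat).
Hypothesis n5 : (5 <= n)%N.
Hypothesis cardL : #|L| = (#|F| ^ n)%N.
Let q := #|F|.
Let M := proj_order q n.
Variables (f D2 : {poly F}).
Hypothesis D2f : D2 * f = 'X^n - 1.
Hypothesis sD2 : size D2 = 3.
Let q1 : (1 < q)%N. Proof. exact: finNzRing_gt1. Qed.
Let M_gt0 : (0 < M)%N. Proof. by apply: proj_order_gt0; apply: leq_trans n5. Qed.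
Let good := exists b : L, primitive_elt b /\ k_normal q n 2 b.

(** 2^98 exceeds 256^54 divided by the product of the 54 primes below 256; one more factor 2 comes
    from M <= 2 q^(n - 1). *)
Lemma primes_bound : (2 ^ (8 * size (primes M)) <= 2 ^ 99 * q ^ n.-1)%N.
Proof.
have TC : (256 ^ size (map N.to_nat small_primes) <= 2 ^ 98 * \prod_(d <- map N.to_nat small_primes) d)%N.
  have : (256 ^ N.of_nat (size small_primes) <=? 2 ^ 98 * foldr N.mul 1 small_primes)%num by vm_compute.
  rewrite to_nat_leb to_nat_mul !to_nat_pow Nat2N.id size_map big_map.
  suff -> : N.to_nat (foldr N.mul 1%num small_primes) = (\prod_(j <- small_primes) N.to_nat j)%N by [].
  by elim: small_primes => [|a l IH]; rewrite ?big_nil // big_cons /= to_nat_mul IH.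
have DT : all (fun d => d <= 256)%N (map N.to_nat small_primes) by vm_compute.
have D0 : all (fun d => 0 < d)%N (map N.to_nat small_primes) by vm_compute.
have := number_of_primes n5 cardL DT TC D0 (fun p pp _ => small_primesP pp).
have gen c s x : ((2 ^ 8) ^ s <= 2 ^ c * (2 * x) -> 2 ^ (8 * s) <= 2 ^ c.+1 * x)%N.
  by rewrite -expnM mulnA -expnSr.
have -> : 256%N = (2 ^ 8)%N by [].
exact: (gen 98%N).
Qed.

(** The condition of [mode1_all_primes] raised to the fourth power, with [primes_bound] inserted.
    For n = 5 the exponent 3 n - 15 is 0, which forces the separate treatment of that degree. *)
Lemma good_mode1 : (2 * (n - 2) <= q)%N -> (2 ^ 99 * (2 * n.-1) ^ 8 <= q ^ (3 * n - 15))%N -> good.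
Proof.
move=> nq h; apply: (mode1_all_primes iota n5 cardL D2f sD2 nq).
rewrite -(@leq_exp2r _ _ 4) // -!expnM -/q -/M.
have := primes_bound; move: (size (primes M)) => s hs.
have -> : (2 * 2 ^ s * n.-1 = 2 ^ s * (2 * n.-1))%N by rewrite mulnAC [RHS]mulnC.
rewrite expnMn -expnM; apply: leq_trans (_ : 2 ^ 99 * q ^ n.-1 * (2 * n.-1) ^ 8 <= _)%N.
  by rewrite [(s * _)%N]mulnC leq_mul2r hs orbT.
have -> : ((n - 4) * 4 = (3 * n - 15) + n.-1)%N by move: n5; clear; lia.
by rewrite expnD mulnAC leq_mul2r h orbT.
Qed.

Lemma good_mode2 : (2 ^ 719 <= q ^ (7 * n - 59))%N -> (9 <= n)%N -> good.
Proof.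
move=> h n9; apply: (mode2_all_primes iota n5 cardL D2f sD2 (c := 99) (w := 28) primes_bound).
- exact: h.
- by move: n9; clear; lia.
move=> rs rsP rsC; rewrite -(big_map (fun r : {poly F} => (size r).-1) predT (fun d => 2%:R / (1 - q%:R ^- d))).
apply: (omega_power_bound q1 (omega_tableP q1)).
- exact: degrees_gt0 rsP.
- by apply: (degrees_sum _ D2f sD2 rsP rsC).
move=> e e0; have f_dvd : f %| 'X^n - 1 by rewrite -D2f dvdp_mull.
have n0 : (0 < n)%N by apply: leq_trans n5.
have f0 : f != 0 by apply/eqP => f0; move: (@Xn1_neq0 F n n0); rewrite -D2f f0 mulr0 eqxx.
have := degree_count n0 f_dvd rsP rsC e0; rewrite count_map => h'.
apply: leq_trans h' _; apply: dvdn_leq; last exact: dvdn_gcdr.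
by rewrite subn_gt0 -(expn0 q) ltn_exp2l.
Qed.

Lemma good_individual : individual_test (N.of_nat q) (N.of_nat n) -> good.
Proof.
rewrite /individual_test; set qN := N.of_nat q; set nN := N.of_nat n.
have qE : N.to_nat qN = q by rewrite Nat2N.id.
have nE : N.to_nat nN = n by rewrite Nat2N.id.
set MN := (_ / _)%num; set D := [seq p <- _ | _]; set B := foldl _ _ _; set Q := (qN ^ _)%num.
have ME : N.to_nat MN = M.
  rewrite !to_natE qE nE; have := proj_orderE cardL; rewrite cardL -/q -/M subn1 => ->.
  by rewrite subn1 mulnK // -ltnS prednK // ltnW.
have QE : (N.to_nat Q <= q ^ (n - 4))%N by rewrite !to_natE qE nE.
have [_ BE] : (0 < N.to_nat B)%N /\ primes (N.to_nat B) = primes (N.to_nat MN) by apply: stripP; rewrite ME.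
have B0 : (0 < N.to_nat B)%N by have [] := @stripP MN D; rewrite ?ME.
have MB : (\prod_(p <- primes M) p <= N.to_nat B)%N by rewrite -ME -BE prod_primes_le.
have DM p : prime p -> (p %| M)%N -> (p < N.to_nat 256)%N -> p \in map N.to_nat D.
  move=> pp pM p256; have /mapP [r rs pr] := small_primesP pp p256.
  by apply/mapP; exists r => //; rewrite mem_filter rs andbT to_nat_eqb to_nat_mod ME -pr.
have s0 : sorted ltn (map N.to_nat small_primes) by vm_compute.
have sD : sorted ltn (map N.to_nat D).
  by apply: (subseq_sorted ltn_trans _ s0); apply: map_subseq; apply: filter_subseq.
have a0 : all (fun d => 0 < d < N.to_nat 256)%N (map N.to_nat small_primes) by vm_compute.
have aD : all (fun d => 0 < d < N.to_nat 256)%N (map N.to_nat D).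
  by apply/allP => d /mapP [r]; rewrite mem_filter => /andP [_ rs] ->; apply: (allP a0); apply: map_f.
have T0 : (0 < N.to_nat 256)%N by [].
case: ifP => [h _|_ h].
  apply: (test1_sound iota n5 cardL D2f sD2 sD aD DM MB T0 QE _ h).
  by rewrite sigma_NE omega_NE qE nE !leqnn.
exact: (test2_sound iota n5 cardL D2f sD2 sD aD DM MB T0 qE nE QE h).
Qed.

Lemma good_range (T : N) (D : seq N) j : sorted ltn (map N.to_nat D) ->
  all (fun d => 0 < d < N.to_nat T)%N (map N.to_nat D) -> (0 < N.to_nat T)%N ->
  (forall p, prime p -> (p %| M)%N -> (p < N.to_nat T)%N -> p \in map N.to_nat D) ->
  (2 ^ j <= q < 2 ^ j.+1)%N -> range_test T D (N.of_nat n) (N.of_nat j) -> good.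
Proof.
move=> sD aD T0 DM /andP [q2 q3]; rewrite /range_test; set B := (2 ^ (_ + 1))%num => h.
have MB : (\prod_(p <- primes M) p <= N.to_nat B)%N.
  apply: leq_trans (prod_primes_le M_gt0) _; apply: leq_trans (proj_order_le n5 cardL) _; rewrite -/q.
  rewrite !to_natE !Nat2N.id addn1 expnS leq_mul2l expnM subn1 addn1 /=.
  by move: n5; case: (n.-1) => // m _; rewrite leq_exp2r // ltnW.
apply: (test1_sound iota n5 cardL D2f sD2 sD aD DM MB T0 _ _ h).
  rewrite !to_natE !Nat2N.id expnM; case: (n - _)%N => // m; by rewrite leq_exp2r.
move: scale => S; rewrite !to_natE !Nat2N.id leqnn andbT; apply/orP; right.
by rewrite leq_mul2l; apply/orP; right; rewrite leq_add2r leq_div2l // expn_gt0.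
Qed.

(** Only 23 primes below 512 can divide M, so that 512^w <= 2^44 q^4 for the number w of primes. The
    gain from 2^8 to 2^9 leaves one power of q: after raising to the ninth power the condition
    becomes 2^(54 + 2 * 44) <= q. *)
Lemma good_quintic : n = 5%N -> (2 ^ 142 <= q)%N -> good.
Proof.
move=> nE hq; have D512 : [/\ all (fun d => d <= 512)%N (map N.to_nat quintic_primes512),
  all (fun d => 0 < d)%N (map N.to_nat quintic_primes512) & size (map N.to_nat quintic_primes512) = 23] by vm_compute.
have [DT D0 szD] := D512.
have TC : (512 ^ size (map N.to_nat quintic_primes512) <= 2 ^ 43 * \prod_(d <- map N.to_nat quintic_primes512) d)%N.
  have : (512 ^ N.of_nat (size quintic_primes512) <=? 2 ^ 43 * foldr N.mul 1 quintic_primes512)%num by vm_compute.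
  rewrite to_nat_leb to_nat_mul !to_nat_pow Nat2N.id size_map big_map.
  suff -> : N.to_nat (foldr N.mul 1%num quintic_primes512) = (\prod_(j <- quintic_primes512) N.to_nat j)%N by [].
  by elim: quintic_primes512 => [|a l IH]; rewrite ?big_nil // big_cons /= to_nat_mul IH.
have DM p : prime p -> (p %| M)%N -> (p < 512)%N -> p \in map N.to_nat quintic_primes512.
  by move=> pp pM; apply: (quintic_primesP (q := q) pp); rewrite /M nE in pM.
have := number_of_primes n5 cardL DT TC D0 DM.
rewrite -/q -/M nE; move: (size (primes M)) (mode1_all_primes iota n5 cardL D2f sD2) => s h1.
move/quintic_arith => /(_ hq) h2; apply: h1; rewrite nE; last exact: h2.
by apply: leq_trans (_ : 2 ^ 3 <= _)%N => //; exact: (@pow2_le 3 142).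
Qed.

Let pp_q : exists p e, [/\ prime p, (0 < e)%N & q = (p ^ e)%N].
Proof. by have [p [e [pc e0 qE]]] := finField_card_pX F; exists p, e; split=> //; apply: pcharf_prime pc. Qed.

Lemma good_grid (nN bN : N) : (nN, bN) \in grid -> N.to_nat nN = n -> (q < N.to_nat bN)%N -> (q < 2 ^ 9)%N ->
  gcdn (q ^ 3 - q) n != 1%N -> good \/ (N.of_nat q, N.of_nat n) \in exceptions.
Proof.
move=> g nE qb q512 gc; have := allP grid_tested _ g.
have qi : N.of_nat q \in map N.of_nat (seq.iota 2 510) by apply: map_f; rewrite mem_iota q1.
move/allP => /(_ _ qi) /=; rewrite to_nat_leb Nat2N.id leqNgt qb /= /grid_test.
have log r : (0 < r)%N -> log_test (N.of_nat r) nN (N.of_nat q) -> good.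
  move=> r0; rewrite /log_test; case: ifP => // h20 h.
  apply: good_mode2; last by move: h20; rewrite to_nat_ltb nE; clear; move: n => m h; apply: leq_trans h.
  apply: (exp2_log_le (r := r)) => //; first exact: ltnW.
  have -> : N.of_nat (7 * n - 59) = (7 * nN - 59)%num by move: nE; clear; lia.
  exact: h.
case: ifP => [h _|_]; first by left; apply: (log 1%N).
case: ifP => [h|_].
  by move: h gc; rewrite to_nat_eqb to_nat_gcd to_nat_sub to_nat_pow nE !Nat2N.id => ->.
case: ifP => [/negP []|_].
  have [p [e [pp e0 qE]]] := pp_q; apply: (prime_power_testP small_primes_prime pp e0); last by rewrite Nat2N.id.
  apply: (@leq_trans 9) => //; rewrite -(@leq_exp2l 2) //; apply: leq_trans (ltnW q512).
  by rewrite qE leq_exp2r // prime_gt1.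
case: ifP => [h _|_]; first by left; apply: (log 16%N).
case: ifP => [h _|_ h]; first by right; rewrite -nE N2Nat.id.
by left; apply: good_individual; rewrite -nE N2Nat.id.
Qed.

Lemma small_sorted : [/\ sorted ltn (map N.to_nat small_primes),
  all (fun d => 0 < d < N.to_nat 256)%N (map N.to_nat small_primes),
  sorted ltn (map N.to_nat quintic_primes) & all (fun d => 0 < d < N.to_nat 256)%N (map N.to_nat quintic_primes)].
Proof. by vm_compute. Qed.

Lemma good_small_range j : (2 ^ j <= q < 2 ^ j.+1)%N -> range_test 256 small_primes (N.of_nat n) (N.of_nat j) -> good.
Proof.
have [s1 a1 _ _] := small_sorted; apply: good_range => // p pp _; exact: small_primesP.
Qed.

Lemma good_quintic_range j : n = 5%N -> (2 ^ j <= q < 2 ^ j.+1)%N -> range_test 256 quintic_primes 5 (N.of_nat j) -> good.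
Proof.
move=> nE hj h; have [_ _ s1 a1] := small_sorted.
apply: (good_range s1 a1 _ _ hj) => [|p pp pM|]; rewrite ?nE //.
by apply: (quintic_primes256P (q := q) pp); rewrite /M nE in pM.
Qed.

Lemma range_dispatch (D : seq N) lo len : (2 ^ lo <= q < 2 ^ (lo + len))%N ->
  all (range_test 256 D (N.of_nat n)) (map N.of_nat (seq.iota lo len)) ->
  exists2 j, (2 ^ j <= q < 2 ^ j.+1)%N & range_test 256 D (N.of_nat n) (N.of_nat j).
Proof.
move=> /andP [h1 h2] /allP t; have [j jin jq] := dyadic_range h1 h2.
by exists j => //; apply: t; apply: map_f.
Qed.

Lemma power_large a k m : (2 ^ a <= q)%N -> (m <= 2 ^ (a * k))%N -> (m <= q ^ k)%N.
Proof. by move=> h1 h2; apply: leq_trans h2 _; rewrite expnM; case: k => // k; rewrite leq_exp2r. Qed.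

Lemma criterion_or_exception : gcdn (q ^ 3 - q) n != 1%N ->
  good \/ (N.of_nat q, N.of_nat n) \in exceptions.
Proof.
move=> gc; have [n5'|n6] := eqVneq n 5%N.
  have [q9|q9] := ltnP q (2 ^ 9); first exact: (@good_grid 5 512 isT (esym n5') q9 q9 gc).
  have [q144|q144] := ltnP q (2 ^ 144); last first.
    left; apply: (good_quintic n5'); exact: (@pow2_le 142 144).
  left; have [||j jq jt] := @range_dispatch quintic_primes 9 135; [by rewrite q9|by rewrite n5'; exact: range5_tested|].
  by apply: (good_quintic_range n5' jq); move: jt; rewrite n5'.
have [n6'|n7] := eqVneq n 6%N.
  have [q9|q9] := ltnP q (2 ^ 9); first exact: (@good_grid 6 512 isT (esym n6') q9 q9 gc).
  have [q46|q46] := ltnP q (2 ^ 46); last first.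
    left; apply: good_mode1; rewrite n6'; first exact: (@pow2_le 3 46).
    apply: (power_large q46); apply: leq_trans (_ : 2 ^ 99 * (2 ^ 4) ^ 8 <= _)%N; first by rewrite leq_mul2l leq_exp2r ?orbT.
    by rewrite -expnM -expnD leq_exp2l.
  left; have [||j jq jt] := @range_dispatch small_primes 9 37; [by rewrite q9|by rewrite n6'; exact: range6_tested|].
  by apply: (good_small_range jq jt).
have [n21|n20] := leqP 21 n.
  have [qn|qn] := leqP (2 * (n - 2)) q.
    left; apply: good_mode1 => //.
    have q32 : (2 ^ 5 <= q)%N by apply: leq_trans qn; move: n21; clear; rewrite -[(2 ^ 5)%N]/32%N; lia.
    have -> : (3 * n - 15 = 8 + (3 * n - 23))%N by move: n21; clear; lia.
    rewrite expnD; apply: leq_trans (_ : 2 ^ 99 * (2 ^ 1 * q) ^ 8 <= _)%N.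
      rewrite leq_mul2l leq_exp2r // leq_mul2l; apply/orP; right; apply/orP; right.
      by move: qn n21; clear; lia.
    have gen a k : (2 ^ (a + 8) <= q ^ k -> 2 ^ a * (2 ^ 1 * q) ^ 8 <= q ^ 8 * q ^ k)%N.
      by move=> h; rewrite expnMn mulnA -expnM -expnD mulnC leq_mul2l h orbT.
    apply: gen; apply: (power_large q32); rewrite leq_exp2l //; move: n21; clear; lia.
  (* 7 * 112 - 59 = 725 >= 719, so q >= 2 is enough here. *)
  have [n112|n111] := leqP 112 n.
    left; apply: good_mode2; last exact: leq_trans n21.
    by apply: (@power_large 1 (7 * n - 59)) => //; rewrite leq_exp2l //; move: n112; clear; lia.
  apply: (@good_grid (N.of_nat n) (2 * (N.of_nat n - 2))%num) => //; rewrite ?Nat2N.id //.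
  - rewrite /grid !mem_cat; apply/orP; right; apply/orP; right; apply/mapP; exists (N.of_nat n) => //.
    by apply: map_f; rewrite mem_iota n21.
  - by rewrite to_nat_mul to_nat_sub Nat2N.id.
  - by apply: leq_trans qn _; move: n111; clear; lia.
have n7' : (7 <= n)%N by move: n5 n6 n7; clear; lia.
(* The exponent 3 n - 15 is at least 6, 2 (n - 1) is below 2^6, and 99 + 6 * 8 <= 25 * 6. *)
have large : (2 ^ 25 <= q)%N -> good.
  move=> q24; apply: good_mode1.
    apply: leq_trans q24; apply: leq_trans (_ : 2 ^ 6 <= _)%N; last by rewrite leq_exp2l.
    by move: n20; clear; rewrite -[(2 ^ 6)%N]/64%N; lia.
  apply: (power_large q24); apply: leq_trans (_ : 2 ^ 99 * (2 ^ 6) ^ 8 <= _)%N.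
    by rewrite leq_mul2l leq_exp2r //; apply/orP; right; move: n20; clear; rewrite -[(2 ^ 6)%N]/64%N; lia.
  rewrite -expnM -expnD leq_exp2l //; move: n7'; clear; lia.
have up a b : (a <= b)%N -> (q < 2 ^ a)%N -> (q < 2 ^ b)%N by move=> ab h; apply: leq_trans h _; rewrite leq_exp2l.
have [q24|q24] := ltnP q (2 ^ 25); last by left; apply: large.
have [nE|n8] := eqVneq n 7%N.
  have [q6|q6] := ltnP q (2 ^ 6); first exact: (@good_grid 7 64 isT (esym nE) q6 (@up 6 9 isT q6) gc).
  left; have [||j jq jt] := @range_dispatch small_primes 6 19; last exact: (good_small_range jq jt).
    by rewrite q6; exact: (@up 25 (6 + 19)).
  by rewrite nE; exact: range7_tested.
have nI : n \in seq.iota 8 13 by rewrite mem_iota; move: n7' n8 n20; clear; lia.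
have [q5|q5] := ltnP q (2 ^ 5).
  apply: (@good_grid (N.of_nat n) 32) => //; last exact: (@up 5 9).
    rewrite /grid !mem_cat; apply/orP; right; apply/orP; left; apply/mapP; exists (N.of_nat n) => //.
    exact: map_f.
  by rewrite Nat2N.id.
left; have [||j jq jt] := @range_dispatch small_primes 5 20; last exact: (good_small_range jq jt).
  by rewrite q5; exact: (@up 25 (5 + 20)).
by apply: (allP range20_tested); apply: map_f.
Qed.
End Dichotomy.

(** * Explicit elements *)

(* A list u stands for the polynomial sum u_i x^i modulo p and x^m = sum r_i x^i; the entries
   are reduced modulo p only now and then. *)
Section ListArithmetic.
Variables (p : N) (m : nat) (r : seq N).

Fixpoint axpy (c : N) (u v : seq N) : seq N :=
  match u, v with
  | a :: u', b :: v' => (c * a + b)%num :: axpy c u' v'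
  | [::], _ => v
  | _, [::] => [seq (c * a)%num | a <- u]
  end.

Definition scaled_add (c : N) (u v : seq N) : seq N := if (c =? 0)%num then v else axpy c u v.

Definition reduce (u : seq N) : seq N := [seq (a mod p)%num | a <- u].

Definition times_x (u : seq N) : seq N :=
  let v := 0%num :: u in
  if drop m v is [:: t] then scaled_add (t mod p)%num r (take m v) else v.

Definition mulx (u v : seq N) : seq N :=
  reduce (foldr (fun c acc => scaled_add c v (times_x acc)) [::] u).

Definition convolve (u v : seq N) : seq N := foldr (fun c acc => scaled_add c v (0%num :: acc)) [::] u.

Definition subx (u v : seq N) : seq N := reduce (axpy (p - 1)%num v u).

Fixpoint powx (u : seq N) (e : positive) : seq N :=
  match e with
  | xH => u
  | xO e' => let t := powx u e' in mulx t t
  | xI e' => let t := powx u e' in mulx u (mulx t t)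
  end.

Definition expx (u : seq N) (e : N) : seq N := if e is Npos e' then powx u e' else [:: 1%num].

Definition zerox (u : seq N) : bool := all (fun a => (a mod p =? 0)%num) u.

Variables (A : comNzRingType) (x : A).
Hypothesis pA : (N.to_nat p)%:R = 0 :> A.
Hypothesis p1 : (1 < N.to_nat p)%N.

Definition evx (u : seq N) : A := foldr (fun a s => (N.to_nat a)%:R + x * s) 0 u.

Hypothesis xm : x ^+ m = evx r.

Lemma to_nat_mod_ring a : (N.to_nat (a mod p))%:R = (N.to_nat a)%:R :> A.
Proof.
have p0 : (p <> 0)%num by move=> p0; move: p1; rewrite p0.
by have [E _] := to_nat_divmod a p0; rewrite [in RHS]E natrD natrM pA mulr0 add0r.
Qed.

Lemma evx_axpy c u v : evx (axpy c u v) = (N.to_nat c)%:R * evx u + evx v.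
Proof.
elim: u v => [|a u IH] [|b v] /=; rewrite ?mulr0 ?add0r ?addr0 //.
  have -> : evx [seq (c * a)%num | a <- u] = (N.to_nat c)%:R * evx u.
    by elim: (u) => [|d w IHw] /=; rewrite ?mulr0 // IHw to_nat_mul natrM; ring.
  by rewrite to_nat_mul natrM; ring.
by rewrite IH to_nat_add to_nat_mul natrD natrM; ring.
Qed.

Lemma evx_scaled_add c u v : evx (scaled_add c u v) = (N.to_nat c)%:R * evx u + evx v.
Proof.
rewrite /scaled_add; case: ifP => [/N.eqb_eq ->|_]; last exact: evx_axpy.
by rewrite mul0r add0r.
Qed.

Lemma evx_reduce u : evx (reduce u) = evx u.
Proof. by elim: u => //= a u ->; rewrite to_nat_mod_ring. Qed.

Lemma evx_cat u v : evx (u ++ v) = evx u + x ^+ size u * evx v.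
Proof. by elim: u => [|a u IH] /=; rewrite ?mul1r ?add0r // IH exprS; ring. Qed.

Lemma evx_times_x u : evx (times_x u) = x * evx u.
Proof.
have E : evx (0%num :: u) = x * evx u by rewrite /= add0r.
rewrite /times_x -E; set v := _ :: u.
case d : (drop m v) => [|t [|t' l]] //.
rewrite evx_scaled_add to_nat_mod_ring -[in RHS](cat_take_drop m v) evx_cat d.
have sm : (m < size v)%N by rewrite -subn_gt0 -size_drop d.
by rewrite size_take sm xm /= mulr0 addr0 addrC mulrC.
Qed.

Lemma evx_mul u v : evx (mulx u v) = evx u * evx v.
Proof.
rewrite /mulx evx_reduce; elim: u => [|a u IH] /=; first by rewrite mul0r.
by rewrite evx_scaled_add evx_times_x IH; ring.
Qed.

Lemma evx_convolve u v : evx (convolve u v) = evx u * evx v.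
Proof.
by elim: u => [|a u IH]; rewrite /= ?mul0r // evx_scaled_add /= IH; ring.
Qed.

Lemma evx_sub u v : evx (subx u v) = evx u - evx v.
Proof.
rewrite /subx evx_reduce evx_axpy to_nat_sub natrB ?(ltnW p1) // pA sub0r mulN1r; ring.
Qed.

Lemma evx_pow u e : evx (powx u e) = evx u ^+ N.to_nat (Npos e).
Proof.
elim: e => [e IH|e IH|]; last by rewrite expr1.
  have -> : N.to_nat (Npos (xI e)) = (N.to_nat (Npos e) + N.to_nat (Npos e)).+1%N by lia.
  by rewrite exprS exprD -IH -!evx_mul.
have -> : N.to_nat (Npos (xO e)) = (N.to_nat (Npos e) + N.to_nat (Npos e))%N by lia.
by rewrite exprD -IH -!evx_mul.
Qed.

Lemma evx_exp u e : evx (expx u e) = evx u ^+ N.to_nat e.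
Proof. by case: e => [|e] /=; [rewrite mulr0 addr0 expr0|exact: evx_pow]. Qed.

Lemma zeroxP u : zerox u -> evx u = 0.
Proof.
elim: u => //= a u IH /andP [a0 /IH ->]; rewrite mulr0 addr0 -to_nat_mod_ring.
by move: a0; rewrite to_nat_eqb => /eqP ->.
Qed.

Lemma eqxP u v : zerox (subx u v) -> evx u = evx v.
Proof. by move/zeroxP; rewrite evx_sub => /eqP; rewrite subr_eq0 => /eqP. Qed.
End ListArithmetic.

(** * Trial division *)

Section TrialDivision.
Definition trial_step (s : N * N * seq N) : N * N * seq N :=
  let: (m, d, acc) := s in
  if (m <? d * d)%num then s
  else if (m mod d =? 0)%num then ((m / d)%num, d, d :: acc) else (m, if (d =? 2)%num then 3%num else (d + 2)%num, acc).

(* At most 2^k steps. *)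
Fixpoint trial_run k (s : N * N * seq N) : N * N * seq N :=
  if (s.1.1 <? s.1.2 * s.1.2)%num then s
  else if k is k'.+1 then trial_run k' (trial_run k' s) else trial_step s.

Definition trial_division (k : nat) (m : N) : option (seq N) :=
  let: (m', d, acc) := trial_run k (m, 2%num, [::]) in
  if (m' <? d * d)%num then Some (if (m' =? 1)%num then acc else m' :: acc) else None.

Let inv (m0 : nat) (s : N * N * seq N) : Prop :=
  [/\ (0 < N.to_nat s.1.1)%N, (s.1.2 = 2%num) \/ ((1 < N.to_nat s.1.2)%N /\ odd (N.to_nat s.1.2)),
   forall l, prime l -> (l %| N.to_nat s.1.1)%N -> (N.to_nat s.1.2 <= l)%N &
   forall l, prime l -> (l %| m0)%N -> (l %| N.to_nat s.1.1)%N \/ l \in map N.to_nat s.2].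

Let inv_gt1 m0 s : inv m0 s -> (1 < N.to_nat s.1.2)%N.
Proof. by case=> _ [->|[]]. Qed.

Let inv_step m0 s : inv m0 s -> inv m0 (trial_step s).
Proof.
move=> hs; have := inv_gt1 hs; case: s hs => [[m d] acc] [/= m_gt0 dp hd hm] d1; rewrite /trial_step; case: ifP => // _.
rewrite to_nat_eqb to_nat_mod; case: ifP => /= h.
  have md : (N.to_nat d %| N.to_nat m)%N by [].
  have d0 : (0 < N.to_nat d)%N by apply: ltnW.
  have mE : N.to_nat m = (N.to_nat (m / d) * N.to_nat d)%N by rewrite to_nat_div divnK.
  split => //=.
  - by move: m_gt0; rewrite mE muln_gt0 => /andP [].
  - by move=> l lp lm; apply: hd => //; rewrite mE dvdn_mulr.
  move=> l lp lm; rewrite inE; case: (hm l lp lm) => [|h']; last by right; rewrite h' orbT.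
  rewrite mE Euclid_dvdM // => /orP [|ld]; [by left|right].
  by rewrite eqn_leq (dvdn_leq d0 ld) hd // (dvdn_trans ld).
have next l : prime l -> (l %| N.to_nat m)%N -> (N.to_nat d < l)%N.
  by move=> lp lm; rewrite ltn_neqAle hd // andbT; apply: contraFneq h => ->.
case: ifP => [/N.eqb_eq d2|d2] /=.
  split => //=; first by right.
  by move=> l lp lm; have := next l lp lm; rewrite d2.
have dodd : odd (N.to_nat d) by case: dp => [dE|[]] //; rewrite dE in d2.
split => //=; first by right; rewrite to_nat_add oddD dodd; split=> //; apply: leq_trans d1 (leq_addr _ _).
move=> l lp lm; rewrite to_nat_add addn2 ltn_neqAle next // andbT; apply/eqP => lE.
have le : ~~ odd l by rewrite -lE /= dodd.
by case: (even_prime lp) => l2; [move: (next l lp lm); rewrite l2 ltnNge d1|rewrite l2 in le].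
Qed.

Let inv_run m0 k s : inv m0 s -> inv m0 (trial_run k s).
Proof.
elim: k s => [|k IH] s hs /=; case: ifP => // _; first exact: inv_step.
exact: (IH _ (IH _ hs)).
Qed.

(** At the end m' < d^2 and no prime below d divides m', so a prime dividing m' is m' itself. *)
Lemma trial_divisionP k m ls l : (0 < N.to_nat m)%N -> trial_division k m = Some ls ->
  prime l -> (l %| N.to_nat m)%N -> l \in map N.to_nat ls.
Proof.
move=> m0; rewrite /trial_division; have : inv (N.to_nat m) (m, 2%num, [::]).
  by split=> //= [|l' /prime_gt1|l' _]; [left| |left].
move/(inv_run k) => hs; have := inv_gt1 hs; case: (trial_run k _) hs => [[m' d] acc] [/= m'0 _ hd hm] d1.
case: ifP => // lt [<-] lp lm.
case: (hm l lp lm) => h; last by case: ifP => //=; rewrite inE h orbT.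
have lE : l = N.to_nat m'.
  have /dvdnP [c cE] := h; have dl := hd l lp h.
  have [c1|c1] := leqP c 1.
    by move: m'0; rewrite cE; case: c c1 {cE} => [|[|]] // _ _; rewrite mul1n.
  have dp : (N.to_nat d <= pdiv c)%N.
    by apply: hd; [exact: pdiv_prime|rewrite cE dvdn_mulr // pdiv_dvd].
  have dc : (N.to_nat d <= c)%N by apply: leq_trans dp _; apply: dvdn_leq (pdiv_dvd c); apply: ltnW.
  by move: lt; rewrite to_nat_ltb to_nat_mul cE ltnNge leq_mul.
case: ifP => [/N.eqb_eq m1|_] /=; last by rewrite inE lE eqxx.
by move: lp; rewrite lE m1.
Qed.
End TrialDivision.

(** * Certificates for explicit elements *)

Section Bezout.
Variables (F L : finFieldType) (n : nat).
Hypothesis cardL : #|L| = (#|F| ^ n)%N.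
Let q := #|F|.

Lemma k_normal_bezout k (a : L) (B D : {poly L}) : size D = k.+1 -> D %| 'X^n - 1 -> D %| g_poly q n a ->
  ('X^n - 1) %| B * g_poly q n a - D -> k_normal q n k a.
Proof.
move=> sD D1 D2 h; have Dg : gcdp ('X^n - 1) (g_poly q n a) %= D.
  rewrite /eqp dvdp_gcd D1 D2 andbT.
  have -> : D = B * g_poly q n a - (B * g_poly q n a - D) by rewrite opprB addrC subrK.
  by rewrite dvdp_sub ?dvdp_mull ?dvdp_gcdr // (dvdp_trans (dvdp_gcdl _ _)).
by rewrite /k_normal (eqp_size Dg) sD.
Qed.

Lemma g_poly_mulXn (a : L) i : ('X^n - 1) %| 'X^i * g_poly q n a - g_poly q n (a ^+ (q ^ i)).
Proof.
elim: i => [|i IH]; first by rewrite expr0 mul1r expr1 subrr dvdp0.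
have E := g_poly_mulX cardL (a ^+ (q ^ i)).
rewrite -exprM -expnSr -/q in E.
have -> : 'X^(i.+1) * g_poly q n a - g_poly q n (a ^+ (q ^ i.+1)) =
  'X * ('X^i * g_poly q n a - g_poly q n (a ^+ (q ^ i))) + a ^+ (q ^ i) *: ('X^n - 1).
  by rewrite mulrBr E exprS; move: (g_poly q n _) (_ *: _) => t u; ring.
by rewrite -mul_polyC dvdp_add // dvdp_mull.
Qed.

(** Modulo X^n - 1, multiplying g by X^i replaces a by its i-th conjugate. *)
Lemma conjugate_combination (a b : L) :
  ('X^n - 1) %| (\sum_(i < n) b ^+ (q ^ i) *: 'X^i) * g_poly q n a -
     \sum_(j < n) (\sum_(i < n) b ^+ (q ^ i) * a ^+ (q ^ (i + j))) *: 'X^(n.-1 - j).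
Proof.
have -> : \sum_(j < n) (\sum_(i < n) b ^+ (q ^ i) * a ^+ (q ^ (i + j))) *: 'X^(n.-1 - j) =
   \sum_(i < n) b ^+ (q ^ i) *: g_poly q n (a ^+ (q ^ i)) :> {poly L}.
  under eq_bigr => j _ do rewrite scaler_suml.
  rewrite exchange_big; apply: eq_bigr => i _; rewrite scaler_sumr; apply: eq_bigr => j _.
  by rewrite scalerA -exprM -expnD.
rewrite mulr_suml -sumrB; apply: (big_ind (fun t => 'X^n - 1 %| t)) => [|u v|i _]; [exact: dvdp0|exact: dvdp_add|].
by rewrite -scalerAl -scalerBr -mul_polyC dvdp_mull // g_poly_mulXn.
Qed.
End Bezout.

Fixpoint digits (k : nat) (p c : N) : seq N :=
  if k is k'.+1 then (c mod p)%num :: digits k' p (c / p)%num else [::].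

Section Certificate.
Variables (q p : N) (n m : nat) (r b : seq N).
Local Notation mul := (mulx p m r).
Local Notation sub := (subx p).
Local Notation zero := (zerox p).
Local Notation exp := (expx p m r).
Let x : seq N := [:: 0; 1]%num.

Definition frobenius_list (u : seq N) : seq (seq N) := traject (fun v => exp v q) u n.

(* The products are reduced modulo x^m = sum r_i x^i only after summation. *)
Definition dot (us vs : seq (seq N)) : seq N :=
  mulx p m r (foldr (fun uv acc => axpy 1%num (convolve uv.1 uv.2) acc) [::] (zip us vs)) [:: 1%num].

Definition quadratic_rem (c1 c0 : seq N) (ts : seq (seq N)) : seq N * seq N :=
  foldl (fun uv t => (sub uv.2 (mul c1 uv.1), sub t (mul c0 uv.1))) ([::], [::]) ts.

Definition quadratic_dvd c1 c0 ts : bool :=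
  let uv := quadratic_rem c1 c0 ts in if zero uv.1 then zero uv.2 else false.

(* With B = sum b^(q^i) X^i and g = g_poly q n x, the coefficients of B g modulo X^n - 1 are the dot
   products below. If it equals D = X^2 + c1 X + c0 and D divides both g and X^n - 1, then D is their gcd. *)
Definition normal_certificate : bool :=
  let fa := frobenius_list x in let fb := frobenius_list b in let fa2 := fa ++ fa in
  let c1 := dot fb (drop (n - 2) fa2) in let c0 := dot fb (drop (n - 1) fa2) in
  if ~~ all (fun j => zero (dot fb (drop j fa2))) (iota 0 (n - 3)) then false else
  if ~~ zero (sub (dot fb (drop (n - 3) fa2)) [:: 1%num]) then false else
  if ~~ quadratic_dvd c1 c0 fa then false else
  quadratic_dvd c1 c0 ([:: 1%num] :: nseq (n - 1) [::] ++ [:: [:: (p - 1)%num]]).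

Definition prod_N (ls : seq N) : N := foldr N.mul 1%num ls.

(* The powers u^(M / l) for l in ls, where M is the product of ls. *)
Fixpoint cofactor_powers (k : nat) (u : seq N) (ls : seq N) : seq (seq N) :=
  if k is k'.+1 then
    let l1 := take (size ls)./2 ls in let l2 := drop (size ls)./2 ls in
    cofactor_powers k' (exp u (prod_N l2)) l1 ++ cofactor_powers k' (exp u (prod_N l1)) l2
  else [seq exp u (prod_N ls / l)%num | l <- ls].

(** x^(q - 1) has order M as soon as none of its powers with exponent M / l is 1. All these
    conditions are checked at once: U is the product of the differences from 1, and U^(q^n - 1) = 1
    shows that U is not 0. *)
Definition generator_certificate : bool :=
  let Q := (q ^ N.of_nat n - 1)%num in let M := (Q / (q - 1))%num in
  if trial_division 20 M is Some ls then
    if ~~ (prod_N ls =? M)%num then false else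
    let us := cofactor_powers 3 (exp x (q - 1)%num) ls in
    let U := foldr (fun u acc => mul acc (sub u [:: 1%num])) [:: 1%num] us in
    zero (sub (exp U Q) [:: 1%num])
  else false.

Definition certificate : bool :=
  if ~~ (p ^ N.of_nat m =? q ^ N.of_nat n)%num then false else
  if ~~ (size r == m) then false else
  if ~~ zero (sub (exp x (q ^ N.of_nat n)%num) x) then false else
  if ~~ normal_certificate then false else generator_certificate.
End Certificate.

(* (q, n, p, m, r, b) with q^n = p^m: the field is F_p[x] modulo x^m - r, where r and b are encoded by
   their base p digits, and x is the element, up to a factor in F. *)
Definition certified (c : N * N * N * N * N * N) : bool :=
  let: (q, n, p, m, r, b) := c in
  certificate q p (N.to_nat n) (N.to_nat m) (digits (N.to_nat m) p r) (digits (N.to_nat m) p b).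

Definition certificates : seq (N * N * N * N * N * N) := [::
  (4, 5, 2, 10, 649, 23); (5, 5, 5, 5, 452, 1340); (9, 5, 3, 10, 30452, 996); (11, 5, 11, 5, 53502, 73251);
  (16, 5, 2, 20, 523741, 10); (19, 5, 19, 5, 2232544, 1824840); (25, 5, 5, 10, 1074304, 22340);
  (31, 5, 31, 5, 14875340, 895677); (41, 5, 41, 5, 96463057, 1909627); (59, 5, 59, 5, 373267175, 302937105);
  (61, 5, 61, 5, 275730106, 69230345); (64, 5, 2, 30, 841483199, 394236); (71, 5, 71, 5, 15794704, 8955869);
  (81, 5, 3, 20, 3243862481, 403468); (101, 5, 101, 5, 3624301807, 83250431); (121, 5, 11, 10, 24665567922, 825131);
  (131, 5, 131, 5, 142357450, 11823274); (151, 5, 151, 5, 161750802, 336897006);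
  (181, 5, 181, 5, 30988509867, 567453318); (191, 5, 191, 5, 275723372, 1127514638);
  (251, 5, 251, 5, 115350804428, 1124441889); (256, 5, 2, 40, 485063059527, 24415310); (2, 6, 2, 6, 45, 32);
  (3, 6, 3, 6, 175, 489); (4, 6, 2, 12, 1817, 136); (5, 6, 5, 6, 10797, 9377); (7, 6, 7, 6, 23293, 899);
  (8, 6, 2, 18, 32765, 17620); (9, 6, 3, 12, 110767, 25923); (11, 6, 11, 6, 16569, 142681);
  (13, 6, 13, 6, 4091648, 4556); (16, 6, 2, 24, 6455757, 97640); (17, 6, 17, 6, 19564768, 52366);
  (19, 6, 19, 6, 10572262, 391287); (23, 6, 23, 6, 107304469, 38788734); (25, 6, 5, 12, 195953603, 459290);
  (29, 6, 29, 6, 574652160, 287305); (31, 6, 31, 6, 175943610, 112802); (37, 6, 37, 6, 167701743, 1834839);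
  (43, 6, 43, 6, 5128302, 30108729); (49, 6, 7, 12, 3772791318, 4374213); (61, 6, 61, 6, 27535324586, 4546998);
  (67, 6, 67, 6, 57729551704, 13510171); (79, 6, 79, 6, 3074233043, 147716754465);
  (109, 6, 109, 6, 5713306050, 10667557936); (8, 7, 2, 21, 1478301, 10470); (2, 8, 2, 8, 99, 36);
  (3, 8, 3, 8, 1714, 1791); (5, 8, 5, 8, 382668, 1124); (9, 8, 3, 16, 11707390, 110838); (2, 9, 2, 9, 353, 27);
  (4, 9, 2, 18, 17031, 10378); (2, 10, 2, 10, 455, 572); (3, 10, 3, 10, 9760, 8367);
  (11, 10, 11, 10, 19091969328, 17817519); (2, 12, 2, 12, 2511, 394); (3, 12, 3, 12, 163756, 368727);
  (4, 12, 2, 24, 6525735, 8561246); (5, 12, 5, 12, 19420868, 26685130); (7, 12, 7, 12, 1681740930, 102343486);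
  (13, 12, 13, 12, 17558295225503, 119538008209); (2, 14, 2, 14, 6147, 10852); (2, 15, 2, 15, 19477, 6201);
  (4, 15, 2, 30, 1017245423, 24907688); (2, 16, 2, 16, 29911, 3838); (3, 16, 3, 16, 1803424, 10286217);
  (2, 18, 2, 18, 228439, 102646); (2, 21, 2, 21, 1496851, 1104958); (2, 24, 2, 24, 13294365, 8624579);
  (5, 24, 5, 24, 5722473543694487, 10637410835147755); (5, 4, 5, 4, 292, 503); (9, 4, 3, 8, 3304, 216);
  (13, 4, 13, 4, 14292, 26373); (17, 4, 17, 4, 50633, 19662); (25, 4, 5, 8, 201083, 234629);
  (29, 4, 29, 4, 60172, 585358); (37, 4, 37, 4, 735358, 962428); (41, 4, 41, 4, 2087231, 2343317);
  (49, 4, 7, 8, 2449773, 9610); (53, 4, 53, 4, 278641, 7294995); (73, 4, 73, 4, 1913462, 7002376);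
  (89, 4, 89, 4, 24831787, 28198786); (97, 4, 97, 4, 62180361, 44721012); (101, 4, 101, 4, 61773807, 1030382);
  (109, 4, 109, 4, 42905798, 63456449); (113, 4, 113, 4, 86323681, 57715937); (125, 4, 5, 12, 132749542, 767);
  (137, 4, 137, 4, 104453211, 172280689); (149, 4, 149, 4, 89466115, 195169067);
  (157, 4, 157, 4, 567282262, 232193682); (173, 4, 173, 4, 806688162, 538482710);
  (197, 4, 197, 4, 536508222, 474013212); (233, 4, 233, 4, 1410993904, 961349646);
  (257, 4, 257, 4, 920841646, 2902655427); (269, 4, 269, 4, 5233676672, 311441852);
  (281, 4, 281, 4, 1992639062, 3771967150); (293, 4, 293, 4, 2985311317, 6539976933);
  (317, 4, 317, 4, 8498885868, 7231088072); (353, 4, 353, 4, 3092076595, 12624262593);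
  (389, 4, 389, 4, 8655626538, 20308035165); (401, 4, 401, 4, 10940376836, 4707128004);
  (461, 4, 461, 4, 12924113456, 34878096591); (509, 4, 509, 4, 28321150293, 32176823939);
  (557, 4, 557, 4, 75254849798, 75171781731); (569, 4, 569, 4, 45284138881, 99478805292);
  (593, 4, 593, 4, 92042321401, 60473078719); (797, 4, 797, 4, 300425430791, 360964501909);
  (857, 4, 857, 4, 328728100276, 342406000076); (1109, 4, 1109, 4, 46523588805, 848369454913);
  (1217, 4, 1217, 4, 438328604046, 2110710301653); (1637, 4, 1637, 4, 1071962876129, 2627682331373);
  (2309, 4, 2309, 4, 2869035628782, 26504268871760)]%num.

Lemma evx_morph (A B : comNzRingType) (j : {rmorphism A -> B}) (x : A) u : j (evx x u) = evx (j x) u.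
Proof. by elim: u => [|a u IH] /=; rewrite ?rmorph0 // rmorphD rmorphM rmorph_nat IH. Qed.

Lemma evx_widen (A : comNzRingType) (x : A) u : evx x u = (Poly [seq (N.to_nat a)%:R | a <- u]).[x].
Proof. by elim: u => [|a u IH]; rewrite /= ?horner0 // horner_cons IH addrC mulrC. Qed.

(** Modulo X^m - r the class x satisfies x^k = x with k = |L|, so every root of X^m - r in an
    algebraic closure of L is fixed by the Frobenius of L and lies in L. The identities checked on
    lists then specialise to this root, whether or not X^m - r is irreducible. *)
Lemma root_in_fixed_field (L : finFieldType) p m r k : (N.to_nat p)%:R = 0 :> L -> (1 < N.to_nat p)%N ->
  size r = m -> (0 < m)%N -> zerox p (subx p (expx p m r [:: 0; 1]%num k) [:: 0; 1]%num) -> N.to_nat k = #|L| ->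
  exists a : L, a ^+ m = evx a r.
Proof.
move=> pL p1 sr m0 hz kL; have [K [jL _]] := countable_algebraic_closure L.
have pK : (N.to_nat p)%:R = 0 :> K by rewrite -(rmorph_nat jL) pL rmorph0.
pose h : {poly K} := 'X^m - Poly [seq (N.to_nat a)%:R | a <- r].
have sh : size h = m.+1.
  rewrite /h size_polyDl ?size_polyXn // size_polyN ltnS -sr -(size_map (fun a => (N.to_nat a)%:R : K) r).
  exact: size_Poly.
have [|a] := closed_rootP h _; first by rewrite sh eqSS -lt0n.
rewrite rootE !hornerE -evx_widen subr_eq0 => /eqP am.
have ex : evx a [:: 0; 1]%num = a by rewrite /= mulr0 addr0 mulr1 add0r.
have := eqxP a pK p1 hz; rewrite (evx_exp pK p1 am) ex => aQ.
have [c ca] : exists c, jL c = a by apply/(frob_fixedP jL)/eqP; rewrite -kL.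
by exists c; apply: (fmorph_inj jL); rewrite rmorphXn ca am -ca evx_morph.
Qed.

Lemma k_normal_scale (F L : finFieldType) (iota : {rmorphism F -> L}) n k (c : F) (a : L) : c != 0 ->
  k_normal #|F| n k a -> k_normal #|F| n k (iota c * a).
Proof.
move=> c0; rewrite /k_normal g_polyZ => <-; congr _.-1; apply: eqp_size.
by apply: eqp_gcdr; rewrite eqp_scale // fmorph_eq0.
Qed.

Section CertificateSoundness.
Variables (F L : finFieldType) (iota : {rmorphism F -> L}).
Variables (q p : N) (n m : nat) (r b : seq N).
Hypothesis qE : N.to_nat q = #|F|.
Hypothesis n3 : (3 <= n)%N.
Hypothesis cardL : #|L| = (#|F| ^ n)%N.
Hypothesis pL : (N.to_nat p)%:R = 0 :> L.
Hypothesis p1 : (1 < N.to_nat p)%N.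
Variable a : L.
Hypothesis am : a ^+ m = evx a r.
Let x : seq N := [:: 0; 1]%num.
Let ev := evx a.
Let n_gt0 : (0 < n)%N. Proof. exact: leq_trans n3. Qed.

Let ev_x : ev x = a.
Proof. by rewrite /ev /= mulr0 addr0 mulr1 add0r. Qed.
Let ev_1 : ev [:: 1%num] = 1. Proof. by rewrite /ev /= mulr0 addr0. Qed.

Lemma ev_conjugate u i : (i < n)%N -> ev (nth [::] (frobenius_list q p n m r u) i) = ev u ^+ (#|F| ^ i).
Proof.
move=> ni; rewrite /frobenius_list (set_nth_default u) ?size_traject // nth_traject //; elim: i {ni} => [|i IH]; first by rewrite expr1.
by rewrite /= /ev (evx_exp pL p1 am) -/ev IH qE -exprM expnSr.
Qed.

Lemma ev_dot us vs : ev (dot p m r us vs) = \sum_(uv <- zip us vs) ev uv.1 * ev uv.2.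
Proof.
rewrite /dot /ev (evx_mul pL p1 am) -/(ev [:: 1%num]) ev_1 mulr1; elim: (zip us vs) => [|uv l IH]; first by rewrite big_nil.
by rewrite big_cons /= evx_axpy evx_convolve mul1r IH.
Qed.

Lemma ev_dot_conjugates u v j : (j < n)%N ->
  ev (dot p m r (frobenius_list q p n m r u) (drop j (frobenius_list q p n m r v ++ frobenius_list q p n m r v))) =
  \sum_(i < n) ev u ^+ (#|F| ^ i) * ev v ^+ (#|F| ^ (i + j)).
Proof.
move=> jn; rewrite ev_dot; set fu := frobenius_list _ _ _ _ _ u; set fv := frobenius_list _ _ _ _ _ v.
have su : size fu = n by rewrite size_traject.
have sv : size fv = n by rewrite size_traject.
have sz : size (zip fu (drop j (fv ++ fv))) = n.
  by rewrite size_zip size_drop size_cat su sv; move: jn; clear; lia.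
rewrite (big_nth ([::], [::])) sz big_mkord; apply: eq_bigr => i _.
rewrite nth_zip_cond sz ltn_ord /= nth_drop ev_conjugate //; congr (_ * _).
rewrite addnC nth_cat sv; have := ltn_ord i; move: (nat_of_ord i) => k kn.
(* Indices i + j beyond n wrap around, since the n-th conjugate is the element itself; this is why
   the list of conjugates is doubled. *)
case: ltnP => h; first exact: ev_conjugate.
rewrite ev_conjugate; last by move: kn jn h; clear; lia.
rewrite -[in RHS](subnKC h) expnD exprM -cardL expf_card //.
Qed.

(** Horner's scheme with the remainder u X + v, where u X^2 is replaced by - u c1 X - u c0 at each
    step. *)
Lemma quadratic_dvdP c1 c0 ts : quadratic_dvd p m r c1 c0 ts ->
  'X^2 + ev c1 *: 'X + (ev c0)%:P %| foldl (fun P t => P * 'X + (ev t)%:P) 0 ts.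
Proof.
rewrite /quadratic_dvd; set uv := quadratic_rem _ _ _ _ _ _; set D := _ + _; case: ifP => // h1 h2.
have step P w : D %| P - (ev w.1 *: 'X + (ev w.2)%:P) ->
   D %| foldl (fun P t => P * 'X + (ev t)%:P) P ts -
     (ev (foldl (fun uv t => (subx p uv.2 (mulx p m r c1 uv.1), subx p t (mulx p m r c0 uv.1))) w ts).1 *: 'X +
      (ev (foldl (fun uv t => (subx p uv.2 (mulx p m r c1 uv.1), subx p t (mulx p m r c0 uv.1))) w ts).2)%:P).
  elim: ts P w {uv h1 h2} => //= t ts IH P w Pw; apply: IH => /=.
  rewrite /ev !(evx_sub a pL p1) !(evx_mul pL p1 am) -/(ev _) -/(ev _) -/(ev _) -/(ev _) -/(ev _).
  have -> : P * 'X + (ev t)%:P - ((ev w.2 - ev c1 * ev w.1) *: 'X + (ev t - ev c0 * ev w.1)%:P) =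
    (P - (ev w.1 *: 'X + (ev w.2)%:P)) * 'X + (ev w.1)%:P * D.
    rewrite /D -!mul_polyC !rmorphB !rmorphM /=; ring.
  by apply: dvdp_add; [exact: dvdp_mulr|exact: dvdp_mull].
have := step 0 ([::], [::]); rewrite /= scale0r addr0 subrr dvdp0 => /(_ isT).
by rewrite -/(quadratic_rem _ _ _ _ _ _) -/uv /ev (zeroxP a pL p1 h1) (zeroxP a pL p1 h2) scale0r addr0 subr0.
Qed.

Lemma foldl_horner_step (ts : seq (seq N)) : foldl (fun P t => P * 'X + (ev t)%:P) 0 ts =
  \sum_(i < size ts) ev (nth [::] ts i) *: 'X^((size ts).-1 - i).
Proof.
elim/last_ind: ts => [|ts t IH]; first by rewrite big_ord0.
rewrite foldl_rcons IH size_rcons big_ord_recr /= subnn expr0 nth_rcons ltnn eqxx alg_polyC; congr (_ + _).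
rewrite mulr_suml; apply: eq_bigr => i _; rewrite nth_rcons ltn_ord -scalerAl -exprSr; congr (_ *: 'X^_).
by have := ltn_ord i; clear; move: (size ts) (nat_of_ord i) => s k; lia.
Qed.

Lemma normal_certificate_sound : normal_certificate q p n m r b -> a != 0 /\ k_normal #|F| n 2 a.
Proof.
rewrite /normal_certificate; set fa := frobenius_list _ _ _ _ _ x; set fb := frobenius_list _ _ _ _ _ b.
set c1 := dot _ _ _ fb (drop (n - 2) _); set c0 := dot _ _ _ fb (drop (n - 1) _).
case: ifP => // /negbFE h0; case: ifP => // /negbFE h1; case: ifP => // /negbFE h2 h3.
pose c j := \sum_(i < n) ev b ^+ (#|F| ^ i) * a ^+ (#|F| ^ (i + j)).
have cE j : (j < n)%N -> ev (dot p m r fb (drop j (fa ++ fa))) = c j.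
  by move=> jn; rewrite ev_dot_conjugates // ev_x.
have cz j : (j < n - 3)%N -> c j = 0.
  move=> jn; rewrite -cE; last by move: jn n3; clear; lia.
  by apply: (zeroxP a pL p1); apply: (allP h0); rewrite mem_iota.
have c_1 : c (n - 3)%N = 1.
  rewrite -cE; last by move: n3; clear; lia.
  by rewrite /ev (eqxP a pL p1 h1).
set D : {poly L} := 'X^2 + ev c1 *: 'X + (ev c0)%:P.
split.
  apply/eqP => a0; have := oner_neq0 L; rewrite -c_1 /c big1 ?eqxx // => i _.
  by rewrite a0 expr0n expn_eq0 gtn_eqF ?mulr0 // ltnW // finNzRing_gt1.
apply: (k_normal_bezout (B := \sum_(i < n) ev b ^+ (#|F| ^ i) *: 'X^i) (D := D)).
- have -> : D = 'X^2 + (ev c1 *: 'X + (ev c0)%:P) by rewrite addrA.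
  rewrite size_polyDl size_polyXn // ltnS; apply: leq_trans (size_polyD _ _) _.
  rewrite geq_max (leq_trans (size_scale_leq _ _)) ?size_polyX //=.
  exact: leq_trans (size_polyC_leq1 _) _.
- have := quadratic_dvdP h3; rewrite -/D.
  suff -> : foldl (fun P t => P * 'X + (ev t)%:P) 0 ([:: 1%num] :: nseq (n - 1) [::] ++ [:: [:: (p - 1)%num]]) = 'X^n - 1 by [].
  have ev_m1 : ev [:: (p - 1)%num] = -1.
    by rewrite /ev /= mulr0 addr0 to_nat_sub natrB ?(ltnW p1) // pL sub0r.
  have zeros k P : foldl (fun P t => P * 'X + (ev t)%:P) P (nseq k [::]) = P * 'X^k.
    elim: k P => [|k IH] P /=; first by rewrite expr0 mulr1.
    by rewrite IH /ev /= addr0 -mulrA -exprS.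
  rewrite -cat1s !foldl_cat zeros.
  have -> : foldl (fun P t => P * 'X + (ev t)%:P) 0 [:: [:: 1%num]] = 1.
    by change (0 * 'X + (ev [:: 1%num])%:P = 1); rewrite mul0r add0r ev_1.
  change (1 * 'X^(n - 1) * 'X + (ev [:: (p - 1)%num])%:P = 'X^n - 1); rewrite ev_m1.
  by rewrite mul1r -exprSr rmorphN rmorph1 subn1 prednK.
- have := quadratic_dvdP h2; rewrite -/D foldl_horner_step size_traject /g_poly.
  by under eq_bigr => i _ do rewrite ev_conjugate // ev_x.
have := conjugate_combination cardL a (ev b).
have -> // : \sum_(j < n) (\sum_(i < n) ev b ^+ (#|F| ^ i) * a ^+ (#|F| ^ (i + j))) *: 'X^(n.-1 - j) = D.
rewrite -(big_mkord xpredT (fun j => c j *: 'X^(n.-1 - j))).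
have [k nE] : exists k, n = k.+3 by exists (n - 3)%N; move: n3; clear; lia.
have [k1 k2 k3] : [/\ (n - 3 = k)%N, (n - 2 = k.+1)%N & (n - 1 = k.+2)%N] by rewrite nE; clear; split; lia.
have e1 : ev c1 = c k.+1 by rewrite cE k2 // nE.
have e0 : ev c0 = c k.+2 by rewrite cE k3 // nE.
rewrite /D e1 e0 {1}nE !big_nat_recr //= big_nat big1 => [|j /andP [_ jk]]; last by rewrite cz ?scale0r // k1.
have [d0 d1 d2] : [/\ (k.+2 - k = 2)%N, (k.+2 - k.+1 = 1)%N & (k.+2 - k.+2 = 0)%N] by clear; split; lia.
have ck : c k = 1 by rewrite -k1.
by rewrite ck nE /= d0 d1 d2 add0r expr0 expr1 scale1r alg_polyC.
Qed.

Lemma cofactor_powersP k u ls l : l \in ls -> (0 < N.to_nat (prod_N ls))%N ->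
  exists2 v, v \in cofactor_powers p m r k u ls & ev v = ev u ^+ (N.to_nat (prod_N ls) %/ N.to_nat l).
Proof.
have prod_cat l1 l2 : N.to_nat (prod_N (l1 ++ l2)) = (N.to_nat (prod_N l1) * N.to_nat (prod_N l2))%N.
  by elim: l1 => [|t l1 IH]; rewrite /prod_N /= ?mul1n // !to_nat_mul IH mulnA.
have dvd_prod l1 : l \in l1 -> (N.to_nat l %| N.to_nat (prod_N l1))%N.
  elim: l1 => //= t l1 IH; rewrite inE to_nat_mul => /orP [/eqP <-|/IH h]; first exact: dvdn_mulr.
  exact: dvdn_mull.
elim: k u ls => [|k IH] u ls lls p0.
  by exists (expx p m r u (prod_N ls / l)%num); [exact: map_f|rewrite /ev (evx_exp pL p1 am) to_nat_div].
rewrite /=; set l1 := take _ _; set l2 := drop _ _.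
have E := prod_cat l1 l2; rewrite cat_take_drop in E.
rewrite E muln_gt0 in p0; case/andP: p0 => p1' p2'.
have : l \in l1 ++ l2 by rewrite cat_take_drop.
rewrite mem_cat => /orP [h|h].
  have [v vin vE] := IH (expx p m r u (prod_N l2)) l1 h p1'; exists v; first by rewrite mem_cat vin.
  by rewrite vE /ev (evx_exp pL p1 am) -exprM E [(N.to_nat (prod_N l1) * _)%N]mulnC muln_divA // dvd_prod.
have [v vin vE] := IH (expx p m r u (prod_N l1)) l2 h p2'; exists v; first by rewrite mem_cat vin orbT.
by rewrite vE /ev (evx_exp pL p1 am) -exprM E muln_divA // dvd_prod.
Qed.

Lemma generator_certificate_sound : a != 0 -> generator_certificate q p n m r ->
  exists2 c : F, c != 0 & primitive_elt (iota c * a).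
Proof.
move=> a0; rewrite /generator_certificate; set Q := (q ^ _ - 1)%num; set M := (Q / _)%num.
have QE : N.to_nat Q = #|L|.-1 by rewrite !to_natE Nat2N.id qE cardL subn1.
have ME : N.to_nat M = proj_order #|F| n.
  rewrite to_nat_div QE to_nat_sub qE (proj_orderE cardL) subn1 mulnK //.
  by have := finNzRing_gt1 F; case: (#|F|) => [|[]].
case tE : (trial_division 20 M) => [ls|//]; case: ifP => // /negbFE /N.eqb_eq lsM; cbv zeta.
set us := cofactor_powers _ _ _ _ _ _; set U := foldr _ _ us => hU.
have [w [w0 [w_gen w_order]]] := finField_generator L.
have M0 : (0 < N.to_nat M)%N by rewrite ME proj_order_gt0.
apply: (scale_primitive iota n_gt0 cardL w0 w_gen w_order a0) => l lp; rewrite -ME => lM; apply/negP => la.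
have /mapP [l' l'ls lE] := trial_divisionP M0 tE lp lM.
have Q0 : (0 < N.to_nat Q)%N by rewrite QE; have := finNzRing_gt1 L; case: (#|L|) => [|[]].
have := eqxP a pL p1 hU; rewrite (evx_exp pL p1 am) -/ev ev_1; suff -> : ev U = 0.
  by rewrite expr0n gtn_eqF // => /esym/eqP; rewrite oner_eq0.
have [|v vus vE] := @cofactor_powersP 3 (expx p m r x (q - 1)%num) ls l' l'ls; first by rewrite lsM.
(* If l divides log a, then a^((q - 1) M / l) is a power of w^(M (q - 1)) = 1. *)
have v1 : ev v = 1.
  rewrite vE lsM /ev (evx_exp pL p1 am) -/(ev x) ev_x to_nat_sub qE -lE -exprM.
  apply/eqP; rewrite -(dlogK w_gen w_order a0) -exprM w_order (proj_orderE cardL) -ME.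
  have /dvdnP [e ->] := la; rewrite -subn1.
  have -> : (e * l * ((#|F| - 1) * (N.to_nat M %/ l)) = e * ((N.to_nat M %/ l * l) * (#|F| - 1)))%N by clear; lia.
  by rewrite divnK // dvdn_mull.
rewrite /U; set g := fun _ => _; have gE u acc : ev (g u acc) = ev acc * (ev u - 1).
  by rewrite /g /ev (evx_mul pL p1 am) (evx_sub a pL p1) -/(ev [:: 1%num]) ev_1.
rewrite -/us in vus; elim: (us) vus => // k vs IH.
rewrite inE => /orP [/eqP <-|/IH h].
  by rewrite -[foldr _ _ _]/(g v (foldr g [:: 1%num] vs)) gE v1 subrr mulr0.
by rewrite -[foldr _ _ _]/(g k (foldr g [:: 1%num] vs)) gE h mul0r.
Qed.
End CertificateSoundness.

Lemma certificate_sound (F L : finFieldType) (iota : {rmorphism F -> L}) (q p : N) n m r b :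
  N.to_nat q = #|F| -> (3 <= n)%N -> #|L| = (#|F| ^ n)%N -> certificate q p n m r b ->
  exists a : L, primitive_elt a /\ k_normal #|F| n 2 a.
Proof.
move=> qE n3 cardL; rewrite /certificate; case: ifP => // /negbFE h1; case: ifP => // /negbFE /eqP sr.
case: ifP => // /negbFE h2; case: ifP => // /negbFE h3 h4.
have LE : (N.to_nat p ^ m)%N = #|L|.
  by move: h1; rewrite to_nat_eqb !to_nat_pow !Nat2N.id qE -cardL => /eqP.
have L1 := finNzRing_gt1 L.
have m0 : (0 < m)%N by case: (m) LE L1 => // <-.
have p1 : (1 < N.to_nat p)%N.
  by move: L1; rewrite -LE; case: (N.to_nat p) => [|[|]] //; rewrite ?exp0n ?exp1n.
have pL : (N.to_nat p)%:R = 0 :> L.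
  have : (#|L|)%:R = 0 :> L.
    have [l lp lL] := finPcharP L; apply/eqP; rewrite -(dvdn_pcharf lL).
    have LE' : #|L| = (l ^ logn l #|L|)%N := card_pprimeChar lL.
    by move: L1; rewrite LE'; case: (logn _ _) => // k _; rewrite expnS dvdn_mulr.
  by rewrite -LE natrX => /eqP; rewrite expf_eq0 m0 => /eqP.
have [|a am] := root_in_fixed_field pL p1 sr m0 h2; first by rewrite to_nat_pow Nat2N.id qE.
have [a0 an] := normal_certificate_sound qE n3 cardL pL p1 am h3.
have [c c0 cp] := generator_certificate_sound iota qE n3 cardL pL p1 am a0 h4.
by exists (iota c * a); split => //; apply: (k_normal_scale iota).
Qed.

Lemma certificates_checked : all certified certificates.
Proof. by vm_compute. Qed.

Lemma certified_element (F L : finFieldType) (iota : {rmorphism F -> L}) (n : nat) :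
  (3 <= n)%N -> #|L| = (#|F| ^ n)%N -> has (fun c => (c.1.1.1.1 == (N.of_nat #|F|, N.of_nat n))) certificates ->
  exists a : L, primitive_elt a /\ k_normal #|F| n 2 a.
Proof.
move=> n3 cardL /hasP [[[[[[q n'] p] m] r] b] /(allP certificates_checked) h /= /eqP [qE nE]].
move: h; rewrite /certified nE Nat2N.id; apply: certificate_sound => //.
by rewrite qE Nat2N.id.
Qed.

Lemma exceptions_certified e : e \in exceptions -> has (fun c => c.1.1.1.1 == e) certificates.
Proof.
have : all (fun e => has (fun c => c.1.1.1.1 == e) certificates) exceptions by vm_compute.
by move/allP; apply.
Qed.

(** * Quadratic divisors of X^n - 1 and necessity *)

(** The order q (q - 1)^2 (q + 1) of GL_2 has the same prime divisors as q^3 - q. *)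
Lemma card_GL2_primes (q n : nat) : (1 < q)%N -> coprime (q ^ 3 - q) n -> coprime (q * q.-1 ^ 2 * q.+1) n.
Proof.
move=> q1; have -> : (q ^ 3 - q = q * q.-1 * q.+1)%N.
  by case: q q1 => // q _ /=; rewrite !expnS expn0; clear; nia.
by rewrite expnS expn1 !coprimeMl => /andP [/andP [-> ->] ->].
Qed.

(** Let C in GL_2(F) have prime order l dividing n. If its characteristic polynomial does not divide
    X^n - 1, the nonzero remainder has degree at most 1 and kills C, so C is a scalar c != 1 with
    c^n = 1, and D = (X - 1)(X - c) serves. *)
Lemma quadratic_divisor_exists (F : finFieldType) (n : nat) : (0 < n)%N -> gcdn (#|F| ^ 3 - #|F|) n != 1%N ->
  exists D f : {poly F}, D * f = 'X^n - 1 /\ size D = 3.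
Proof.
move=> n0 g1; have [l lp /andP [lq ln]] : exists2 l, prime l & (l %| #|F| ^ 3 - #|F|)%N && (l %| n)%N.
  exists (pdiv (gcdn (#|F| ^ 3 - #|F|) n)); last by rewrite -dvdn_gcd pdiv_dvd.
  by apply: pdiv_prime; rewrite ltn_neqAle eq_sym g1 gcdn_gt0 n0 orbT.
have lG : (l %| #|('GL_2[F])%g|)%N.
  rewrite card_GL_2; apply: contraLR lq; rewrite -!prime_coprime // coprime_sym => h.
  rewrite coprime_sym; have q1 := finNzRing_gt1 F.
  have -> : (#|F| ^ 3 - #|F| = #|F| * #|F|.-1 * #|F|.+1)%N.
    by case: (#|F|) q1 => // q _ /=; rewrite !expnS expn0; clear; nia.
  by move: h; rewrite expnS expn1 !coprimeMl => /andP [/and3P [-> -> _] ->].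
have [u _ ou] := Cauchy lp lG.
pose C : 'M[F]_2 := val u.
have Cn : C ^+ n = 1.
  by rewrite /C -FinRing.val_unitX -FinRing.val_unit1; congr val; apply/eqP; rewrite -order_dvdn ou.
have C1 : C != 1.
  apply: contraTneq lp => C1; have u1 : u = 1%g by apply: val_inj.
  by rewrite -ou u1 order1.
have dvd_scalar (c : F) : C = c%:M -> exists D f : {poly F}, D * f = 'X^n - 1 /\ size D = 3.
  move=> Cc; have c1 : c != 1 by apply: contraNneq C1 => c1; rewrite Cc c1.
  have cn : c ^+ n = 1.
    have : (c ^+ n)%:M = 1%:M :> 'M[F]_2 by rewrite rmorphXn /= -Cc Cn.
    by move/(congr1 (fun B : 'M_2 => B 0 0)); rewrite !mxE.
  have /dvdpP [f fE] : ('X - 1%:P) * ('X - c%:P) %| ('X^n - 1 : {poly F}).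
    rewrite Gauss_dvdp; last by rewrite coprimep_XsubC2 // subr_eq0.
    by rewrite !dvdp_XsubCl !rootE !hornerE expr1n cn subrr eqxx.
  exists (('X - 1%:P) * ('X - c%:P)), f; split; first by rewrite mulrC.
  by rewrite size_mul ?polyXsubC_eq0 // !size_XsubC.
pose P := char_poly C; have sP : size P = 3 by rewrite size_char_poly.
pose R := ('X^n - 1) %% P.
have RC : horner_mx C R = 0.
  have : horner_mx C ('X^n - 1) = 0 by rewrite rmorphB rmorphXn /= horner_mx_X rmorph1 Cn subrr.
  by rewrite (divp_eq ('X^n - 1) P) rmorphD rmorphM /= Cayley_Hamilton mulr0 add0r.
have [R0|R0] := eqVneq R 0.
  exists P, (('X^n - 1) %/ P); split=> //.
  by rewrite mulrC divpK // /dvdp -/R R0.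
have sR : (size R <= 2)%N.
  have : (size R < size P)%N by rewrite ltn_modp -size_poly_gt0 sP.
  by rewrite sP ltnS.
have RE : R = R`_1 *: 'X + (R`_0)%:P.
  apply/polyP => i; rewrite coefD coefZ coefX coefC.
  case: i => [|[|i]]; rewrite ?mulr0 ?mulr1 ?add0r ?addr0 //.
  by rewrite nth_default // (leq_trans sR).
have RCE : R`_1 *: C + (R`_0)%:M = 0.
  by rewrite -RC RE rmorphD /= linearZ /= horner_mx_X horner_mx_C -RE.
have [u0|u0] := eqVneq R`_1 0; last first.
  apply: (dvd_scalar (- R`_0 / R`_1)); apply: (scalerI u0).
  rewrite scale_scalar_mx mulrC divfK // rmorphN /=.
  by apply/eqP; rewrite -addr_eq0 RCE.
case/eqP: R0; rewrite RE u0 scale0r add0r.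
move: RCE; rewrite u0 scale0r add0r => /(congr1 (fun B : 'M_2 => B 0 0)); rewrite !mxE eqxx mulr1n => ->.
by rewrite polyC0.
Qed.

(** The companion matrix C of D satisfies C^n = 1. Its upper left entry is 0, so C is not the
    identity and its order is a nontrivial common divisor of n and |GL_2(F)|. *)
Lemma quadratic_divisor_gcd (F : finFieldType) (n : nat) (D f : {poly F}) : (0 < n)%N ->
  D * f = 'X^n - 1 -> size D = 3 -> gcdn (#|F| ^ 3 - #|F|) n != 1%N.
Proof.
move=> n0 Df sD; apply/negP => co.
have d0 : D`_2 != 0 by have := lead_coef_eq0 D; rewrite /lead_coef sD -size_poly_eq0 sD /= => ->.
pose c i := D`_i / D`_2.
pose C : 'M[F]_2 := \matrix_(i, j) if i == 0 then (j == 1)%:R else - (if j == 0 then c 0%N else c 1%N).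
have DE : D = D`_2 *: ('X^2 + c 1%N *: 'X + (c 0%N)%:P).
  apply/polyP => i; rewrite coefZ !coefD coefZ coefXn coefX coefC.
  case: i => [|[|[|i]]] /=; rewrite /c !(mulr0, mulr1, add0r, addr0) ?[_ * (_ / _)]mulrC ?divfK //.
  by rewrite nth_default ?sD.
have CC : C * C + c 1%N *: C + (c 0%N)%:M = 0.
  apply/matrixP => i j; rewrite !mxE !big_ord_recl big_ord0 !mxE.
  case: i => [[|[|i]] ilt] //; case: j => [[|[|j]] jlt] //=; rewrite ?mulr1n ?mulr0n; ring.
have Cn : C ^+ n = 1.
  have : horner_mx C ('X^n - 1) = 0.
    rewrite -Df rmorphM /= {1}DE linearZ /= !rmorphD /= linearZ /= rmorphXn /= horner_mx_X horner_mx_C.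
    by rewrite expr2 CC scaler0 mul0r.
  by rewrite rmorphB rmorphXn /= horner_mx_X rmorph1 => /eqP; rewrite subr_eq0 => /eqP.
have Cu : C \is a GRing.unit by apply: contraLR (unitr1 'M[F]_2) => nu; rewrite -Cn unitrX_pos.
pose u : {'GL_2[F]} := FinRing.Unit Cu.
have un : (u ^+ n = 1)%g by apply: val_inj; rewrite FinRing.val_unitX FinRing.val_unit1.
have o1 : (#[u]%g %| n)%N by rewrite order_dvdn un.
have o2 : (#[u]%g %| #|('GL_2[F])%g|)%N by apply: order_dvdG; rewrite inE.
move: o2; rewrite card_GL_2 => o2.
have /eqP g1 := card_GL2_primes (finNzRing_gt1 F) co.
have : (#[u]%g %| gcdn (#|F| * #|F|.-1 ^ 2 * #|F|.+1) n)%N by rewrite dvdn_gcd o1 o2.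
rewrite g1 dvdn1 order_eq1 => /eqP u1.
have : C 0 0 = 1 by rewrite -[C]/(val u) u1 FinRing.val_unit1 mxE.
by rewrite mxE => /esym/eqP; rewrite oner_eq0.
Qed.

Lemma primitive_order (L : finFieldType) (a : L) k : primitive_elt a -> (0 < k)%N -> a ^+ k = 1 -> (#|L|.-1 <= k)%N.
Proof.
move=> [a0 agen] k0 ak; rewrite -card_nonzero.
apply: leq_trans (_ : #|[seq a ^+ i | i : 'I_k]| <= k)%N; last by apply: leq_trans (leq_image_card _ _) _; rewrite card_ord.
apply: subset_leq_card; apply/subsetP => y; rewrite inE => /agen [i ->].
apply/imageP; exists (Ordinal (ltn_pmod i k0)) => //=.
by rewrite {1}(divn_eq i k) exprD mulnC exprM ak expr1n mul1r.
Qed.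

(** Comparing coefficients gives u = -b, v = b^2 - c and b (b^2 - 2 c) = 0. *)
Lemma quartic_quadratic_divisor (F : fieldType) (u v b c : F) :
  ('X^2 + u *: 'X + v%:P) * ('X^2 + b *: 'X + c%:P) = 'X^4 - 1 ->
  (b = 0 /\ c ^+ 2 = 1) \/ (b != 0 /\ c ^+ 2 = -1 /\ b ^+ 2 = c *+ 2).
Proof.
move=> E; have : ('X^2 + u *: 'X + v%:P) * ('X^2 + b *: 'X + c%:P) =
   'X^4 + (u + b) *: 'X^3 + (c + u * b + v) *: 'X^2 + (u * c + v * b) *: 'X + (v * c)%:P.
  rewrite -!mul_polyC !rmorphD !rmorphM /=; ring.
rewrite {}E => E.
have co i : (('X^4 - 1 : {poly F})`_i = ('X^4 + (u + b) *: 'X^3 + (c + u * b + v) *: 'X^2 + (u * c + v * b) *: 'X + (v * c)%:P)`_i) by rewrite E.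
have e3 := co 3%N; have e2 := co 2%N; have e1 := co 1%N; have e0 := co 0%N.
move: e3 e2 e1 e0; rewrite !(coefD, coefN, coefZ, coefXn, coefX, coefC) /= ?oppr0 !(mulr0, mulr1, addr0, add0r).
move=> e3 e2 e1 e0.
have uE : u = - b by apply/eqP; rewrite -addr_eq0 -e3 ?coef1 ?subrr.
have vE : v = b ^+ 2 - c by apply/eqP; rewrite -subr_eq0; apply/eqP; rewrite [RHS]e2 uE; ring.
have e1' : b * (b ^+ 2 - c *+ 2) = 0 by rewrite [RHS]e1 uE vE; ring.
have e0' : (c - b ^+ 2) * c = 1 by apply/eqP; rewrite -eqr_opp [- (1)]e0 vE; apply/eqP; ring.
have [b0|b0] := eqVneq b 0; [left|right].
  by split=> //; rewrite -e0' b0; ring.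
have bc : b ^+ 2 = c *+ 2.
  by apply/eqP; rewrite -subr_eq0; move/eqP: e1'; rewrite mulf_eq0 (negbTE b0).
by split=> //; split=> //; apply/eqP; rewrite -eqr_opp opprK; apply/eqP; rewrite -e0' bc; ring.
Qed.

Lemma sqrt_minus1_mod4 (F : finFieldType) (c : F) : c ^+ 2 = -1 -> (2%:R : F) != 0 -> (#|F| %% 4 = 1)%N.
Proof.
move=> c2 two; have c0 : c != 0 by apply/eqP => c0; move/eqP: c2; rewrite c0 expr0n eq_sym oppr_eq0 oner_eq0.
have c4 : c ^+ 4 = 1 by rewrite (exprM c 2 2) c2 sqrrN expr1n.
have cq : c ^+ #|F|.-1 = 1.
  by apply: (mulfI c0); rewrite mulr1 -exprS prednK ?expf_card // ltnW // finNzRing_gt1.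
have c21 : c ^+ 2 != 1 by rewrite c2 -subr_eq0 -opprD oppr_eq0.
have := expr_gcd1 (isT : 0 < 4)%N c4 cq.
have [d4|d4] := boolP (4 %| #|F|.-1)%N.
  by move=> _; move: d4; have := finNzRing_gt1 F; clear; move: #|F| => q q1 /dvdnP [k]; case: q q1 => //= q _ ->; rewrite -addn1 modnMDl.
have := dvdn_gcdl 4 #|F|.-1; have := dvdn_gcdr 4 #|F|.-1; move: (gcdn 4 _) => g g2 g1.
have gle : (g <= 4)%N by apply: dvdn_leq g1.
case: g g1 g2 gle => [|[|[|[|[|g]]]]] // _ g2 _ h.
- by move: c21; rewrite expr1 in h; rewrite h expr1n eqxx.
- by move: c21; rewrite h eqxx.
- by rewrite g2 in d4.
Qed.

Section Necessity.
Variables (F L : finFieldType) (iota : {rmorphism F -> L}) (n : nat).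
Hypothesis n_gt0 : (0 < n)%N.
Hypothesis cardL : #|L| = (#|F| ^ n)%N.
Let q := #|F|.
Let q1 : (1 < q)%N. Proof. exact: finNzRing_gt1. Qed.

Lemma iota_order (x : L) (c : F) k : x ^+ k = iota c -> c != 0 -> x ^+ (k * q.-1) = 1.
Proof.
move=> h c0; rewrite exprM h -rmorphXn.
have -> : c ^+ q.-1 = 1 by apply: (mulfI c0); rewrite mulr1 -exprS prednK ?expf_card // ltnW.
by rewrite rmorph1.
Qed.

Lemma primitive_2normal_necessary (a : L) : primitive_elt a -> k_normal q n 2 a ->
  ((5 <= n)%N /\ gcdn (q ^ 3 - q) n != 1%N) \/ (n = 4%N /\ q %% 4 = 1)%N.
Proof.
move=> ap ak; have [a0 _] := ap; have [D [E [DE sD Ea]]] := k_normal_cofactor iota n_gt0 cardL ak.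
have [n5|n4] := leqP 5 n; first by left; split=> //; exact: quadratic_divisor_gcd DE sD.
right; have N0 := @Xn1_neq0 F n n_gt0.
have E0 : E != 0 by apply: contraNneq N0 => E0; rewrite -DE E0 mulr0.
have D0 : D != 0 by rewrite -size_poly_eq0 sD.
have sDE := congr1 (fun P : {poly F} => size P) DE; rewrite /= size_mul // sD size_XnsubC // in sDE.
have sE : size E = (n - 1)%N by move: sDE; clear; move: (size E) => s; lia.
have lE : E`_(n - 2) != 0 by rewrite -lead_coef_eq0 /lead_coef sE in E0; rewrite -subn1 -subnDA in E0.
have EaE : \sum_(i < n - 1) iota E`_i * a ^+ (q ^ i) = 0 by rewrite -(act_widen iota a (N := n - 1)) ?sE.
have scale (c d : F) k l : (l < k)%N -> d != 0 -> iota c * a ^+ l + iota d * a ^+ k = 0 -> a ^+ (k - l) = iota (- c / d) /\ - c / d != 0.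
  move=> lk d0 h; have h1 : iota d * (a ^+ (k - l) - iota (- c / d)) = 0.
    apply: (mulIf (expf_neq0 l a0)); rewrite mul0r -mulrA mulrBl -exprD subnK ?(ltnW lk) //.
    rewrite mulrBr mulrA -rmorphM mulrC (mulrC d) divfK // rmorphN mulNr opprK addrC mulrC; exact: h.
  have h2 : a ^+ (k - l) = iota (- c / d).
    by move/eqP: h1; rewrite mulf_eq0 fmorph_eq0 (negbTE d0) subr_eq0 => /eqP.
  by split=> //; rewrite -(fmorph_eq0 iota) -h2 expf_neq0.
have ord k (c : F) : (0 < k)%N -> c != 0 -> a ^+ k = iota c -> (q ^ n <= k * q.-1 + 1)%N.
  move=> k0 c0 h; have := primitive_order ap _ (iota_order h c0).
  by rewrite cardL -/q muln_gt0 k0 -ltnS prednK ?(ltnW q1) // addn1 => /(_ q1); case: (q ^ n)%N.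
case: n n_gt0 n4 cardL N0 lE EaE sE ord {ak sDE} DE => [|[|[|[|[|n']]]]] // _ _ cL N0 lE EaE sE ord DE.
- by move: lE; rewrite nth_default ?eqxx // sE.
- exfalso; move: EaE; rewrite big_ord_recl big_ord0 addr0 expn0 expr1 => /eqP.
  by rewrite mulf_eq0 fmorph_eq0 (negbTE a0) orbF; move: lE; rewrite subnn => /negbTE ->.
(* For n = 3 the cofactor E is linear, so a^(q - 1) lies in F and a has order at most (q - 1)^2. *)
- exfalso; move: EaE; rewrite !big_ord_recl big_ord0 addr0 expn0 expr1 => h.
  have [||h1 h2] := scale _ _ q 1%N _ _ h => //.
  have := ord _ _ _ h2 h1; rewrite subn_gt0 => /(_ q1); move: q1; clear; case: q => // k.
  by rewrite subn1 /= !expnS expn0; nia.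
split=> //; pose e2 := E`_2; have e20 : e2 != 0 by exact: lE.
pose b := E`_1 / e2; pose c := E`_0 / e2.
have EE : E = e2 *: ('X^2 + b *: 'X + c%:P).
  apply/polyP => i; rewrite coefZ !coefD coefZ coefXn coefX coefC.
  case: i => [|[|[|i]]] /=; rewrite /b /c !(mulr0, mulr1, add0r, addr0) ?[_ * (_ / _)]mulrC ?divfK //.
  by rewrite nth_default ?sE.
pose u := e2 * D`_1; pose v := e2 * D`_0.
have DDE : e2 *: D = 'X^2 + u *: 'X + v%:P.
  apply/polyP => i; rewrite coefZ !coefD coefZ coefXn coefX coefC.
  have ld : e2 * D`_2 = 1.
    have := congr1 lead_coef DE; rewrite lead_coefM lead_coefXnsubC // /lead_coef sD sE /= mulrC.
    by [].
  case: i => [|[|[|i]]] /=; rewrite /u /v !(mulr0, mulr1, add0r, addr0) //.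
  by rewrite nth_default ?sD // mulr0.
have : ('X^2 + u *: 'X + v%:P) * ('X^2 + b *: 'X + c%:P) = 'X^4 - 1.
  by rewrite -DDE -DE [in RHS]EE -scalerAl scalerAr.
case/quartic_quadratic_divisor=> [[b0 c2]|[b0 [c2 bc]]].
  (* Here a^(q^2 - 1) = - c with c^2 = 1, so the order of a is at most 2 (q^2 - 1). *)
  exfalso; move: EaE; rewrite !big_ord_recl big_ord0 addr0 /=.
  have -> : E`_1 = 0 by move/eqP: b0; rewrite mulf_eq0 invr_eq0 (negbTE e20) orbF => /eqP.
  rewrite rmorph0 mul0r add0r expn0 => h.
  have [||h1 h2] := scale _ _ (q ^ 2)%N 1%N _ _ h => //; first by rewrite -(exp1n 2) ltn_exp2r.
  have h3 : a ^+ ((q ^ 2 - 1) * 2) = iota 1.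
    by rewrite exprM h1 -rmorphXn mulNr sqrrN -/e2 -/c c2.
  have := primitive_order ap _ (etrans h3 (rmorph1 iota)); rewrite cL -/q.
  have : (0 < (q ^ 2 - 1) * 2)%N by rewrite muln_gt0 subn_gt0 -(exp1n 2) ltn_exp2r ?q1.
  move=> h4 /(_ h4); move: q1; clear; case: q => // k; rewrite !expnS expn0; nia.
(* In characteristic 2 the relation b^2 = 2 c would force b = 0. *)
apply: (sqrt_minus1_mod4 c2); apply: contraNneq b0 => two.
by have := expf_eq0 b 2; rewrite bc -mulr_natr two mulr0 eqxx => /esym.
Qed.
End Necessity.

(** * Degree four *)

Section Eigenvectors.
Variables (F L : finFieldType) (iota : {rmorphism F -> L}) (n : nat).
Hypothesis n_gt0 : (0 < n)%N.
Hypothesis cardL : #|L| = (#|F| ^ n)%N.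
Let q := #|F|.

Lemma act_eigenvector (P : {poly F}) (c : F) (x : L) : x ^+ q = iota c * x -> act iota P x = iota P.[c] * x.
Proof.
move=> xq; have xqe e : x ^+ (q ^ e) = iota (c ^+ e) * x.
  elim: e => [|e IH]; first by rewrite expr1 expr0 rmorph1 mul1r.
  by rewrite expnSr exprM IH exprMn -rmorphXn expf_card xq mulrA -rmorphM exprSr.
rewrite /act horner_coef rmorph_sum mulr_suml; apply: eq_bigr => i _.
by rewrite xqe rmorphM mulrA.
Qed.

(** If P kills u + v, so does X P: this gives P(c) u + P(d) v = 0 and c P(c) u + d P(d) v = 0,
    whence P(c) = P(d) = 0 as c != d. *)
Lemma two_eigenvectors_normal (c d : F) (D : {poly F}) (u v : L) : c != d -> u != 0 -> v != 0 ->
  u ^+ q = iota c * u -> v ^+ q = iota d * v -> D * (('X - c%:P) * ('X - d%:P)) = 'X^n - 1 ->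
  k_normal q n (size D).-1 (u + v).
Proof.
move=> cd u0 v0 uq vq DE; apply: (k_normal_exact (iota := iota) n_gt0 cardL DE) => [|P].
  by rewrite actDr (act_eigenvector _ uq) (act_eigenvector _ vq) !hornerM !hornerXsubC !subrr mul0r mulr0 rmorph0 !mul0r addr0.
move=> h; have h2 : iota (c * P.[c]) * u + iota (d * P.[d]) * v = 0.
  have : act iota ('X * P) (u + v) = 0.
    by rewrite actX h expr0n gtn_eqF // ltnW // finNzRing_gt1.
  by rewrite actDr (act_eigenvector _ uq) (act_eigenvector _ vq) !hornerM !hornerX.
rewrite actDr (act_eigenvector _ uq) (act_eigenvector _ vq) in h.
have Pc : P.[c] = 0.
  have : iota ((c - d) * P.[c]) * u = 0.
    transitivity (iota (c * P.[c]) * u + iota (d * P.[d]) * v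
       - iota d * (iota P.[c] * u + iota P.[d] * v)); first by rewrite !rmorphM rmorphB; ring.
    by rewrite h h2 mulr0 subr0.
  by move/eqP; rewrite mulf_eq0 (negbTE u0) orbF fmorph_eq0 mulf_eq0 subr_eq0 (negbTE cd) => /eqP.
have Pd : P.[d] = 0.
  by move/eqP: h; rewrite Pc rmorph0 mul0r add0r mulf_eq0 (negbTE v0) orbF fmorph_eq0 => /eqP.
rewrite Gauss_dvdp; last by rewrite coprimep_XsubC2 // subr_eq0 eq_sym.
by rewrite !dvdp_XsubCl !rootE Pc Pd eqxx.
Qed.
End Eigenvectors.

Lemma proj_order4 q : proj_order q 4 = (q.+1 * (q ^ 2).+1)%N.
Proof. by rewrite /proj_order !big_ord_recl big_ord0 /= !expnS expn0; clear; lia. Qed.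

Section Quartic.
Variables (F L : finFieldType) (iota : {rmorphism F -> L}).
Let q := #|F|.
Hypothesis cardL : #|L| = (q ^ 4)%N.
Hypothesis q4 : (q %% 4 = 1)%N.
Let q1 : (1 < q)%N. Proof. exact: finNzRing_gt1. Qed.
Let M := proj_order q 4.
Let m := (M %/ 4)%N.

(** Both factors q + 1 and q^2 + 1 of M are 2 modulo 4. *)
Lemma proj_order4_odd_part : M = (4 * m)%N /\ odd m.
Proof.
have [k qE] : exists k, q = (4 * k + 1)%N by exists (q %/ 4)%N; rewrite mulnC {1}(divn_eq q 4) q4.
have ME : M = (4 * ((2 * k + 1) * (8 * k ^ 2 + 4 * k + 1)))%N.
  by rewrite /M proj_order4 qE !expnS expn0; clear; lia.
rewrite /m ME mulKn // oddM !addn1 /= mul2n odd_double; split=> //.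
by have -> : (8 * k ^ 2 + 4 * k = (4 * k ^ 2 + 2 * k).*2)%N; [clear; lia|rewrite odd_double].
Qed.

Let m_gt1 : (1 < m)%N.
Proof.
have [ME _] := proj_order4_odd_part; rewrite -(ltn_pmul2l (isT : 0 < 4)%N) -ME /M proj_order4.
have : (5 <= q)%N by move: q1 q4; move: q => k; clear; case: k => [|[|[|[|[|k]]]]].
move: q => k; rewrite !expnS expn0; clear; nia.
Qed.

Variables (w : L) (z : algC).
Hypothesis w0 : w != 0.
Hypothesis w_gen : forall x, x != 0 -> exists i, x = w ^+ i.
Hypothesis w_order : forall i, (w ^+ i == 1) = (#|L|.-1 %| i)%N.
Hypothesis zM : M.-primitive_root z.
Local Notation log := (dlog w).
Let y := w ^+ m.
Let y0 : y != 0. Proof. exact: expf_neq0. Qed.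
Let LM : #|L|.-1 = (4 * m * q.-1)%N.
Proof. by have [<- _] := proj_order4_odd_part; apply: proj_orderE cardL. Qed.

(** As |L| - 1 = 4 m (q - 1), the element y^(q - 1) has order exactly 4; since 4 divides q - 1 it
    lies in F and squares to -1. *)
Lemma quartic_eigenvalue : exists i : F, [/\ y ^+ q = iota i * y, i ^+ 2 = -1 & (2%:R : F) != 0].
Proof.
have L0 : (0 < #|L|.-1)%N by have := finNzRing_gt1 L; case: #|L| => [|[]].
pose t := y ^+ q.-1.
have t4 : t ^+ 4 = 1.
  by apply/eqP; rewrite /t /y -!exprM w_order LM; apply/dvdnP; exists 1%N; clear; lia.
have t2 : t ^+ 2 != 1.
  rewrite LM -mulnA muln_gt0 /= in L0.
  rewrite /t /y -!exprM w_order LM -[(4 * m * _)%N]mulnA [(m * (_ * 2))%N]mulnA; apply/negP => /dvdnP [c]; move: L0.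
  by move: (m * q.-1)%N => s; clear; case: c => [|c]; nia.
have tq : t ^+ q = t.
  rewrite {1}(divn_eq q 4) q4 addn1 exprSr mulnC exprM t4 expr1n mul1r //.
have [i it] := frob_fixedP iota t (introT eqP tq).
have i2 : i ^+ 2 = -1.
  have : (i ^+ 2) ^+ 2 == 1 by rewrite -exprM -(inj_eq (fmorph_inj iota)) rmorphXn it t4 rmorph1.
  rewrite sqrf_eq1 => /orP [/eqP h|/eqP //].
  by case/eqP: t2; rewrite -it -rmorphXn h rmorph1.
exists i; split=> //.
  by rewrite it /t -exprSr prednK // ltnW.
apply: contraNneq t2 => two; rewrite -it -rmorphXn i2 rmorphN rmorph1 -subr_eq0 -opprD oppr_eq0.
by rewrite -(rmorph1 iota) -rmorphD -mulr2n two rmorph0.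
Qed.

Section Line.
Variable i : F.
Hypothesis yq : y ^+ q = iota i * y.
Hypothesis i2 : i ^+ 2 = -1.
Hypothesis two : (2%:R : F) != 0.

Let i0 : i != 0.
Proof. by apply/eqP => i0; move/eqP: i2; rewrite i0 expr0n eq_sym oppr_eq0 oner_eq0. Qed.
Let m11 : (-1 : F) != 1.
Proof. by rewrite -subr_eq0 -opprD oppr_eq0. Qed.
Let i_1 : i != 1. Proof. by apply: contraNneq m11 => i1; rewrite -i2 i1 expr1n. Qed.
Let i_m1 : i != -1. Proof. by apply: contraNneq m11 => i1; rewrite -i2 i1 sqrrN expr1n. Qed.

(** The conjugates y, i y, -y and - i y of y are distinct. *)
Lemma quartic_free (f : {poly F}) : (size f <= 4)%N -> (map_poly iota f).[y] = 0 -> f = 0.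
Proof.
move=> sf fy; apply: contraTeq sf => f0; rewrite -ltnNge -(size_map_poly iota).
have g0 : map_poly iota f != 0 by rewrite map_poly_eq0.
have step x : root (map_poly iota f) x -> root (map_poly iota f) (x ^+ q).
  rewrite !rootE => /eqP fx; apply/eqP.
  have -> : (map_poly iota f).[x ^+ q] = (map_poly iota f).[x] ^+ q.
    by rewrite -{1}(map_frob_map iota f) -[x ^+ q]/(frobenius iota x) horner_map.
  by rewrite fx expr0n gtn_eqF // ltnW.
have r0 : root (map_poly iota f) y by rewrite rootE fy.
have pw (c : F) : (iota c * y) ^+ q = iota (c * i) * y by rewrite exprMn -rmorphXn expf_card yq mulrA -rmorphM.
pose rs : seq L := [seq iota c * y | c <- [:: 1; i; -1; -i]].
have := max_poly_roots (rs := rs) g0; apply.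
  rewrite /= rmorph1 mul1r r0 andbT.
  have r1 := step _ r0; rewrite yq in r1; have r2 := step _ r1; rewrite pw -expr2 i2 in r2.
  by have := step _ r2; rewrite pw mulN1r => r3; rewrite r1 r2 r3.
rewrite map_inj_uniq => [|c d /(mulIf y0) /fmorph_inj //].
rewrite /= !inE !negb_or !(eq_sym 1) i_1 m11 eqr_oppLR i_m1 eqr_opp /= andbT.
by rewrite (eq_sym 1) i_1 andbT -subr_eq0 opprK -mulr2n -mulr_natl mulf_eq0 negb_or two.
Qed.

Let y_line t : y + iota t != 0.
Proof.
apply/eqP => h; have := @quartic_free ('X + t%:P); rewrite rmorphD /= map_polyX map_polyC hornerD hornerX hornerC h.
by rewrite size_XaddC => /(_ isT erefl)/eqP; rewrite -size_poly_eq0 size_XaddC.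
Qed.

(** With the point 1 at infinity this represents the projective line spanned by 1 and y, and its
    character sum is the one that [weil_line_bound] controls. *)
Definition line : {set L} := 1 |: [set y + iota t | t : F].

Let line1 : 1 \notin [set y + iota t | t : F].
Proof. by apply/imsetP => -[t _ h]; have := y_line (t - 1); rewrite rmorphB rmorph1 addrA -h subrr eqxx. Qed.

Lemma card_line : #|line| = q.+1.
Proof.
by rewrite /line cardsU1 line1 card_imset // => t t' /addrI /fmorph_inj.
Qed.

Lemma line_char_sum a : ~~ (M %| a)%N -> `|\sum_(x in line) z ^+ (a * log x)| <= sqrtC (4 * q)%:R.
Proof.
move=> na; have E x : x != 0 -> z ^+ (a * log x) = mchar w z a x by move=> x0; rewrite /mchar (negbTE x0).
have -> : \sum_(x in line) z ^+ (a * log x) = 1 + \sum_t mchar w z a (y + iota t).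
  rewrite /line big_setU1 //= E ?oner_neq0 // (mchar1 iota cardL w_gen w_order zM); congr (_ + _).
  rewrite big_imset /=; last by move=> t t' _ _ /addrI /fmorph_inj.
  by apply: eq_big => [t|t _]; rewrite ?inE // E.
have s0 : 0 <= sqrtC (4 * q)%:R :> algC by rewrite sqrtC_ge0 ler0n.
rewrite -(@ler_pXn2r _ 2) ?nnegrE // sqrtCK natrM.
apply: (weil_line_bound cardL) => [f||||||x].
- exact: quartic_free.
- exact: mchar0.
- exact: (mchar1 iota cardL w_gen w_order zM).
- exact: (mcharM cardL w0 w_gen w_order zM).
- by move=> c c0; apply: (mchar_iota iota cardL w_gen w_order zM).
- exact: (mchar_sum cardL w0 w_gen w_order zM).
- have [->|x0] := eqVneq x 0; first by rewrite mchar0 normr0.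
  by rewrite (@mchar_norm F L 4 w z zM a).
Qed.

Lemma log_y : log y = m %[mod M].
Proof.
apply: (mod_proj_order cardL); apply/eqP; rewrite -(w_eq w0 w_order) dlogK //.
Qed.

(** Both are sums of two Frobenius eigenvectors, with eigenvalues 1, i and i, -1; the second element
    is y times the first. *)
Lemma normal_on_line t : t != 0 -> k_normal q 4 2 (iota t + y) /\ k_normal q 4 2 (iota t * y + y ^+ 2).
Proof.
move=> t0; have it0 : iota t != 0 by rewrite fmorph_eq0.
have Fq : iota t ^+ q = iota t by rewrite -rmorphXn expf_card.
have s2 (c d : F) : (size (('X - c%:P) * ('X - d%:P))).-1 = 2%N by rewrite size_mul ?polyXsubC_eq0 // !size_XsubC.
have ii : i%:P * i%:P = -1 :> {poly F} by rewrite -rmorphM -expr2 i2 rmorphN rmorph1.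
split.
  have := @two_eigenvectors_normal F L iota 4 isT cardL 1 i (('X - (-1)%:P) * ('X - (-i)%:P)); rewrite s2; apply; rewrite ?rmorph1 ?mul1r // 1?eq_sym //.
  rewrite !rmorphN rmorph1 !opprK; transitivity (('X ^+ 2 - 1) * ('X ^+ 2 - i%:P * i%:P) : {poly F}); first by ring.
  by rewrite ii opprK; ring.
have := @two_eigenvectors_normal F L iota 4 isT cardL i (-1) (('X - 1%:P) * ('X - (-i)%:P)); rewrite s2; apply => //.
- by rewrite mulf_neq0.
- by rewrite expf_neq0.
- by rewrite exprMn Fq yq mulrCA.
- by rewrite exprAC yq exprMn -rmorphXn i2.
- rewrite !rmorphN rmorph1 !opprK; transitivity (('X ^+ 2 - 1) * ('X ^+ 2 - i%:P * i%:P) : {poly F}); first by ring.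
  by rewrite ii opprK; ring.
Qed.

Variables (K R : seq nat).
Hypothesis KR : primes_of m (R ++ K).
Hypothesis KRm : forall l, prime l -> (l %| m)%N -> l \in R ++ K.
Hypothesis rec1 : rec_sum R < 1.

(* The class of y generates the 2-part of L^*/F^*, so only the odd primes need sieving:
   multiplying by y repairs the prime 2 and stays within 2-normal elements. *)
Lemma line_criterion : 2 ^+ size K * sqrtC (4 * q)%:R * (size R).+1%:R <= (1 - rec_sum R) * q.+1%:R ->
  exists b : L, primitive_elt b /\ k_normal q 4 2 b.
Proof.
move=> h; have [ME modd] := proj_order4_odd_part.
have M_gt0 : (0 < M)%N by apply: proj_order_gt0.
have pKR : primes_of M (R ++ K).
  case/and3P: KR => a b /allP c; apply/and3P; split=> //; apply/allP => l /c lm.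
  by rewrite ME dvdn_mull.
have z2 j : z ^+ j = 1 -> (M %| j)%N by move/eqP; rewrite -(prim_order_dvd zM).
have z1 : z ^+ M = 1 := prim_expr_order zM.
set B := sqrtC (4 * q)%:R : algC in h *.
have B0 : 0 < B by rewrite sqrtC_gt0 ltr0n muln_gt0 /= (ltnW q1).
have rec1' : 0 <= 1 - rec_sum R by rewrite subr_ge0 ltW.
have [a] : exists a, a \in [set x in line | avoids log (R ++ K) x].
  apply/card_gt0P; rewrite -(ltr0n algC).
  apply: lt_le_trans (sift_count_lower M_gt0 z1 z2 (ltW B0) line_char_sum pKR rec1').
  rewrite mulr_gt0 //.
    apply: sift_density_gt0; have /and3P [aP _ _] := KR.
    by move: aP; rewrite all_cat => /andP [_]; apply: sub_all => l; apply: prime_gt1.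
  rewrite subr_gt0 mulrDr card_line.
  by apply: le_lt_trans h _; rewrite ltrDl mulr_gt0 // subr_gt0.
rewrite inE => /andP [al /allP aR].
have aodd l : prime l -> (l %| m)%N -> ~~ (l %| log a)%N by move=> lp lm; apply: aR; apply: KRm.
have [p pp pm] : exists2 p, prime p & (p %| m)%N by exists (pdiv m); rewrite ?pdiv_prime ?pdiv_dvd.
have dvd_mod l b c : (l %| M)%N -> b = c %[mod M] -> (l %| b)%N = (l %| c)%N.
  by move=> lM bc; rewrite /dvdn -(modn_dvdm b lM) bc modn_dvdm.
have pM : (p %| M)%N by rewrite ME dvdn_mull.
move: al aodd {aR}; rewrite in_setU1 => /orP [/eqP ->|/imsetP [t _ ->]] aodd.
  (* The sieve itself excludes the point 1, whose logarithm is a multiple of M, and then y, whose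
     logarithm is m modulo M: the prime p of m divides both. *)
  have := aodd p pp pm; rewrite (dvdn_trans pM) // -(rmorph1 iota).
  by apply: (dlogF iota cardL w_gen w_order); apply: oner_neq0.
have t0 : t != 0.
  by apply: contraTneq pm => t0; have := aodd p pp; rewrite t0 rmorph0 addr0 (dvd_mod p _ _ pM log_y); case: (p %| m)%N => // /(_ isT).
have [n1 n2] := normal_on_line t0.
have finish b : b != 0 -> k_normal q 4 2 b -> odd (log b) -> (forall l, prime l -> (l %| m)%N -> ~~ (l %| log b)%N) ->
    exists b : L, primitive_elt b /\ k_normal q 4 2 b.
  move=> b0 bn bo bm; have [|c c0 cp] := scale_primitive iota (isT : 0 < 4)%N cardL w0 w_gen w_order b0.
    move=> l lp; rewrite -/q -/M ME Euclid_dvdM // => /orP [l4|]; last exact: bm.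
    have -> : l = 2%N by move: l4; rewrite (_ : 4 = 2 ^ 2)%N // Euclid_dvdX // andbT dvdn_prime2 // => /eqP.
    by rewrite dvdn2 bo.
  by exists (iota c * b); split=> //; apply: k_normal_scale.
have [ao|ao] := boolP (odd (log (y + iota t))).
  by apply: (finish (y + iota t)) => //; rewrite addrC.
have yy0 : (y + iota t) * y != 0 by rewrite mulf_neq0.
have lM := dlogM cardL w0 w_gen w_order (y_line t) y0.
have lE : log ((y + iota t) * y) = log (y + iota t) + m %[mod M] by rewrite lM -modnDmr log_y modnDmr.
apply: (finish ((y + iota t) * y)) => //.
- by rewrite mulrDl addrC -expr2.
- rewrite -[odd _]negbK -dvdn2 (dvd_mod 2%N _ _ _ lE); last by rewrite ME dvdn_mulr.
  by rewrite dvdn2 negbK oddD modd (negbTE ao).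
move=> l lp lm; rewrite (dvd_mod l _ _ _ lE) ?dvdn_addl ?aodd // ME dvdn_mull //.
Qed.
End Line.
End Quartic.

(** * Numerical verification in degree four *)

Definition odd_primes : seq N := behead small_primes.

Lemma odd_primesP p : prime p -> odd p -> (p < 256)%N -> p \in map N.to_nat odd_primes.
Proof.
move=> pp po /(small_primesP pp); rewrite (_ : map _ small_primes = 2%N :: map N.to_nat odd_primes) // inE.
by case/orP => // /eqP p2; move: po; rewrite p2.
Qed.

(** [test1] is reused without factors of f; in place of q^(n - 4) stands (q + 2) / 4, an integer
    lower bound for (q + 1)^2 / (4 q), the square of the quotient of the q + 1 points by the bound 2
    sqrt q. *)
Definition quartic_individual (T : N) (ps : seq N) (q : N) : bool :=
  let m := ((q + 1) * (q ^ 2 + 1) / 4)%num in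
  let D := [seq p <- ps | (m mod p =? 0)%num] in
  let B := foldl strip m D in
  exists_tail (test1 scale 0 0 ((q + 2) / 4))%num 1%num (tails_N scale (cover_N (N.size_nat B) T D B)).

(** B comes from 2 m <= q^3. *)
Definition quartic_range (lo hi : N) : bool :=
  let B := (hi ^ 3 / 2)%num in
  exists_tail (test1 scale 0 0 (lo / 4))%num 1%num (tails_N scale (cover_N (N.size_nat B) 256 odd_primes B)).

(* A cheap test settles almost all q. *)
Definition quartic_test (q : N) : bool :=
  if ~~ prime_power_test (take 10 odd_primes) q then true else
  if quartic_individual 32 (take 10 odd_primes) q then true else
  if ~~ prime_power_test small_primes q then true else
  if has (fun c => c.1.1.1.1 == (q, 4%num)) certificates then true else quartic_individual 256 odd_primes q.

(** Halving visits 2^k terms of the progression q, q + 4, ... with recursion depth k. *)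
Fixpoint quartic_scan (k : nat) (q : N) : bool :=
  if k is k'.+1 then if quartic_scan k' q then quartic_scan k' (q + 4 * 2 ^ N.of_nat k')%num else false
  else quartic_test q.

Lemma quartic_scanP k q i : quartic_scan k q -> (i < 2 ^ k)%N -> quartic_test (q + 4 * N.of_nat i)%num.
Proof.
elim: k q i => [|k IH] q i /=.
  rewrite expn0 ltnS leqn0 => h /eqP ->.
  by rewrite (_ : (q + 4 * N.of_nat 0)%num = q) //; clear; lia.
case: ifP => // h1 h2 ik; have [lt|ge] := ltnP i (2 ^ k); first exact: IH.
have -> : (q + 4 * N.of_nat i = q + 4 * 2 ^ N.of_nat k + 4 * N.of_nat (i - 2 ^ k))%num.
  have -> : (2 ^ N.of_nat k)%num = N.of_nat (2 ^ k) by apply: N2Nat.inj; rewrite to_nat_pow !Nat2N.id.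
  by move: ge; clear; move: (2 ^ k)%N => t; lia.
by apply: IH => //; rewrite ltn_subLR // addnn -mul2n -expnS.
Qed.

Lemma quartic_scanned : quartic_scan 13 5%num.
Proof. by vm_compute. Qed.

Lemma quartic_scanned_upper : quartic_scan 9 32773%num.
Proof. by vm_compute. Qed.

Lemma quartic_fine_ranges_tested : all (fun t => quartic_range (2048 * t) (2048 * (t + 1)))%num (map N.of_nat (iota 17 15)).
Proof. by vm_compute. Qed.

Lemma quartic_ranges_tested : all (fun j => quartic_range (2 ^ j) (2 ^ (j + 1)))%num (map N.of_nat (iota 16 90)).
Proof. by vm_compute. Qed.

Lemma quartic_arith (P X t K c k : nat) : (P <= X * t -> t <= K -> X * c <= k -> P * c <= k * K)%N.
Proof.
move=> h1 h2 h3; apply: leq_trans (leq_mul h1 (leqnn c)) _.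
by rewrite mulnAC; apply: leq_mul.
Qed.

Section QuarticTests.
Variables (F L : finFieldType) (iota : {rmorphism F -> L}).
Let q := #|F|.
Hypothesis cardL : #|L| = (q ^ 4)%N.
Hypothesis q4 : (q %% 4 = 1)%N.
Let q1 : (1 < q)%N. Proof. exact: finNzRing_gt1. Qed.
Let m := (proj_order q 4 %/ 4)%N.
Let good := exists b : L, primitive_elt b /\ k_normal q 4 2 b.

Let m_odd : odd m. Proof. by have [] := proj_order4_odd_part q4. Qed.
Let m_gt0 : (0 < m)%N. Proof. by move: m_odd; case: m. Qed.

Lemma quartic_nat (S recS dd k s Q : nat) (K R : seq nat) : primes_of m (R ++ K) ->
  (forall l, prime l -> (l %| m)%N -> l \in R ++ K) -> (0 < S)%N -> (recS + dd = S)%N -> (0 < dd)%N ->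
  rec_sum R * S%:R <= recS%:R -> (size K <= k)%N -> (size R <= s)%N -> (4 * q * Q <= q.+1 ^ 2)%N ->
  ((S * 2 ^ k * (s + 1)) ^ 2 <= dd ^ 2 * Q)%N -> good.
Proof.
move=> KR KRm S0 E dd0 hrec hK hR hQ h.
have [w [w0 [w_gen w_order]]] := finField_generator L.
have [z zM] := C_prim_root_exists (proj_order_gt0 F (isT : 0 < 4)%N).
have [i [yq i2 two]] := quartic_eigenvalue iota cardL q4 w_order.
have lt : (recS < S)%N by rewrite -E -addn1 leq_add2l.
have rec1 := rec_sum_lt1 S0 hrec lt.
apply: (line_criterion cardL q4 w0 w_gen w_order zM yq i2 two KR KRm rec1).
have S0' : 0 < (S%:R : algC) by rewrite ltr0n.
rewrite -(ler_pM2l S0'); apply: le_trans (_ : dd%:R * q.+1%:R <= _); last first.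
  rewrite mulrA ler_wpM2r ?ler0n // mulrBr mulr1 mulrC lerBrDr addrC -[X in _ <= X%:R]E natrD lerD2r //.
set b := sqrtC _; have b0 : 0 <= b by rewrite sqrtC_ge0 ler0n.
have -> : S%:R * (2 ^+ size K * b * (size R).+1%:R) = (S * 2 ^ size K * (size R).+1)%:R * b.
  by rewrite !natrM natrX; ring.
rewrite -(@ler_pXn2r _ 2) ?nnegrE ?mulr_ge0 ?ler0n // exprMn sqrtCK -natrX -natrM -natrM -natrX ler_nat.
apply: leq_trans (_ : (S * 2 ^ k * (s + 1)) ^ 2 * (4 * q) <= _)%N.
  rewrite leq_mul2r leq_exp2r // addn1; apply/orP; right; apply: leq_mul => //.
  by rewrite leq_mul2l leq_exp2l // hK orbT.
apply: leq_trans (_ : dd ^ 2 * Q * (4 * q) <= _)%N; first by rewrite leq_mul2r h orbT.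
by rewrite expnMn -mulnA leq_mul2l [(Q * _)%N]mulnC hQ orbT.
Qed.

Lemma quartic_sound (T B : N) (D : seq N) Q : (0 < N.to_nat T)%N -> sorted ltn (map N.to_nat D) ->
  all (fun d => 0 < d < N.to_nat T)%N (map N.to_nat D) ->
  (forall p, prime p -> (p %| m)%N -> (p < N.to_nat T)%N -> p \in map N.to_nat D) ->
  (\prod_(p <- primes m) p <= N.to_nat B)%N -> (4 * q * N.to_nat Q <= q.+1 ^ 2)%N ->
  exists_tail (test1 scale 0 0 Q)%num 1%num (tails_N scale (cover_N (N.size_nat B) T D B)) -> good.
Proof.
move=> T0 sD aD DM MB hQ; have : (0 < N.to_nat scale)%N by [].
move: scale => S S0 /exists_tailP [k]; rewrite /test1 N.mul_1_r; case: ifP => // h1 h2.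
have Bfuel := size_nat_bound B.
set cov := cover_N _ _ _ _ in h1 h2.
have covE : map N.to_nat (drop k cov) = drop k (cover (N.size_nat B) (N.to_nat T) (map N.to_nat D) (N.to_nat B)).
  by rewrite map_drop cover_NE.
have hr := cover_rec_sum sD aD T0 DM MB Bfuel (N.to_nat S) k.
have hs := cover_size sD aD T0 DM MB Bfuel k.
rewrite -covE in hr hs; rewrite size_map in hs; rewrite -/(rec_nat S (drop k cov)) in hr.
move: h1; rewrite !to_natE Nat2N.id addn0 => h1.
apply: (quartic_nat (primes_of_take_drop m k) (@primes_take_drop_complete m m_gt0 k) S0 _ _ hr _ hs hQ (k := k) (dd := (N.to_nat S - rec_nat S (drop k cov))%N)).
- by rewrite subnKC // ltnW.
- by rewrite subn_gt0.
- by rewrite size_take; case: ltnP => // /ltnW.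
by move: h2; rewrite !to_natE !Nat2N.id !addn0.
Qed.

Let odd_prime_dvd p : prime p -> (p %| m)%N -> (p < 256)%N -> p \in map N.to_nat odd_primes.
Proof. by move=> pp pm; apply: odd_primesP => //; apply: dvdn_odd pm m_odd. Qed.

Let odd_prime_dvd32 p : prime p -> (p %| m)%N -> (p < 32)%N -> p \in map N.to_nat (take 10 odd_primes).
Proof.
move=> pp pm p32; have p256 : (p < 256)%N by apply: leq_trans p32 _.
have := odd_prime_dvd pp pm p256.
by rewrite -{1}(cat_take_drop 10 odd_primes) map_cat mem_cat => /orP [//|/(allP (isT : all (leq 32) (map N.to_nat (drop 10 odd_primes))))]; rewrite leqNgt p32.
Qed.

Let odd_sorted : [/\ sorted ltn (map N.to_nat odd_primes), all (fun d => 0 < d < N.to_nat 256)%N (map N.to_nat odd_primes),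
  sorted ltn (map N.to_nat (take 10 odd_primes)) & all (fun d => 0 < d < N.to_nat 32)%N (map N.to_nat (take 10 odd_primes))].
Proof. by vm_compute. Qed.

Let m_le : (2 * m <= q ^ 3)%N.
Proof.
have [ME _] := proj_order4_odd_part q4; rewrite -(leq_pmul2l (isT : 0 < 2)%N) mulnA -ME proj_order4 -/q.
have : (5 <= q)%N by move: q1 q4; move: q => k; clear; case: k => [|[|[|[|[|k]]]]].
move=> h; have [d ->] : exists d, q = (d + 5)%N by exists (q - 5)%N; rewrite subnK.
by rewrite !expnS expn0; clear; nia.
Qed.

Lemma good_quartic_range (lo hi : N) : (N.to_nat lo <= q < N.to_nat hi)%N -> quartic_range lo hi -> good.
Proof.
move=> /andP [h1 h2]; have [sD aD _ _] := odd_sorted; apply: quartic_sound => //.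
  apply: leq_trans (prod_primes_le m_gt0) _; rewrite !to_natE leq_divRL // mulnC (leq_trans m_le) //.
  by rewrite leq_exp2r // ltnW.
rewrite !to_natE mulnAC; apply: leq_trans (_ : q * q <= _)%N; last by rewrite expnS expn1 leq_mul.
by rewrite leq_mul2r (leq_trans _ h1) ?orbT // mulnC leq_divM.
Qed.

Lemma good_quartic_individual (T : N) ps : (0 < N.to_nat T)%N -> sorted ltn (map N.to_nat ps) ->
  all (fun d => 0 < d < N.to_nat T)%N (map N.to_nat ps) ->
  (forall p, prime p -> (p %| m)%N -> (p < N.to_nat T)%N -> p \in map N.to_nat ps) ->
  quartic_individual T ps (N.of_nat q) -> good.
Proof.
move=> T0 s0 a0 psP; rewrite /quartic_individual; set mN := (_ * _ / 4)%num; set D := [seq p <- _ | _]; set B := foldl _ _ _.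
have ME : N.to_nat mN = m.
  rewrite !to_natE Nat2N.id /m proj_order4 -/q (_ : N.to_nat 1 = 1%N) // !addn1 //.
have [B0 BE] : (0 < N.to_nat B)%N /\ primes (N.to_nat B) = primes (N.to_nat mN) by apply: stripP; rewrite ME.
apply: (quartic_sound T0).
- by apply: (subseq_sorted ltn_trans _ s0); apply: map_subseq; apply: filter_subseq.
- by apply/allP => d /mapP [r]; rewrite mem_filter => /andP [_ rs] ->; apply: (allP a0); apply: map_f.
- move=> p pp pm pT; have /mapP [r rs pr] := psP p pp pm pT.
  by apply/mapP; exists r => //; rewrite mem_filter rs andbT to_nat_eqb to_nat_mod ME -pr.
- by rewrite -ME -BE prod_primes_le.
rewrite !to_natE Nat2N.id; have : (4 * ((q + 2) %/ 4) <= q + 2)%N by rewrite mulnC leq_divM.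
by move: (_ %/ 4)%N => t h; rewrite mulnAC; apply: leq_trans (leq_mul h (leqnn q)) _; rewrite !expnS expn0; move: q => k; clear; lia.
Qed.

(** With all w primes in K the condition is 4 * 2^(2 w) <= q. Its fourth power follows from 256^w <=
    2^98 m and m <= q^3 once 2^(98 + 8) <= q. *)
Lemma good_quartic_large : (2 ^ 106 <= q)%N -> good.
Proof.
move=> hq; have [s0 a0 _ _] := odd_sorted.
have DT : all (fun d => d <= 256)%N (map N.to_nat odd_primes) by vm_compute.
have D0 : all (fun d => 0 < d)%N (map N.to_nat odd_primes) by vm_compute.
have TC : (256 ^ size (map N.to_nat odd_primes) <= 2 ^ 98 * \prod_(d <- map N.to_nat odd_primes) d)%N.
  have : (256 ^ N.of_nat (size odd_primes) <=? 2 ^ 98 * foldr N.mul 1 odd_primes)%num by vm_compute.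
  rewrite to_nat_leb to_nat_mul !to_nat_pow Nat2N.id size_map big_map.
  suff -> : N.to_nat (foldr N.mul 1%num odd_primes) = (\prod_(j <- odd_primes) N.to_nat j)%N by [].
  by elim: odd_primes => [|a l IH]; rewrite ?big_nil // big_cons /= to_nat_mul IH.
have DM : all (fun p => (p < 256)%N ==> (p \in map N.to_nat odd_primes)) (primes m).
  by apply/allP => p; rewrite mem_primes => /and3P [pp _ pm]; apply/implyP; apply: odd_prime_dvd.
have pD : (0 < \prod_(d <- map N.to_nat odd_primes) d)%N.
  by elim: (map _ _) D0 => [|d l IH]; rewrite ?big_nil // big_cons muln_gt0 => /andP [-> /IH].
have h1 := size_large_primes (primes_uniq m) DT DM.
have hs : (256 ^ size (primes m) <= 2 ^ 98 * m)%N.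
  rewrite -(leq_pmul2r pD); apply: leq_trans h1 _.
  by apply: leq_trans (leq_mul TC (prod_primes_le m_gt0)) _; rewrite mulnAC.
have pr := primes_of_take_drop m (size (primes m)).
have pc := @primes_take_drop_complete m m_gt0 (size (primes m)).
rewrite drop_size take_size in pr pc.
apply: (quartic_nat pr pc (isT : 0 < 1)%N (add0n 1) isT _ (leqnn _) (leqnn _) (Q := (q %/ 4)%N)).
- by rewrite /rec_sum big_nil mul0r.
- have : (4 * (q %/ 4) <= q)%N by rewrite mulnC leq_divM.
  move: (_ %/ 4)%N => t h; rewrite mulnAC; apply: leq_trans (leq_mul h (leqnn q)) _.
  by rewrite !expnS expn0; move: q => k; clear; lia.
rewrite exp1n !mul1n add0n muln1 -expnM [(_ * 2)%N]mulnC leq_divRL // (_ : 4 = 2 ^ 2)%N // -expnD -(@leq_exp2r _ _ 4) // -expnM.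
have -> : ((2 * size (primes m) + 2) * 4 = 8 * size (primes m) + 8)%N by clear; lia.
rewrite expnD expnM [(q ^ 4)%N]expnS; apply: (quartic_arith hs).
  by apply: leq_trans m_le; rewrite leq_pmull.
by rewrite -expnD.
Qed.

Lemma quartic_element : good.
Proof.
have [h16|h16] := ltnP q (2 ^ 16); last first.
  have [h106|] := leqP (2 ^ 106) q; first exact: good_quartic_large.
  rewrite (_ : 106 = 16 + 90)%N // => h; have [j jin jq] := dyadic_range h16 h.
  apply: (@good_quartic_range (2 ^ N.of_nat j)%num (2 ^ (N.of_nat j + 1))%num); last by apply: (allP quartic_ranges_tested (N.of_nat j)); apply: map_f.
  by rewrite !to_natE Nat2N.id addn1.
have [hf|hs] := leqP (2048 * 17) q.
  pose t := (q %/ 2048)%N.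
  have tin : N.of_nat t \in map N.of_nat (seq.iota 17 15).
    by apply: map_f; rewrite mem_iota leq_divRL // mulnC hf ltn_divLR.
  apply: (@good_quartic_range (2048 * N.of_nat t) (2048 * (N.of_nat t + 1)))%num; last exact: (allP quartic_fine_ranges_tested (N.of_nat t) tin).
  by rewrite !to_natE Nat2N.id mulnC leq_divM addn1 mulnC -ltn_divLR // ltnS leqnn.
have q5 : (5 <= q)%N by move: q1 q4; move: q => k; clear; case: k => [|[|[|[|[|k]]]]].
have [k qk] : exists k, q = (5 + 4 * k)%N by exists (q %/ 4 - 1)%N; move: q4 q5; move: q => t; clear; lia.
have : quartic_test (N.of_nat q).
  have [k13|k13] := ltnP k (2 ^ 13).
    have := quartic_scanP quartic_scanned k13; congr quartic_test; rewrite qk; clear; lia.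
  have k9 : (k - 2 ^ 13 < 2 ^ 9)%N.
    rewrite ltn_subLR // -(ltn_pmul2l (isT : 0 < 4)%N); apply: leq_ltn_trans (_ : q < _)%N; first by rewrite qk leq_addl.
    by apply: leq_trans hs _.
  have zE : N.of_nat (2 ^ 13) = 8192%num by rewrite (_ : 8192 = 2 ^ 13)%num //; apply: N2Nat.inj; rewrite Nat2N.id to_nat_pow.
  have := quartic_scanP quartic_scanned_upper k9; congr quartic_test; rewrite qk; move: (2 ^ 13)%N zE k13; clear; lia.
have [p [e [pc e0 qE]]] := finField_card_pX F; have pp := pcharf_prime pc.
(* The limit that [prime_power_testP] requires: p is odd and 3^11 > 2^16. *)
have e10 : (e <= 10)%N.
  have p3 : (3 <= p)%N.
    rewrite ltn_neqAle prime_gt1 // andbT; apply/eqP => p2; move: q4; rewrite /q qE -p2.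
    by case: e e0 {qE} => // e _; rewrite expnS; clear; lia.
  rewrite -ltnS -(@ltn_exp2l 3) //; apply: leq_ltn_trans (_ : q < _)%N; first by rewrite /q qE leq_exp2r.
  exact: leq_trans h16 _.
have ppt ps : all (fun r => prime (N.to_nat r)) ps -> prime_power_test ps (N.of_nat q).
  by move=> psP; apply: (prime_power_testP psP pp e0 e10); rewrite Nat2N.id.
have [s1 a1 s2 a2] := odd_sorted.
rewrite /quartic_test ppt //; case: ifP => [h _|_].
  exact: (good_quartic_individual _ s2 a2 odd_prime_dvd32 h).
rewrite ppt ?small_primes_prime //; case: ifP => [h _|_].
  exact: (certified_element iota (isT : 3 <= 4)%N cardL).
exact: (good_quartic_individual _ s1 a1 odd_prime_dvd).
Qed.
End QuarticTests.

Lemma primitive_2normal_finite_field (F L : finFieldType) (iota : {rmorphism F -> L}) n :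
  (0 < n)%N -> #|L| = (#|F| ^ n)%N ->
  (exists a : L, primitive_elt a /\ k_normal #|F| n 2 a) <->
  (((5 <= n)%N /\ gcdn (#|F| ^ 3 - #|F|) n != 1%N) \/ (n = 4%N /\ #|F| %% 4 = 1)%N).
Proof.
move=> n0 cardL; split=> [[a [ap ak]]|]; first exact: (primitive_2normal_necessary iota n0 cardL ap ak).
case=> [[n5 gc]|[n4 q4]]; last by rewrite n4 in cardL *; apply: (quartic_element iota cardL q4).
have [D [f [Df sD]]] := quadratic_divisor_exists n0 gc.
have [//|ex] := criterion_or_exception iota n5 cardL Df sD gc.
apply: (certified_element iota _ cardL); first exact: leq_trans n5.
exact: exceptions_certified.
Qed.

(* F = F_q (any finite field, q = #|F| ranges over all prime powers),
   L = F_{q^n} (any extension of F of degree n = dim_F L). *)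
Theorem theorem1p2 (F : finFieldType) (L : fieldExtType F) (q n : nat) :
  q = #|F| -> n = \dim {:L} -> (0 < n)%N ->
  (exists a : L, primitive_elt a /\ k_normal q n 2 a) <->
  (((5 <= n)%N /\ gcdn (q ^ 3 - q) n != 1%N) \/ (n = 4%N /\ q %% 4 = 1)%N).
Proof.
move=> -> -> n0; pose L' : finFieldType := finvect_type L.
have cardL : #|L'| = (#|F| ^ \dim {:L})%N.
  by rewrite -(@card_vspacef F L' (Vector.class L)) card_vspace.
exact: (@primitive_2normal_finite_field F L' (in_alg L) _ n0 cardL).
Qed.
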